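(* Let $N\ge2$ be a fixed integer and let $R>0$. Then there is a constant $A_R>0$ depending only on $R$ such that for any potentials $\mathrm q=[q_j]_{j=1}^N$ and $\tilde{\mathrm q}=[\tilde q_j]_{j=1}^N$ on the star-graph satisfying $$\omega_j=\tilde\omega_j,\quad j=1,\dots,N,\qquad \|\mathrm q\|<R,\qquad\|\tilde{\mathrm q}\|<R,$$ the following estimate holds: $$\|\mathrm q-\tilde{\mathrm q}\|\le A_R\,\varepsilon,\qquad \varepsilon:=\big\|\rho^N\big(\Delta(\rho^2)-\tilde\Delta(\rho^2)\big)\big\|_{L_2(\mathbb R)}+\sum_{k=2}^N\big\|\rho^{N-1}\big(\Delta_k(\rho^2)-\tilde\Delta_k(\rho^2)\big)\big\|_{L_2(\mathbb R)},$$ where the $L_2(\mathbb R)$-norms are taken with respect to $\rho\in\mathbb R$.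
   Context: Star-graph with $N$ edges of length $\pi$ ($N\ge2$ fixed). A potential is a vector function $\mathrm q=[q_j]_{j=1}^N$ with complex-valued $q_j\in L_2(0,\pi)$, with norm $\|\mathrm q\|=\max_{1\le j\le N}\|q_j\|_{L_2(0,\pi)}$. Put $\omega_j=\frac12\int_0^\pi q_j(t)\,dt$. For $j=1,\dots,N$ let $S_j(x,\lambda)$, $C_j(x,\lambda)$ be the solutions of $-y''+q_j(x)y=\lambda y$ on $(0,\pi)$ with $S_j(0,\lambda)=C_j'(0,\lambda)=0$, $S_j'(0,\lambda)=C_j(0,\lambda)=1$ (prime is the derivative in $x$). The characteristic functions are the entire functions of $\lambda$ (all $S_j,S_j',C_j,C_j'$ evaluated at $(\pi,\lambda)$; product indices $l$ range over $\{1,\dots,N\}$ with the indicated exclusions, empty sums are $0$, empty products are $1$) $$\Delta(\lambda)=C_1\prod_{l=2}^NS_l+\sum_{j=2}^NS_j'\prod_{l\ne j}S_l,$$ $$\Delta_k(\lambda)=C_k\Big(C_1\prod_{l\ne1,k}S_l+\sum_{j\ne1,k}S_j'\prod_{l\ne j,k}S_l\Big)+C_k'\prod_{l\ne k}S_l,\qquad k=2,\dots,N.$$ They are the characteristic functions of the boundary value problems for the system $-y_j''+q_jy_j=\lambda y_j$ ($j=1,\dots,N$) with the matching conditions $y_1(0)=y_j(\pi)$ ($j=2,\dots,N$), $y_1'(0)=\sum_{j=2}^Ny_j'(\pi)$ and, respectively, the boundary conditions $y_1(\pi)=0$, $y_j(0)=0$ ($j=2,\dots,N$) for $\Delta$,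 and $y_1(\pi)=0$, $y_j(0)=0$ ($j\in\{2,\dots,N\}\setminus\{k\}$), $y_k'(0)=0$ for $\Delta_k$. Objects with a tilde are the same objects constructed from $\tilde{\mathrm q}$. *)

(* Defs.v *)
From HB Require Import structures.
From mathcomp Require Import all_boot all_order all_algebra.
From mathcomp Require Import complex.
From mathcomp Require Import all_classical all_reals all_analysis.

Set Implicit Arguments.
Unset Strict Implicit.
Unset Printing Implicit Defensive.

Import Order.TTheory GRing.Theory Num.Theory.
Import numFieldNormedType.Exports.

Local Open Scope classical_set_scope.
Local Open Scope ring_scope.

Section ComplexValued.
Variable R : realType.
Implicit Types (f g : R -> R[i]) (D : set R).

(* The norm `|z| of R[i] takes its values in R[i]; this is the same modulus,
   with values in R. *)
Definition cmod (z : R[i]) : R := Normc.normc z.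

Definition cmeasurable D f : Prop :=
  measurable_fun D (fun x => complex.Re (f x)) /\
  measurable_fun D (fun x => complex.Im (f x)).

Definition cintegral D f : R[i] :=
  Complex (\int[lebesgue_measure]_(x in D) complex.Re (f x))
          (\int[lebesgue_measure]_(x in D) complex.Im (f x)).

Definition L2norm D f : \bar R :=
  Lnorm lebesgue_measure 2%:E (fun x => (\1_D x * cmod (f x))%:E).

Definition inL2 D f : Prop := cmeasurable D f /\ (L2norm D f < +oo)%E.

(* f is differentiable at the real point x, with derivative v; R[i] is not a
   normed R-module in the library, hence the componentwise definition. *)
Definition has_cderive f (x : R) (v : R[i]) : Prop :=
  is_derive x (1 : R) (fun t => complex.Re (f t) : R) (complex.Re v) /\
  is_derive x (1 : R) (fun t => complex.Im (f t) : R) (complex.Im v).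

Definition absolutely_continuous (a b : R) f : Prop :=
  forall e : R, 0 < e -> exists2 d : R, 0 < d &
    forall (n : nat) (s t : 'I_n -> R),
      (forall i, [/\ a <= s i, s i <= t i & t i <= b]) ->
      trivIset [set: 'I_n] (fun i => [set` `]s i, t i[]) ->
      \sum_(i < n) (t i - s i) < d ->
      \sum_(i < n) cmod (f (t i) - f (s i)) < e.

End ComplexValued.

Section StarGraph.
Variable R : realType.

Definition edge : set R := [set` `]0, pi[].

(* y solves - y'' + q y = lambda y on (0, pi) in the sense of Caratheodory:
   y and y' are absolutely continuous on [0, pi] and the equation holds almost
   everywhere. The function dy is y' on (0, pi); by continuity, dy 0 and dy pi
   are the values of y' at the end points. *)
Definition SL_solution (q : R -> R[i]) (lambda : R[i]) (y dy : R -> R[i]) : Prop :=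
  [/\ absolutely_continuous 0 pi y,
      absolutely_continuous 0 pi dy,
      forall x, edge x -> has_cderive y x (dy x) &
      {ae (@lebesgue_measure R), forall x, edge x ->
        exists2 d2y : R[i], has_cderive dy x d2y &
          - d2y + q x * y x = lambda * y x}].

(* The solutions S, C of one edge with their x-derivatives, as functions of
   (x, lambda). For q in L2(0, pi) they exist and, for x in [0, pi], are unique. *)
Record edge_solutions (q : R -> R[i]) := EdgeSolutions {
  solS : R -> R[i] -> R[i];
  dsolS : R -> R[i] -> R[i];
  solC : R -> R[i] -> R[i];
  dsolC : R -> R[i] -> R[i];
  solS_eq : forall lambda, SL_solution q lambda (solS^~ lambda) (dsolS^~ lambda);
  solC_eq : forall lambda, SL_solution q lambda (solC^~ lambda) (dsolC^~ lambda);
  solS_init : forall lambda, solS 0 lambda = 0 /\ dsolS 0 lambda = 1;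
  solC_init : forall lambda, solC 0 lambda = 1 /\ dsolC 0 lambda = 0 }.

Variable N : nat.
Implicit Types (q : 'I_N -> R -> R[i]).

Definition is_potential q : Prop := forall j, inL2 edge (q j).

Definition potential_norm q : \bar R :=
  \big[Order.max/0%E]_(j < N) L2norm edge (q j).

Definition omega q (j : 'I_N) : R[i] := 2^-1 * cintegral edge (q j).

(* The edges are indexed by 'I_N; o stands for the distinguished edge, the one
   numbered 1 when the edges are numbered from 1 to N. *)
Section Characteristic.
Variables (o : 'I_N) (q : 'I_N -> R -> R[i]) (Y : forall j, edge_solutions (q j)).
Variable lambda : R[i].

Let S j := solS (Y j) pi lambda.
Let S' j := dsolS (Y j) pi lambda.
Let C j := solC (Y j) pi lambda.
Let C' j := dsolC (Y j) pi lambda.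

Definition Delta : R[i] :=
  C o * \prod_(l | l != o) S l
  + \sum_(j | j != o) S' j * \prod_(l | l != j) S l.

Definition DeltaK (k : 'I_N) : R[i] :=
  C k * (C o * \prod_(l | (l != o) && (l != k)) S l
         + \sum_(j | (j != o) && (j != k))
             S' j * \prod_(l | (l != j) && (l != k)) S l)
  + C' k * \prod_(l | l != k) S l.

End Characteristic.

Definition spectral_distance (o : 'I_N) (q qt : 'I_N -> R -> R[i])
    (Y : forall j, edge_solutions (q j)) (Yt : forall j, edge_solutions (qt j)) :
    \bar R :=
  (L2norm setT (fun rho : R => let z := real_complex R rho in
     z ^+ N * (Delta o Y (z ^+ 2) - Delta o Yt (z ^+ 2)))%R
   + \sum_(k < N | k != o) L2norm setT (fun rho : R => let z := real_complex R rho in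
     z ^+ N.-1 * (DeltaK o Y (z ^+ 2) k - DeltaK o Yt (z ^+ 2) k))%R)%E.

End StarGraph.

(* Main.v *)
Require Import Defs.
From mathcomp Require Import all_boot all_order all_algebra.
From mathcomp Require Import complex.
From mathcomp Require Import all_classical all_reals all_analysis.
From mathcomp Require Import measurable_realfun ring lra.

(* Everything happens on the real line of rho, lambda = rho ^+ 2. For k <> 1 let psi_k be the
   solution of edge k with Cauchy data (Delta, - Delta_k) at 0, and let chi be the solution of
   edge 1 that vanishes at pi. The Lagrange identity turns
   G_k = Delta_k Delta~ - Delta Delta~_k into
     int (q_k - q~_k) psi_k psi~_k + Pi Pi~ int (q_1 - q~_1) chi chi~
       + sum_j P_j P~_j int (q_j - q~_j) S_j S~_j,
   where Pi and the P_j are products of values S_l(pi). Writing G_k as a combination of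
   Delta - Delta~ and Delta_k - Delta~_k with bounded coefficients bounds the L2 norm of
   rho ^+ (2 N - 2) G_k by the spectral distance.
   As functions of rho, the solutions are superpositions of the exponentials exp(i s rho) with
   s bounded below, and the exponents of rho ^+ (2 N - 2) psi_k(x) psi~_k(x) start at 2 x - 2 N pi,
   with an explicit nonzero leading coefficient, while those of all other terms of G_k start at
   2 pi - 2 N pi. So the part of q_k - q~_k on (0, a) is seen, modulo higher exponents and an
   O(1/rho) remainder, as a Fourier transform supported below the other terms; the restriction
   to low frequencies (through Poisson kernels) bounds its norm, and finitely many short steps
   in a exhaust (0, pi). This gives q_k - q~_k for k <> 1; subtracting these terms, which are
   bounded in L2 because the omegas agree, leaves the term of edge 1, treated in the same way. *)

(** All constants may depend on N and the radius R only. Functions of rho are therefore kept in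
    classes with explicit constants: [spec] (lowest exponent, total mass) and [front] (leading
    exponential, gap to the next exponents, O(1/rho) error). These are stable under products,
    integrals and limits of Picard iterates. The main obstacle is the O(1/rho) remainder: its L2
    norm is of the size of the L1 norm of the unknown difference, so it is not smaller than what is
    to be bounded. Over a window of length l, Cauchy-Schwarz yields a factor sqrt l; for l small
    compared with the constants, the share of the new window is absorbed, and the number of windows
    depends on these constants alone. The leading coefficient of psi_k is N/2 times (i/2)^(N-1): the
    N edges contribute with the same sign and cannot cancel. Equality of the omegas matters when
    known terms are moved to the other side: a product of two solutions contains a part constant in
    x, whose coefficient is bounded in rho but not square integrable, and which multiplies the
    integral of q - q~. *)

Set Implicit Arguments.
Unset Strict Implicit.
Unset Printing Implicit Defensive.

Import Order.TTheory GRing.Theory Num.Theory.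
Import numFieldNormedType.Exports.

Local Open Scope classical_set_scope.
Local Open Scope ring_scope.

Local Notation ReC := complex.Re.
Local Notation ImC := complex.Im.

(** * Complex-valued functions of a real variable *)

Section ComplexModulus.
Variable R : realType.
Implicit Types (z w : R[i]) (x : R).

Lemma cmod_ge0 z : 0 <= cmod z.
Proof. by case: z => a b; rewrite /cmod /= sqrtr_ge0. Qed.

Lemma cmod0 : cmod (0 : R[i]) = 0.
Proof. exact: Normc.normc0. Qed.

Lemma cmod1 : cmod (1 : R[i]) = 1.
Proof. exact: Normc.normc1. Qed.

Lemma cmod_eq0 z : cmod z = 0 -> z = 0.
Proof. exact: Normc.eq0_normc. Qed.

Lemma cmodM z w : cmod (z * w) = cmod z * cmod w.
Proof. exact: Normc.normcM. Qed.

Lemma cmodD z w : cmod (z + w) <= cmod z + cmod w.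
Proof. exact: le_normcD. Qed.

Lemma cmodN z : cmod (- z) = cmod z.
Proof. exact: normcN. Qed.

Lemma cmodB z w : cmod (z - w) <= cmod z + cmod w.
Proof. by rewrite (le_trans (cmodD _ _))// cmodN. Qed.

Lemma cmod_distC z w : cmod (z - w) = cmod (w - z).
Proof. by rewrite -opprB cmodN. Qed.

Lemma sqr_cmod z : cmod z ^+ 2 = ReC z ^+ 2 + ImC z ^+ 2.
Proof. by case: z => a b; rewrite /cmod /= sqr_sqrtr// addr_ge0// sqr_ge0. Qed.

Lemma cmod_real x : cmod (real_complex R x) = `|x|.
Proof. by rewrite /cmod /= expr0n/= addr0 sqrtr_sqr. Qed.

Lemma cmod_conj z : cmod (z^*)%C = cmod z.
Proof. by case: z => a b; rewrite /cmod /= sqrrN. Qed.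

Lemma ler_cmod_sqr z x : 0 <= x -> (cmod z <= x) = (ReC z ^+ 2 + ImC z ^+ 2 <= x ^+ 2).
Proof. by move=> x0; rewrite -sqr_cmod ler_sqr// nnegrE ?cmod_ge0. Qed.

Lemma Re_le_cmod z : `|ReC z| <= cmod z.
Proof.
rewrite -ler_sqr ?nnegrE ?cmod_ge0//.
by rewrite sqr_cmod real_normK ?num_real// lerDl sqr_ge0.
Qed.

Lemma Im_le_cmod z : `|ImC z| <= cmod z.
Proof.
rewrite -ler_sqr ?nnegrE ?cmod_ge0//.
by rewrite sqr_cmod real_normK ?num_real// lerDr sqr_ge0.
Qed.

Lemma cmod_le_ReIm z : cmod z <= `|ReC z| + `|ImC z|.
Proof.
rewrite ler_cmod_sqr ?addr_ge0// sqrrD !real_normK ?num_real//.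
by rewrite -addrA lerD2l lerDr mulrn_wge0// mulr_ge0.
Qed.

Lemma Re_add z w : ReC (z + w) = ReC z + ReC w. Proof. by case: z; case: w. Qed.
Lemma Im_add z w : ImC (z + w) = ImC z + ImC w. Proof. by case: z; case: w. Qed.
Lemma Re_opp z : ReC (- z) = - ReC z. Proof. by case: z. Qed.
Lemma Im_opp z : ImC (- z) = - ImC z. Proof. by case: z. Qed.
Lemma Re_mul z w : ReC (z * w) = ReC z * ReC w - ImC z * ImC w.
Proof. by case: z; case: w. Qed.
Lemma Im_mul z w : ImC (z * w) = ReC z * ImC w + ImC z * ReC w.
Proof. by case: z; case: w. Qed.

Lemma complexP z w : ReC z = ReC w -> ImC z = ImC w -> z = w.
Proof. by case: z; case: w => a b c d /= -> ->. Qed.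

Lemma conjM_cmod z : (z^*)%C * z = real_complex R (cmod z ^+ 2).
Proof.
by apply: complexP; rewrite ?Re_mul ?Im_mul /= ?sqr_cmod; case: z => a b /=; ring.
Qed.

(** The exponential exp(i x). *)
Definition cis x : R[i] := Complex (cos x) (sin x).

Lemma cisD x y : cis (x + y) = cis x * cis y.
Proof.
by apply: complexP; rewrite ?Re_mul ?Im_mul/= ?cosD ?sinD//; ring.
Qed.

Lemma cis0 : cis 0 = 1.
Proof. by rewrite /cis cos0 sin0. Qed.

Lemma cmod_cis x : cmod (cis x) = 1.
Proof. by rewrite /cmod /= cos2Dsin2 sqrtr1. Qed.

Lemma conj_cis x : (cis x)^*%C = cis (- x).
Proof. by rewrite /cis /= cosN sinN. Qed.

End ComplexModulus.

(** * Measurability of complex-valued functions *)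

Section CMeas.
Variables (R : realType) (d : measure_display) (T : measurableType d).
Implicit Types (f g : T -> R[i]).

Definition cmeas f := measurable_fun setT (fun x => ReC (f x)) /\
  measurable_fun setT (fun x => ImC (f x)).

Lemma cmeas_cst (c : R[i]) : cmeas (fun=> c).
Proof. by split; exact: measurable_cst. Qed.

Lemma cmeas_real (h : T -> R) : measurable_fun setT h -> cmeas (fun x => real_complex R (h x)).
Proof. by move=> mh; split => //=; exact: measurable_cst. Qed.

Lemma cmeasD f g : cmeas f -> cmeas g -> cmeas (fun x => f x + g x).
Proof.
move=> [f1 f2] [g1 g2]; split.
- by under eq_fun do rewrite Re_add; exact: measurable_funD.
- by under eq_fun do rewrite Im_add; exact: measurable_funD.
Qed.

Lemma cmeasN f : cmeas f -> cmeas (fun x => - f x).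
Proof.
move=> [f1 f2]; split.
- by under eq_fun do rewrite Re_opp; exact: measurableT_comp.
- by under eq_fun do rewrite Im_opp; exact: measurableT_comp.
Qed.

Lemma cmeasB f g : cmeas f -> cmeas g -> cmeas (fun x => f x - g x).
Proof. by move=> mf mg; apply: cmeasD => //; exact: cmeasN. Qed.

Lemma cmeasM f g : cmeas f -> cmeas g -> cmeas (fun x => f x * g x).
Proof.
move=> [f1 f2] [g1 g2]; split.
- by under eq_fun do rewrite Re_mul; apply: measurable_funB; exact: measurable_funM.
- by under eq_fun do rewrite Im_mul; apply: measurable_funD; exact: measurable_funM.
Qed.

Lemma cmeas_conj f : cmeas f -> cmeas (fun x => (f x)^*%C).
Proof.
move=> [f1 f2]; split.
- by rewrite [X in measurable_fun _ X](_ : _ = fun x => ReC (f x))//; apply/funext => x; case: (f x).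
- rewrite [X in measurable_fun _ X](_ : _ = fun x => - ImC (f x)); first exact: measurableT_comp.
  by apply/funext => x; case: (f x).
Qed.

Lemma cmeas_cmod f : cmeas f -> measurable_fun setT (fun x => cmod (f x)).
Proof.
move=> [f1 f2].
rewrite [X in measurable_fun _ X](_ : _ = fun x => Num.sqrt (ReC (f x) ^+ 2 + ImC (f x) ^+ 2)).
  apply: measurableT_comp; first exact: continuous_measurable_fun (@sqrt_continuous R).
  by apply: measurable_funD; exact: measurable_funX.
by apply/funext => x; rewrite -sqr_cmod sqrtr_sqr ger0_norm ?cmod_ge0.
Qed.

Lemma cmeas_cis (h : T -> R) : measurable_fun setT h -> cmeas (fun x => cis (h x)).
Proof.
move=> mh; split => /=.
- by apply: measurableT_comp => //; exact: continuous_measurable_fun (@continuous_cos R).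
- by apply: measurableT_comp => //; exact: continuous_measurable_fun (@continuous_sin R).
Qed.

Lemma eq_cmeas f g : f =1 g -> cmeas f -> cmeas g.
Proof. by move=> /funext ->. Qed.

End CMeas.

Lemma cmeas_comp (R : realType) (d d' : measure_display) (T : measurableType d)
    (T' : measurableType d') (h : T -> T') (f : T' -> R[i]) :
  measurable_fun setT h -> cmeas f -> cmeas (fun x => f (h x)).
Proof. by move=> mh [f1 f2]; split; [exact: (measurableT_comp f1 mh)|exact: (measurableT_comp f2 mh)]. Qed.

(** * Integration of complex-valued functions over the real line *)

Section CIntegral.
Variable R : realType.
Local Notation mu := (@lebesgue_measure R).
Implicit Types (f g : R -> R[i]) (h k : R -> R).

Definition rintegrable h := mu.-integrable setT (EFin \o h).
Definition cintegrable f := rintegrable (fun x => ReC (f x)) /\ rintegrable (fun x => ImC (f x)).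
Local Notation cint f := (cintegral setT f).

Lemma rintegrable_meas h : rintegrable h -> measurable_fun setT h.
Proof. by move=> /measurable_int/measurable_EFinP. Qed.

Lemma rintegrable_dom h k : measurable_fun setT k -> rintegrable h ->
  (forall x, `|k x| <= h x) -> rintegrable k.
Proof.
move=> mk ih kh; apply: (le_integrable measurableT _ _ ih); first exact/measurable_EFinP.
by move=> x _ /=; rewrite lee_fin (le_trans (kh x))// ler_norm.
Qed.

Lemma rintegrableD h k : rintegrable h -> rintegrable k -> rintegrable (fun x => h x + k x).
Proof. by move=> ih ik; exact: (integrableD measurableT ih ik). Qed.

Lemma rintegrableZ c h : rintegrable h -> rintegrable (fun x => c * h x).
Proof. by move=> ih; exact: (integrableZl measurableT c ih). Qed.

Lemma rintegrableB h k : rintegrable h -> rintegrable k -> rintegrable (fun x => h x - k x).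
Proof. by move=> ih ik; exact: (integrableB measurableT ih ik). Qed.

Lemma rintegrable0 : rintegrable (fun=> 0).
Proof. exact: integrable0. Qed.

Lemma cintegrable_meas f : cintegrable f -> cmeas f.
Proof. by move=> [f1 f2]; split; exact: rintegrable_meas. Qed.

Lemma cintegrable_dom f h : cmeas f -> rintegrable h ->
  (forall x, cmod (f x) <= h x) -> cintegrable f.
Proof.
move=> [f1 f2] ih fh; split; apply: (rintegrable_dom _ ih) => // x.
- exact: le_trans (Re_le_cmod _) (fh x).
- exact: le_trans (Im_le_cmod _) (fh x).
Qed.

Lemma rintegrable_norm h : rintegrable h -> rintegrable (fun x => `|h x|).
Proof. by move=> ih; exact: integrable_norm ih. Qed.

Lemma rintegrable_cmod f : cintegrable f -> rintegrable (fun x => cmod (f x)).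
Proof.
move=> cf; have [f1 f2] := cf.
apply: (rintegrable_dom _ (rintegrableD (rintegrable_norm f1) (rintegrable_norm f2))).
  exact/cmeas_cmod/cintegrable_meas.
by move=> x; rewrite ger0_norm ?cmod_ge0//; exact: cmod_le_ReIm.
Qed.

Lemma cintegrableD f g : cintegrable f -> cintegrable g -> cintegrable (fun x => f x + g x).
Proof.
move=> [f1 f2] [g1 g2]; split.
- by under eq_fun do rewrite Re_add; exact: rintegrableD.
- by under eq_fun do rewrite Im_add; exact: rintegrableD.
Qed.

Lemma cintegrable_bM f g M : cmeas f -> (forall x, cmod (f x) <= M) -> cintegrable g ->
  cintegrable (fun x => f x * g x).
Proof.
move=> mf fM ig; apply: (cintegrable_dom _ (rintegrableZ M (rintegrable_cmod ig))).
  by apply: cmeasM => //; exact: cintegrable_meas.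
by move=> x; rewrite cmodM ler_wpM2r ?cmod_ge0.
Qed.

Lemma cintegrableZ c f : cintegrable f -> cintegrable (fun x => c * f x).
Proof. by move=> cf; apply: (@cintegrable_bM (fun=> c) _ (cmod c)) => //; exact: cmeas_cst. Qed.

Lemma cintegrableN f : cintegrable f -> cintegrable (fun x => - f x).
Proof. by move=> cf; under eq_fun do rewrite -mulN1r; exact: cintegrableZ. Qed.

Lemma cintegrableB f g : cintegrable f -> cintegrable g -> cintegrable (fun x => f x - g x).
Proof. by move=> cf cg; apply: cintegrableD => //; exact: cintegrableN. Qed.

Lemma eq_cint f g : f =1 g -> cint f = cint g.
Proof. by move=> /funext ->. Qed.

Lemma cint0 : cint (fun=> 0 : R[i]) = 0.
Proof. by rewrite /cintegral/= !Rintegral_cst// !mul0r. Qed.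

Lemma cintD f g : cintegrable f -> cintegrable g ->
  cint (fun x => f x + g x) = cint f + cint g.
Proof.
move=> [f1 f2] [g1 g2]; apply: complexP; rewrite ?Re_add ?Im_add /=.
- by under eq_Rintegral do rewrite Re_add; rewrite RintegralD.
- by under eq_Rintegral do rewrite Im_add; rewrite RintegralD.
Qed.

Lemma cintZ c f : cintegrable f -> cint (fun x => c * f x) = c * cint f.
Proof.
move=> [f1 f2]; apply: complexP; rewrite ?Re_mul ?Im_mul /=.
- under eq_Rintegral do rewrite Re_mul.
  by rewrite RintegralB//; [rewrite !RintegralZl|exact: rintegrableZ..].
- under eq_Rintegral do rewrite Im_mul.
  by rewrite RintegralD//; [rewrite !RintegralZl|exact: rintegrableZ..].
Qed.

Lemma cintZr c f : cintegrable f -> cint (fun x => f x * c) = cint f * c.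
Proof. by move=> cf; under eq_cint do rewrite mulrC; rewrite cintZ// mulrC. Qed.

Lemma cintN f : cintegrable f -> cint (fun x => - f x) = - cint f.
Proof. by move=> cf; under eq_cint do rewrite -mulN1r; rewrite cintZ// mulN1r. Qed.

Lemma cintB f g : cintegrable f -> cintegrable g ->
  cint (fun x => f x - g x) = cint f - cint g.
Proof. by move=> cf cg; rewrite cintD ?cintN//; exact: cintegrableN. Qed.

Lemma cintegrable_conj f : cintegrable f -> cintegrable (fun x => (f x)^*%C).
Proof.
move=> cf; apply: (cintegrable_dom _ (rintegrable_cmod cf)).
  exact/cmeas_conj/cintegrable_meas.
by move=> x; rewrite cmod_conj.
Qed.

Lemma cint_conj f : cintegrable f -> cint (fun x => (f x)^*%C) = (cint f)^*%C.
Proof.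
move=> [f1 f2]; apply: complexP => /=.
- by congr fine; apply: eq_integral => x _; case: (f x).
- rewrite -mulN1r -RintegralZl//; congr fine; apply: eq_integral => x _.
  by rewrite mulN1r; case: (f x).
Qed.

(* Rotate the integral onto the positive real axis and compare real parts. *)
Lemma cmod_cint f : cintegrable f -> cmod (cint f) <= \int[mu]_x cmod (f x).
Proof.
move=> cf; set I := cint f.
have [I0|I0] := eqVneq (cmod I) 0; first by rewrite I0 Rintegral_ge0// => x _; exact: cmod_ge0.
pose u : R[i] := (I^*)%C / real_complex R (cmod I).
have cI : cmod (real_complex R (cmod I)) = cmod I by rewrite cmod_real ger0_norm ?cmod_ge0.
have uI : u * I = real_complex R (cmod I).
  have -> : u * I = (I^*)%C * I / real_complex R (cmod I) by rewrite /u; ring.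
  rewrite conjM_cmod expr2 rmorphM.
  rewrite mulfK//; apply/eqP => /(congr1 (@cmod R)); rewrite cI cmod0; exact/eqP.
have cu : cmod u = 1.
  by apply: (mulIf I0); rewrite -cmodM uI cI mul1r.
have -> : cmod I = ReC (cint (fun x => u * f x)) by rewrite cintZ// -/I uI.
apply: le_Rintegral => //.
- by have [] := cintegrableZ u cf.
- exact: rintegrable_cmod.
- by move=> x _; rewrite (le_trans (ler_norm _))// (le_trans (Re_le_cmod _))// cmodM cu mul1r.
Qed.

Lemma cmod_cint_le f h : cmeas f -> rintegrable h -> (forall x, cmod (f x) <= h x) ->
  cmod (cint f) <= \int[mu]_x h x.
Proof.
move=> mf ih fh; have cf := cintegrable_dom mf ih fh.
apply: le_trans (cmod_cint cf) _; apply: le_Rintegral => //; exact: rintegrable_cmod.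
Qed.

End CIntegral.
Notation cint f := (cintegral setT f).

(** * Fubini for kernels dominated by a product, and joint measurability *)

Section Fubini.
Variable R : realType.
Local Notation mu := (@lebesgue_measure R).

Section RealFubini.
Variables (k : R -> R -> R) (a b : R -> R).
Hypothesis mk : measurable_fun setT (fun p : R * R => k p.1 p.2).
Hypotheses (ia : rintegrable a) (ib : rintegrable b).
Hypothesis kab : forall x y, `|k x y| <= a x * b y.

Let mk1 x : measurable_fun setT (k x).
Proof. exact: (measurableT_comp mk (pair1_measurable x)). Qed.

Let mk2 y : measurable_fun setT (k^~ y).
Proof. exact: (measurableT_comp mk (pair2_measurable y)). Qed.

Lemma rintegrable_sectionl x : rintegrable (k x).
Proof. by apply: (rintegrable_dom _ (rintegrableZ (a x) ib)) => //; exact: kab. Qed.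

Lemma rintegrable_sectionr y : rintegrable (k^~ y).
Proof.
apply: (rintegrable_dom _ (rintegrableZ (b y) ia)) => // x.
by rewrite mulrC; exact: kab.
Qed.

Let mE : measurable_fun setT (fun p : R * R => (k p.1 p.2)%:E).
Proof. exact/measurable_EFinP. Qed.

(** Tonelli: integrating the bound [a x * b y] first in y and then in x gives a finite value, which
    is integrability on the plane. *)
Let ik : (mu \x mu)%E.-integrable setT (fun p : R * R => (k p.1 p.2)%:E).
Proof.
apply: (iffRL (@integrable12ltyP _ _ _ _ R mu mu _ mE)) => /=.
have ia' := rintegrable_norm ia; have ib' := rintegrable_norm ib.
have le1 x : (\int[mu]_y `|(k x y)%:E| <= (`|a x| * \int[mu]_y `|b y|)%:E)%E.
  rewrite EFinM /Rintegral fineK; last first.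
    by have := ib'; move=> /(integrable_fin_num measurableT).
  rewrite -(integralZl measurableT ib'); apply: ge0_le_integral => //=.
  - by apply/measurable_EFinP; apply: measurableT_comp => //; exact: mk1.
  - apply/measurable_EFinP; apply: measurable_funM => //.
    exact: (rintegrable_meas ib').
  - by move=> y _; rewrite lee_fin (le_trans (kab x y))// -normrM ler_norm.
apply: le_lt_trans (_ : (\int[mu]_x ((`|a x| * \int[mu]_y `|b y|)%:E) < +oo)%E).
  apply: ge0_le_integral => //=.
  - by move=> x _; exact: integral_ge0.
  - have := @measurable_fun_fubini_tonelli_F _ _ _ _ _ mu (abse \o (fun p : R * R => (k p.1 p.2)%:E)).
    apply; last by move=> p; exact: abse_ge0.
    exact: measurableT_comp.
  - apply/measurable_EFinP; apply: measurable_funM => //.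
    exact: (rintegrable_meas ia').
  - by move=> x _; exact: le1.
have /integrableP[_ h] := rintegrableZ (\int[mu]_y `|b y|) ia'.
apply: le_lt_trans h; rewrite le_eqVlt; apply/orP; left; apply/eqP.
apply: eq_integral => x _ /=; congr EFin; rewrite [RHS]ger0_norm 1?mulrC//.
by rewrite mulr_ge0// Rintegral_ge0.
Qed.

Lemma rfubini_integrable : rintegrable (fun x => \int[mu]_y k x y).
Proof.
have := integrable_fubini_F ik; rewrite /fubini_F /rintegrable.
congr (is_true (_.-integrable _ _)); apply/funext => x /=.
by rewrite fineK//; have /(integrable_fin_num measurableT) := rintegrable_sectionl x.
Qed.

Lemma rfubini : \int[mu]_x \int[mu]_y k x y = \int[mu]_y \int[mu]_x k x y.
Proof.
have /= h := Fubini ik; rewrite /Rintegral; congr fine.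
transitivity (\int[mu]_x \int[mu]_y (k x y)%:E)%E.
  apply: eq_integral => x _; rewrite fineK//.
  by have /(integrable_fin_num measurableT) := rintegrable_sectionl x.
rewrite h; apply: eq_integral => y _; rewrite fineK//.
by have /(integrable_fin_num measurableT) := rintegrable_sectionr y.
Qed.

End RealFubini.

(** Tonelli measurability concerns nonnegative integrands, so the positive and negative parts are
    treated separately; their difference is measurable with values in the extended reals, and [fine]
    is measurable. *)
Lemma measurable_Rintegral (d : measure_display) (T : measurableType d) (k : R -> T -> R) :
  measurable_fun setT (fun p : R * T => k p.1 p.2) ->
  measurable_fun setT (fun z => \int[mu]_x k x z).
Proof.
move=> mk; pose f (p : R * T) := (k p.1 p.2)%:E.
have mf : measurable_fun setT f by apply/measurable_EFinP.
have mG (g : R * T -> \bar R) : measurable_fun setT g -> (forall p, (0 <= g p)%E) ->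
    measurable_fun setT (fun z => (\int[mu]_x g (x, z))%E).
  by move=> mg g0; exact: (measurable_fun_fubini_tonelli_G (m1 := mu) g mg g0).
apply: (@measurableT_comp _ _ _ _ _ _ fine); first exact: fine_measurable.
rewrite (_ : (fun z => _) = fun z => (\int[mu]_x f^\+ (x, z) - \int[mu]_x f^\- (x, z))%E).
  by apply: emeasurable_funB; apply: mG => //;
    [exact: measurable_funepos|exact: measurable_funeneg].
apply/funext => z; rewrite [LHS]integralE.
by congr (_ - _)%E; apply: eq_integral => x _; rewrite ?funeposE ?funenegE.
Qed.

Lemma cmeas_cint (d : measure_display) (T : measurableType d) (k : R -> T -> R[i]) :
  cmeas (fun p : R * T => k p.1 p.2) -> cmeas (fun z => cint (k^~ z)).
Proof.
move=> [m1 m2]; split; first exact: (@measurable_Rintegral _ _ (fun x z => ReC (k x z))).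
exact: (@measurable_Rintegral _ _ (fun x z => ImC (k x z))).
Qed.

Definition jmeas (E : R -> R -> R[i]) := cmeas (fun p : R * R => E p.1 p.2).

Section ComplexFubini.
Variables (F : R -> R -> R[i]) (a b : R -> R).
Hypothesis mF : jmeas F.
Hypotheses (ia : rintegrable a) (ib : rintegrable b).
Hypothesis Fab : forall x y, cmod (F x y) <= a x * b y.

Let Re_ab x y : `|ReC (F x y)| <= a x * b y.
Proof. exact: le_trans (Re_le_cmod _) (Fab x y). Qed.

Let Im_ab x y : `|ImC (F x y)| <= a x * b y.
Proof. exact: le_trans (Im_le_cmod _) (Fab x y). Qed.

Lemma cfubini_integrable : cintegrable (fun x => cint (F x)).
Proof.
by have [m1 m2] := mF; split => /=;
  [exact: (rfubini_integrable m1 ia ib Re_ab)|exact: (rfubini_integrable m2 ia ib Im_ab)].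
Qed.

Lemma cfubini : cint (fun x => cint (F x)) = cint (fun y => cint (F^~ y)).
Proof.
have [m1 m2] := mF; apply: complexP => /=;
  [exact: (rfubini m1 ia ib Re_ab)|exact: (rfubini m2 ia ib Im_ab)].
Qed.

End ComplexFubini.

Lemma jmeas1 (f : R -> R[i]) : cmeas f -> jmeas (fun x _ => f x).
Proof. by move=> mf; exact: (cmeas_comp (h := fst) measurable_fst mf). Qed.

Lemma jmeas2 (f : R -> R[i]) : cmeas f -> jmeas (fun _ y => f y).
Proof. by move=> mf; exact: (cmeas_comp (h := snd) measurable_snd mf). Qed.

Lemma jmeas_swap E : jmeas E -> jmeas (fun x y => E y x).
Proof.
move=> mE; apply: (cmeas_comp (h := fun p : R * R => (p.2, p.1)) _ mE).
by apply: measurable_fun_pair; [exact: measurable_snd|exact: measurable_fst].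
Qed.

Lemma jmeasD E F : jmeas E -> jmeas F -> jmeas (fun x y => E x y + F x y).
Proof. exact: cmeasD. Qed.

Lemma jmeasM E F : jmeas E -> jmeas F -> jmeas (fun x y => E x y * F x y).
Proof. exact: cmeasM. Qed.

Lemma jmeasB E F : jmeas E -> jmeas F -> jmeas (fun x y => E x y - F x y).
Proof. exact: cmeasB. Qed.

Lemma jmeas_secl E x : jmeas E -> cmeas (E x).
Proof.
move=> [m1 m2]; split.
- exact: (measurableT_comp m1 (pair1_measurable x)).
- exact: (measurableT_comp m2 (pair1_measurable x)).
Qed.

Lemma jmeas_secr E y : jmeas E -> cmeas (E^~ y).
Proof.
move=> [m1 m2]; split.
- exact: (measurableT_comp m1 (pair2_measurable y)).
- exact: (measurableT_comp m2 (pair2_measurable y)).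
Qed.

End Fubini.

(** * Superpositions of exponentials *)

Section SpecClass.
Variable R : realType.
Local Notation mu := (@lebesgue_measure R).
Implicit Types (E F g : R -> R[i]) (a b M : R).

Lemma integral_oneDsqrV : (\int[mu]_x ((oneDsqr x)^-1)%:E = (pi : R)%:E)%E.
Proof.
rewrite (@ge0_symfun_integralT R (fun x => (oneDsqr x)^-1)).
- rewrite -set_itvcy integral0y_oneDsqr -EFinM; congr EFin; lra.
- by move=> x; rewrite invr_ge0 (le_trans ler01).
- by move=> x; exact: continuous_oneDsqrV.
- by move=> x; rewrite /= /oneDsqr sqrrN.
Qed.

Lemma rintegrable_oneDsqrV : rintegrable (fun x : R => (oneDsqr x)^-1).
Proof.
apply/integrableP; split.
  by apply/measurable_EFinP; apply: continuous_measurable_fun => x; exact: continuous_oneDsqrV.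
under eq_integral => x _.
  rewrite /= ger0_norm; last by rewrite invr_ge0 (le_trans ler01).
  over.
by rewrite integral_oneDsqrV ltry.
Qed.

(** The bound on [h] is asked only where the weight is nonzero: solutions are controlled on the
    edge, and the weights, built from potentials, vanish outside it. *)
Lemma cintegrable_mulb (w : R -> R[i]) (h : R -> R[i]) M : cintegrable w -> cmeas h ->
  (forall x, w x != 0 -> cmod (h x) <= M) -> cintegrable (fun x => w x * h x).
Proof.
move=> iw mh hM; apply: (cintegrable_dom _ (rintegrableZ M (rintegrable_cmod iw))).
  by apply: cmeasM => //; exact: cintegrable_meas.
move=> x; rewrite cmodM mulrC; have [->|wx] := eqVneq (w x) 0; first by rewrite cmod0 !mulr0.
by rewrite ler_wpM2r ?cmod_ge0// hM.
Qed.

Lemma cmod_cint_mulb (w : R -> R[i]) (h : R -> R[i]) M : cintegrable w -> cmeas h ->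
  (forall x, w x != 0 -> cmod (h x) <= M) ->
  cmod (cint (fun x => w x * h x)) <= M * \int[mu]_x cmod (w x).
Proof.
move=> iw mh hM; rewrite -RintegralZl//; last exact: rintegrable_cmod.
apply: cmod_cint_le.
- by apply: cmeasM => //; exact: cintegrable_meas.
- exact/rintegrableZ/rintegrable_cmod.
move=> x; rewrite cmodM mulrC; have [->|wx] := eqVneq (w x) 0; first by rewrite cmod0 !mulr0.
by rewrite ler_wpM2r ?cmod_ge0// hM.
Qed.

Section ParametricIntegral.
Variables (w : R -> R[i]) (E : R -> R -> R[i]) (M : R).
Hypotheses (iw : cintegrable w) (mE : jmeas E).
Hypothesis EM : forall x r, w x != 0 -> cmod (E x r) <= M.

Lemma cmeas_cint_param : cmeas (fun r => cint (fun x => w x * E x r)).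
Proof.
apply: (@cmeas_cint _ _ _ (fun x r => w x * E x r)).
exact: (jmeasM (jmeas1 (cintegrable_meas iw)) mE).
Qed.

Lemma cfubini_param g : cintegrable g ->
  cint (fun r => cint (fun x => w x * E x r) * g r) =
  cint (fun x => w x * cint (fun r => E x r * g r)).
Proof.
move=> ig; pose F x r := w x * (E x r * g r).
have mF : jmeas F.
  apply: jmeasM; first exact/jmeas1/cintegrable_meas.
  by apply: jmeasM => //; exact/jmeas2/cintegrable_meas.
have hF x r : cmod (F x r) <= (M * cmod (w x)) * cmod (g r).
  rewrite /F !cmodM; have [->|wx] := eqVneq (w x) 0; first by rewrite cmod0 mul0r mulr0 mul0r.
  by rewrite mulrA ler_wpM2r ?cmod_ge0// mulrC ler_wpM2r ?cmod_ge0// EM.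
have := cfubini mF (rintegrableZ M (rintegrable_cmod iw)) (rintegrable_cmod ig) hF.
move=> h; transitivity (cint (fun r => cint (F^~ r))).
  apply: eq_cint => r; rewrite -cintZr; last first.
    by apply: (cintegrable_mulb iw (jmeas_secr r mE)) => x; exact: EM.
  by apply: eq_cint => x; rewrite /F mulrA.
rewrite -h; apply: eq_cint => x.
have [wx|wx] := eqVneq (w x) 0.
  by rewrite /F wx mul0r; under eq_cint do rewrite mul0r; rewrite cint0.
have ic : cintegrable (fun r => E x r * g r).
  by apply: (cintegrable_bM (jmeas_secl x mE) _ ig) => r; exact: EM.
by rewrite /F (cintZ _ ic).
Qed.

End ParametricIntegral.

(* A function E of the real variable r has spectrum in [a, +oo[ and total mass at most M.
   The dual formulation makes stability under products and integrals immediate. *)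
Definition spec a M E := [/\ cmeas E, (forall r, cmod (E r) <= M) &
  forall g c, cintegrable g ->
    (forall s, a <= s -> cmod (cint (fun r => cis (s * r) * g r)) <= c) ->
    cmod (cint (fun r => E r * g r)) <= M * c].

Lemma spec_meas a M E : spec a M E -> cmeas E. Proof. by case. Qed.

Lemma spec_bound a M E : spec a M E -> forall r, cmod (E r) <= M. Proof. by case. Qed.

Lemma spec_ge0 a M E : spec a M E -> 0 <= M.
Proof. by case=> _ /(_ 0) + _; exact: le_trans (cmod_ge0 _). Qed.

Lemma eq_spec a M E F : E =1 F -> spec a M E -> spec a M F.
Proof. by move=> /funext ->. Qed.

Lemma spec_le a M b M' E : b <= a -> M <= M' -> spec a M E -> spec b M' E.
Proof.
move=> ba MM' [mE bE sE]; split => // [r|g c ig hg]; first exact: le_trans (bE r) MM'.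
have c0 : 0 <= c by exact: le_trans (cmod_ge0 _) (hg b (lexx b)).
rewrite (le_trans _ (ler_wpM2r c0 MM'))//; apply: sE => // s as_.
by apply: hg; exact: le_trans as_.
Qed.

Lemma cintegrable_cisM (s : R) g : cintegrable g -> cintegrable (fun r => cis (s * r) * g r).
Proof.
move=> ig; apply: (@cintegrable_bM _ _ _ 1) => // [|x]; last by rewrite cmod_cis.
by apply: cmeas_cis; exact: mulrl_measurable.
Qed.

Lemma cmeas_cisl (s : R) : cmeas (fun r : R => cis (s * r)).
Proof. by apply: cmeas_cis; exact: mulrl_measurable. Qed.

Lemma spec_cis a s : a <= s -> spec a 1 (fun r => cis (s * r)).
Proof.
move=> as_; split => [|r|g c ig hg]; first exact: cmeas_cisl.
- by rewrite cmod_cis.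
- by rewrite mul1r hg.
Qed.

Lemma spec0 a : spec a 0 (fun=> 0).
Proof.
split => [|r|g c ig hg]; first exact: cmeas_cst; first by rewrite cmod0.
by under eq_cint do rewrite mul0r; rewrite cint0 cmod0 mul0r.
Qed.

(** Testing is done in two rounds. For fixed s, [F] is tested against exp(i s r) g, which bounds
    every exponential tested against F g; then [E] is tested against F g. Exponents add because
    exponentials multiply. *)
Lemma specM a b M M' E F : spec a M E -> spec b M' F ->
  spec (a + b) (M * M') (fun r => E r * F r).
Proof.
move=> sE sF; have M0 := spec_ge0 sE; have M'0 := spec_ge0 sF.
move: sE sF => [mE bE sE] [mF bF sF]; split => [|r|g c ig hg]; first exact: cmeasM.
  by rewrite cmodM ler_pM ?cmod_ge0.
under eq_cint do rewrite -mulrA.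
rewrite -mulrA; apply: sE; first exact: (@cintegrable_bM _ _ _ M').
move=> s as_; under eq_cint do rewrite mulrCA.
apply: sF; first exact: cintegrable_cisM.
move=> t bt; under eq_cint do rewrite mulrA -cisD -mulrDl.
by apply: hg; rewrite addrC lerD.
Qed.

Lemma specD a M M' E F : spec a M E -> spec a M' F ->
  spec a (M + M') (fun r => E r + F r).
Proof.
move=> [mE bE sE] [mF bF sF]; split => [|r|g c ig hg]; first exact: cmeasD.
  by rewrite (le_trans (cmodD _ _))// lerD.
under eq_cint do rewrite mulrDl.
rewrite cintD; [|exact: (cintegrable_bM mE bE)|exact: (cintegrable_bM mF bF)].
apply: le_trans (cmodD _ _) _; rewrite mulrDl.
by apply: lerD; [exact: sE|exact: sF].
Qed.

Lemma specZ a M E (c : R[i]) : spec a M E -> spec a (cmod c * M) (fun r => c * E r).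
Proof.
move=> [mE bE sE]; split => [|r|g e ig hg].
- by apply: cmeasM => //; exact: cmeas_cst.
- by rewrite cmodM ler_wpM2l// cmod_ge0.
under eq_cint do rewrite -mulrA.
rewrite cintZ; last exact: (cintegrable_bM mE bE).
rewrite cmodM -mulrA; apply: ler_wpM2l; first exact: cmod_ge0.
exact: sE.
Qed.

Lemma spec_cst (c : R[i]) : spec 0 (cmod c) (fun=> c).
Proof.
rewrite -[X in spec _ X]mulr1; have := specZ c (spec_cis (lexx 0)).
by apply: eq_spec => r; rewrite mul0r cis0 mulr1.
Qed.

Lemma specN a M E : spec a M E -> spec a M (fun r => - E r).
Proof.
move=> /(specZ (-1)); rewrite cmodN cmod1 mul1r.
by apply: eq_spec => r; rewrite mulN1r.
Qed.

Lemma specB a M M' E F : spec a M E -> spec a M' F -> spec a (M + M') (fun r => E r - F r).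
Proof. by move=> sE sF; apply: specD => //; exact: specN. Qed.

(** By Fubini, testing a weighted average against g averages the tested values, so the total mass is
    multiplied by the L1 norm of the weight. *)
Lemma spec_cint a M (w : R -> R[i]) (E : R -> R -> R[i]) : cintegrable w -> jmeas E ->
  (forall x, w x != 0 -> spec a M (E x)) ->
  spec a (M * \int[mu]_x cmod (w x)) (fun r => cint (fun x => w x * E x r)).
Proof.
move=> iw mE sE; have EM x r : w x != 0 -> cmod (E x r) <= M.
  by move=> wx; have [_ + _] := sE x wx; exact.
split => [|r|g c ig hg]; first exact: cmeas_cint_param.
- by apply: (cmod_cint_mulb iw (jmeas_secr r mE)) => x; exact: EM.
rewrite (cfubini_param iw mE EM ig) mulrAC.
have M'E x : w x * cint (fun r => E x r * g r) = cint (fun r => (w x * E x r) * g r).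
  have [wx|wx] := eqVneq (w x) 0.
    by rewrite wx mul0r; under eq_cint do rewrite !mul0r; rewrite cint0.
  under [RHS]eq_cint do rewrite -mulrA.
  have ic : cintegrable (fun r => E x r * g r).
    by apply: (cintegrable_bM (jmeas_secl x mE) _ ig) => r; exact: EM.
  by rewrite (cintZ _ ic).
have iF : cintegrable (fun x => w x * cint (fun r => E x r * g r)).
  under eq_fun do rewrite M'E.
  apply: (@cfubini_integrable _ (fun x r => w x * E x r * g r)
    (fun x => M * cmod (w x)) (fun r => cmod (g r))) => [||| x r].
  - apply: jmeasM; last exact/jmeas2/cintegrable_meas.
    by apply: jmeasM => //; exact/jmeas1/cintegrable_meas.
  - exact/rintegrableZ/rintegrable_cmod.
  - exact: rintegrable_cmod.
  rewrite !cmodM; have [->|wx] := eqVneq (w x) 0; first by rewrite cmod0 mul0r mulr0 mul0r.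
  by rewrite ler_wpM2r ?cmod_ge0// mulrC ler_wpM2r ?cmod_ge0// EM.
apply: le_trans (cmod_cint iF) _; rewrite -RintegralZl//; last exact: rintegrable_cmod.
apply: le_Rintegral => //; first exact: rintegrable_cmod.
  exact/rintegrableZ/rintegrable_cmod.
move=> x _; rewrite cmodM mulrC.
have [->|wx] := eqVneq (w x) 0; first by rewrite cmod0 !mulr0.
by rewrite ler_wpM2r ?cmod_ge0//; have [_ _] := sE x wx; exact.
Qed.

End SpecClass.

(** * Absolutely continuous functions *)

Section AbsolutelyContinuous.
Variable R : realType.
Local Notation mu := (@lebesgue_measure R).
Implicit Types (F G : R -> R[i]) (a b : R).

Lemma is_derive0_lip (f : R -> R) (x : R) : is_derive x (1 : R) f 0 ->
  forall e, 0 < e -> exists2 d, 0 < d & forall y, `|y - x| < d -> `|f y - f x| <= e * `|y - x|.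
Proof.
move=> [df f0] e e0.
have : h^-1 *: (f (h *: 1 + x) - f x) @[h --> 0^'] --> 'D_1 f x by exact: df.
rewrite f0 => /cvgr0Pnorm_le/(_ _ e0)[d /= d0 hd].
exists d => // y yd; have [->|yx] := eqVneq y x; first by rewrite !subrr normr0 mulr0.
have yx0 : y - x != 0 by rewrite subr_eq0.
have := hd (y - x) => /=; rewrite sub0r normrN => /(_ yd yx0).
rewrite /GRing.scale/= mulr1 subrK normrM normfV ler_pdivrMl ?normr_gt0//.
by rewrite mulrC.
Qed.

Lemma has_cderive0_lip F (x : R) : has_cderive F x 0 ->
  forall e, 0 < e -> exists2 d, 0 < d &
    forall y, `|y - x| < d -> cmod (F y - F x) <= e * `|y - x|.
Proof.
move=> [/is_derive0_lip h1 /is_derive0_lip h2] e e0; have e20 : 0 < e / 2 by lra.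
have [d1 d10 k1] := h1 _ e20; have [d2 d20 k2] := h2 _ e20.
exists (Num.min d1 d2); first by rewrite lt_min d10.
move=> y; rewrite lt_min => /andP[y1 y2]; apply: le_trans (cmod_le_ReIm _) _.
rewrite Re_add Im_add Re_opp Im_opp; apply: le_trans (lerD (k1 _ y1) (k2 _ y2)) _.
by rewrite -mulrDl -splitr.
Qed.

Section ZeroDerivative.
Variables (a b : R) (F : R -> R[i]).
Hypotheses (ab : a < b) (acF : absolutely_continuous a b F).
Hypothesis dF : {ae mu, forall x, a < x < b -> has_cderive F x 0}.

Section Chain.
Variables (e : R) (U : set R).

(* The increment of F up to x is controlled by slope e plus the increments over
   finitely many disjoint intervals inside U. *)
Definition chained x := exists n (s t : 'I_n -> R), [/\
  (forall i, [/\ a <= s i, s i <= t i & t i <= x]),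
  trivIset [set: 'I_n] (fun i => [set` `]s i, t i[]),
  (forall i, [set` `]s i, t i[] `<=` U) &
  cmod (F x - F a) <= e * (x - a) + \sum_(i < n) cmod (F (t i) - F (s i))].

Lemma chained_start : chained a.
Proof.
by exists 0%N, (fun=> 0), (fun=> 0); split=> [[]//|[]//|[]//|]; rewrite big_ord0 !subrr cmod0 mulr0 addr0.
Qed.

(** Both increments are compared with the same point z between u and v, because a small derivative
    at z controls only differences with F z. *)
Lemma chained_slope u z v : u <= z -> z <= v -> cmod (F u - F z) <= e * `|u - z| ->
  cmod (F v - F z) <= e * `|v - z| -> chained u -> chained v.
Proof.
move=> uz zv hu hv [n [s [t [st ts tU hF]]]]; exists n, s, t; split => // [i|].
  by have [? ? tu] := st i; split => //; exact: le_trans tu (le_trans uz zv).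
have -> : F v - F a = (F v - F z) - (F u - F z) + (F u - F a) by ring.
apply: le_trans (cmodD _ _) _; apply: le_trans (lerD (cmodB _ _) hF) _.
rewrite addrA lerD2r; apply: le_trans (lerD (lerD hv hu) (lexx _)) _.
by rewrite (ger0_norm (_ : 0 <= v - z)) ?subr_ge0// ler0_norm ?subr_le0//; lra.
Qed.

Lemma chained_cover u v : 0 <= e -> a <= u -> u <= v -> [set` `]u, v[] `<=` U -> chained u -> chained v.
Proof.
move=> e0 au uv uvU [n [s [t [st ts tU hF]]]].
(* The last index [ord_max] carries the new interval; it is disjoint from the earlier ones since
   those end at u or before. *)
pose s' (i : 'I_n.+1) := if unlift ord_max i is Some j then s j else u.
pose t' (i : 'I_n.+1) := if unlift ord_max i is Some j then t j else v.
exists n.+1, s', t'; split => [i||i|].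
- rewrite /s' /t'; case: unliftP => [j _|_] //.
  by have [? ? tu] := st j; split => //; exact: le_trans uv.
- have disj j y : [set` `]s j, t j[] y -> [set` `]u, v[] y -> False.
    rewrite /= !in_itv/= => /andP[_ yt] /andP[uy _].
    by have [_ _ tu] := st j; have := lt_trans uy yt; rewrite ltNge tu.
  move=> i j _ _ [y]; rewrite /s' /t'.
  case: unliftP => [i' ->|->]; case: unliftP => [j' ->|->] [yi yj] //.
  + by rewrite (ts i' j' I I)//; exists y.
  + by case: (disj _ _ yi yj).
  + by case: (disj _ _ yj yi).
- by rewrite /s' /t'; case: unliftP => [j _|_] //; exact: tU.
- rewrite big_ord_recr/=; have -> : s' ord_max = u by rewrite /s' unlift_none.
  have -> : t' ord_max = v by rewrite /t' unlift_none.
  under eq_bigr => i _.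
    rewrite /s' /t' (_ : widen_ord _ i = lift ord_max i); last first.
      by apply/val_inj; rewrite /= /bump leqNgt ltn_ord.
    rewrite liftK; over.
  have -> : F v - F a = (F u - F a) + (F v - F u) by ring.
  apply: le_trans (cmodD _ _) _; rewrite [leRHS]addrA lerD2r.
  by rewrite (le_trans hF)// lerD2r ler_wpM2l// lerD2r.
Qed.

Hypothesis oU : open U.
Hypothesis e0 : 0 < e.
Hypothesis aU : U a.
Hypothesis bU : U b.
Hypothesis goodU : forall x, a < x < b -> ~ U x -> has_cderive F x 0.

(** A step across z is paid either by an interval of U, when z is in U, or by slope e, when the
    derivative at z vanishes. The end points lie in U, so derivatives are needed only strictly
    inside. *)
Lemma chained_local z : a <= z <= b -> exists2 d, 0 < d &
  forall u v, a <= u -> u <= z -> z <= v -> v <= b -> z - d < u -> v < z + d -> chained u -> chained v.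
Proof.
move=> /andP[az zb]; have [Uz|Uz] := pselect (U z).
  have /nbhs_ballP[d /= d0 dU] : nbhs z U by exact: open_nbhs_nbhs.
  exists d => // u v au uz zv vb zu vz; apply: chained_cover => //; first exact: ltW.
    exact: le_trans zv.
  move=> y /=; rewrite in_itv/= => /andP[uy yv]; apply: dU.
  by rewrite /ball/= ltr_norml; apply/andP; split; lra.
have za : z != a by apply/eqP => zE; apply: Uz; rewrite zE.
have zb' : z != b by apply/eqP => zE; apply: Uz; rewrite zE.
have zab : a < z < b by rewrite !lt_def az zb za eq_sym zb'.
have [d d0 hd] := has_cderive0_lip (goodU zab Uz) e0.
exists d => // u v au uz zv vb zu vz; apply: (chained_slope uz zv); apply: hd.
- by rewrite ltr_norml; apply/andP; split; lra.
- by rewrite ltr_norml; apply/andP; split; lra.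
Qed.

(** A supremum argument takes the place of a covering theorem: some chained u lies just below the
    supremum c, and the local step through c goes beyond c unless c = b. *)
Lemma chained_end : chained b.
Proof.
pose S := [set x | a <= x <= b /\ chained x].
have Sa : S a by split; [rewrite lexx ltW|exact: chained_start].
have Sb x : S x -> x <= b by move=> [/andP[]].
have supS : has_sup S by split; [exists a|exists b].
pose c := sup S.
have ac : a <= c by apply: sup_upper_bound.
have cb : c <= b by apply: sup_le_ub; [exists a|].
have [d d0 hd] := chained_local (z := c) ltac:(by rewrite ac cb).
have [u [/andP[au ub] Qu] cu] := sup_adherent d0 supS.
have uc : u <= c by apply: sup_upper_bound => //; split => //; rewrite au ub.
have step v : c <= v -> v <= b -> v < c + d -> chained v.
  by move=> cv vb vd; exact: (hd u v).
have [cbE|cb'] := eqVneq c b; first by apply: step => //; lra.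
have {}cb' : c < b by rewrite lt_neqAle cb' cb.
pose v := Num.min b (c + d / 2).
have cv : c < v by rewrite lt_min cb'/= ltrDl; lra.
have vb : v <= b by rewrite ge_min lexx.
have vd : v < c + d by rewrite gt_min; apply/orP; right; lra.
have : v <= c.
  apply: sup_upper_bound => //; split; first by rewrite vb andbT (le_trans ac)// ltW.
  by apply: step => //; exact: ltW.
by rewrite leNgt cv.
Qed.

End Chain.

(** The exceptional null set and the two end points are covered by an open set of measure below the
    modulus d of absolute continuity. Increments over intervals inside that set sum to less than e,
    and the rest of the way has slope at most e. *)
Lemma ac_derive0 : F b = F a.
Proof.
suff h e : 0 < e -> cmod (F b - F a) <= e * (b - a + 1).
  have : cmod (F b - F a) <= 0.
    apply/ler_addgt0Pl => e e0; rewrite addr0.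
    have ba1 : 0 < b - a + 1 by rewrite ltr_wpDl// subr_ge0 ltW.
    have := h (e / (b - a + 1)); rewrite divfK ?gt_eqF//; apply.
    by rewrite divr_gt0.
  move=> h0; apply/eqP; rewrite -subr_eq0; apply/eqP; apply: cmod_eq0.
  by apply/eqP; rewrite eq_le h0 cmod_ge0.
move=> e0; have [d d0 hd] := acF e0.
have [N [mN N0 NP]] := dF.
pose N' := N `|` [set a] `|` [set b].
have mN' : measurable N' by do 2 apply: measurableU => //.
have N'0 : mu N' = 0%E.
  have N1 : mu (N `|` [set a]) = 0%E.
    by rewrite measureU0//; exact: lebesgue_measure_set1.
  rewrite measureU0//; [exact: measurableU|exact: lebesgue_measure_set1].
have N'fin : (mu N' < +oo)%E by rewrite N'0.
have [U [oU N'U mU]] := lebesgue_regularity_outer mN' N'fin d0.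
have good x : a < x < b -> ~ U x -> has_cderive F x 0.
  move=> xab Ux; apply: contrapT => nd; apply: Ux; apply: N'U; left; left.
  by apply: NP => /= /(_ xab).
have [] := @chained_end e U oU e0 _ _ good.
- by apply: N'U; left; right.
- by apply: N'U; right.
move=> n [s [t [st ts tU hF]]]; apply: le_trans hF _.
have : \sum_(i < n) cmod (F (t i) - F (s i)) < e.
  apply: hd => //; rewrite -lte_fin.
  have mU' : measurable U by exact: open_measurable.
  have UN : mu U = mu (U `\` N').
    rewrite [LHS](_ : _ = mu ((U `\` N') `|` N')).
      by rewrite measureU0//; exact: measurableD.
    by congr (mu _); rewrite setUC setDUK.
  apply: le_lt_trans (_ : (mu U < d%:E)%E); last by rewrite UN.
  have <- : mu (\big[setU/set0]_(i < n) [set` `]s i, t i[]) = (\sum_(i < n) (t i - s i))%:E.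
    transitivity (\sum_(i < n) mu [set` `]s i, t i[])%E.
      by apply: measure_semi_additive_ord => //; exact: bigsetU_measurable.
    rewrite -sumEFin; apply: eq_bigr => i _; rewrite lebesgue_measure_itv/= lte_fin.
    have [_ sti _] := st i; case: ltP => // tsi.
    by rewrite (_ : t i = s i) ?subrr//; apply/eqP; rewrite eq_le sti tsi.
  apply: le_measure; rewrite ?inE//; first exact: bigsetU_measurable.
  by rewrite -bigcup_seq => x [i _ /tU].
by move=> h; rewrite [leRHS]mulrDr mulr1 lerD2l ltW.
Qed.

End ZeroDerivative.
End AbsolutelyContinuous.

(** * Derivatives of complex-valued functions *)

Section ComplexDerivative.
Variable R : realType.
Implicit Types (F G : R -> R[i]) (x : R) (u v : R[i]).

Lemma eq_is_derive (f g : R -> R) (x d d' : R) : f =1 g -> d = d' ->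
  is_derive x (1 : R) f d -> is_derive x (1 : R) g d'.
Proof. by move=> /funext -> ->. Qed.

Lemma has_cderiveD F G x u v : has_cderive F x u -> has_cderive G x v ->
  has_cderive (fun t => F t + G t) x (u + v).
Proof.
move=> [f1 f2] [g1 g2]; split.
- by apply: eq_is_derive (is_deriveD f1 g1) => [t|]; rewrite Re_add.
- by apply: eq_is_derive (is_deriveD f2 g2) => [t|]; rewrite Im_add.
Qed.

Lemma has_cderiveM F G x u v : has_cderive F x u -> has_cderive G x v ->
  has_cderive (fun t => F t * G t) x (F x * v + u * G x).
Proof.
move=> [f1 f2] [g1 g2]; split.
- apply: eq_is_derive (is_deriveB (is_deriveM f1 g1) (is_deriveM f2 g2)) => [t|].
    by rewrite Re_mul.
  by rewrite Re_add !Re_mul /GRing.scale/=; ring.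
- apply: eq_is_derive (is_deriveD (is_deriveM f1 g2) (is_deriveM f2 g1)) => [t|].
    by rewrite Im_mul.
  by rewrite Im_add !Im_mul /GRing.scale/=; ring.
Qed.

Lemma has_cderive_cst (c : R[i]) x : has_cderive (fun=> c) x 0.
Proof. by split; exact: is_derive_cst. Qed.

Lemma has_cderive_real (h : R -> R) x d : is_derive x (1 : R) h d ->
  has_cderive (fun t => real_complex R (h t)) x (real_complex R d).
Proof. by move=> dh; split => //=; exact: is_derive_cst. Qed.

Lemma has_cderiveZ c F x u : has_cderive F x u -> has_cderive (fun t => c * F t) x (c * u).
Proof.
move=> dF; have := has_cderiveM (has_cderive_cst c x) dF.
by rewrite mul0r addr0.
Qed.

Lemma has_cderiveB F G x u v : has_cderive F x u -> has_cderive G x v ->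
  has_cderive (fun t => F t - G t) x (u - v).
Proof.
move=> dF dG; have := has_cderiveD dF (has_cderiveZ (-1) dG).
by rewrite mulN1r; under eq_fun do rewrite mulN1r.
Qed.

End ComplexDerivative.

(** * Operations on absolutely continuous functions and the fundamental theorem of calculus *)

Section AcAlgebra.
Variable R : realType.
Local Notation mu := (@lebesgue_measure R).
Implicit Types (F G : R -> R[i]) (a b : R).
Local Notation AC := absolutely_continuous.

Lemma ac_sub a b a' b' F : a <= a' -> b' <= b -> AC a b F -> AC a' b' F.
Proof.
move=> aa bb acF e e0; have [d d0 hd] := acF e e0; exists d => // n s t st.
apply: hd => i; have [? ? ?] := st i; split => //; [exact: le_trans aa _|exact: le_trans bb].
Qed.

Lemma acD a b F G : AC a b F -> AC a b G -> AC a b (fun x => F x + G x).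
Proof.
move=> acF acG e e0; have e2 : 0 < e / 2 by lra.
have [d1 d10 h1] := acF _ e2; have [d2 d20 h2] := acG _ e2.
exists (Num.min d1 d2); first by rewrite lt_min d10.
move=> n s t st ts; rewrite lt_min => /andP[l1 l2].
rewrite [ltRHS]splitr.
apply: le_lt_trans (ltrD (h1 n s t st ts l1) (h2 n s t st ts l2)).
rewrite -big_split/=; apply: ler_sum => i _.
by rewrite (_ : _ - _ = (F (t i) - F (s i)) + (G (t i) - G (s i))) ?cmodD//; ring.
Qed.

Lemma ac_unif a b F : AC a b F -> forall e, 0 < e -> exists2 d, 0 < d &
  forall x y, a <= x -> x <= y -> y <= b -> y - x < d -> cmod (F y - F x) < e.
Proof.
move=> acF e e0; have [d d0 hd] := acF e e0; exists d => // x y ax xy yb yx.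
have := hd 1%N (fun=> x) (fun=> y); rewrite !big_ord1; apply => //.
by move=> i j _ _ _; rewrite !ord1.
Qed.

(** From a, walk in steps of length d / 2, each of which changes F by less than 1. *)
Lemma ac_bounded a b F : AC a b F ->
  exists2 B, 0 <= B & forall x, a <= x -> x <= b -> cmod (F x) <= B.
Proof.
move=> /ac_unif/(_ 1 ltr01)[d d0 hd].
have step n x : a <= x -> x <= b -> x <= a + n%:R * (d / 2) -> cmod (F x - F a) <= n%:R.
  elim: n x => [x ax xb|n IH x ax xb].
    rewrite mul0r addr0 => xa; have -> : x = a by apply/eqP; rewrite eq_le xa ax.
    by rewrite subrr cmod0.
  move=> xn; have [xn'|xn'] := leP x (a + n%:R * (d / 2)).
    by rewrite (le_trans (IH x ax xb xn'))// ler_nat.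
  have an : a <= a + n%:R * (d / 2) by rewrite lerDl mulr_ge0//; lra.
  set z := a + n%:R * (d / 2) in xn' an.
  have -> : F x - F a = (F x - F z) + (F z - F a) by ring.
  rewrite (le_trans (cmodD _ _))// -natr1 [leRHS]addrC lerD//.
    apply/ltW/hd => //; first exact: ltW.
    by rewrite -natr1 mulrDl mul1r in xn; rewrite /z; lra.
  by apply: IH => //; rewrite (le_trans (ltW xn')).
pose n := (Num.bound ((b - a) / (d / 2))).
exists (n%:R + cmod (F a)); first by rewrite addr_ge0 ?cmod_ge0.
move=> x ax xb; have -> : F x = (F x - F a) + F a by ring.
rewrite (le_trans (cmodD _ _))// lerD2r; apply: step => //.
have ba0 : 0 <= (b - a) / (d / 2) by rewrite divr_ge0//; lra.
have := archi_boundP ba0; rewrite -/n ltr_pdivrMr; last by lra.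
by move=> h; lra.
Qed.

Lemma acM a b F G : AC a b F -> AC a b G -> AC a b (fun x => F x * G x).
Proof.
move=> acF acG e e0.
have [B B0 hB] := ac_bounded acF; have [B' B'0 hB'] := ac_bounded acG.
pose M := B + B' + 1; have M0 : 0 < M by rewrite /M; lra.
have e2 : 0 < e / 2 / M by rewrite !divr_gt0.
have [d1 d10 h1] := acF _ e2; have [d2 d20 h2] := acG _ e2.
exists (Num.min d1 d2); first by rewrite lt_min d10.
move=> n s t st ts; rewrite lt_min => /andP[l1 l2].
have := ltrD (h1 n s t st ts l1) (h2 n s t st ts l2).
rewrite -mulrDl -splitr ltr_pdivlMr//; apply: le_lt_trans.
rewrite -big_split/= mulr_suml; apply: ler_sum => i _.
have [asi sti tib] := st i.
have -> : F (t i) * G (t i) - F (s i) * G (s i) =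
  (F (t i) - F (s i)) * G (t i) + F (s i) * (G (t i) - G (s i)) by ring.
rewrite (le_trans (cmodD _ _))// !cmodM mulrDl lerD//.
  by rewrite ler_wpM2l ?cmod_ge0// (le_trans (hB' _ (le_trans asi sti) tib))// /M; lra.
by rewrite mulrC ler_wpM2l ?cmod_ge0// (le_trans (hB _ asi (le_trans sti tib)))// /M; lra.
Qed.

Lemma ac_lip a b F K : (forall x y, a <= x -> x <= y -> y <= b -> cmod (F y - F x) <= K * (y - x)) ->
  AC a b F.
Proof.
move=> hK e e0; pose K' := `|K| + 1; have K0 : 0 < K' by rewrite /K' ltr_wpDl.
exists (e / K'); first by rewrite divr_gt0.
move=> n s t st _; rewrite ltr_pdivlMr// mulr_suml; apply: le_lt_trans.
apply: ler_sum => i _; have [asi sti tib] := st i.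
apply: le_trans (hK _ _ asi sti tib) _; rewrite mulrC ler_wpM2l ?subr_ge0//.
by rewrite /K' (le_trans (ler_norm _))// lerDl.
Qed.

Lemma ac_cst a b (c : R[i]) : AC a b (fun=> c).
Proof. by apply: (@ac_lip _ _ _ 0) => x y _ _ _; rewrite subrr cmod0 mul0r. Qed.

Lemma acB a b F G : AC a b F -> AC a b G -> AC a b (fun x => F x - G x).
Proof.
move=> acF acG; have := acD acF (acM (ac_cst a b (-1)) acG).
by under eq_fun do rewrite mulN1r.
Qed.

(** The increments add up to at most the integral of |h| over the union of the intervals, which is
    small when the measure of the union is. *)
Lemma ac_indefinite_real (h : R -> R) : rintegrable h ->
  forall e, 0 < e -> exists2 d, 0 < d & forall (n : nat) (s t : 'I_n -> R),
    (forall i, s i <= t i) ->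
    trivIset [set: 'I_n] (fun i => [set` `]s i, t i[]) ->
    \sum_(i < n) (t i - s i) < d ->
    \sum_(i < n) `|\int[mu]_(x in `]-oo, t i]) h x - \int[mu]_(x in `]-oo, s i]) h x| < e.
Proof.
move=> ih e e0; have [d [d0 hd]] := integral_normr_continuous ih e0.
exists d => // n s t st ts sd.
pose U := \big[setU/set0]_(i < n) [set` `]s i, t i[].
have mU : measurable U by apply: bigsetU_measurable.
have muU : (mu U < d%:E)%E.
  rewrite (_ : mu U = (\sum_(i < n) (t i - s i))%:E) ?lte_fin//.
  transitivity (\sum_(i < n) mu [set` `]s i, t i[])%E.
    by apply: measure_semi_additive_ord => //; exact: bigsetU_measurable.
  rewrite -sumEFin; apply: eq_bigr => i _; rewrite lebesgue_measure_itv/= lte_fin.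
  case: ltP => // tsi.
  by rewrite (_ : t i = s i) ?subrr//; apply/eqP; rewrite eq_le st tsi.
apply: le_lt_trans (hd U mU muU).
have inh := rintegrable_norm ih.
have -> : \int[mu]_(x in U) `|h x| = \sum_(i < n) \int[mu]_(x in `]s i, t i[) `|h x|.
  transitivity (fine (\sum_(i < n) \int[mu]_(x in `]s i, t i[) (`|h x|)%:E)%E).
    congr fine; have := @integral_bigsetU_EFin _ _ R mu _ (fun i : 'I_n => [set` `]s i, t i[]) (fun x => `|h x|)
      (index_enum 'I_n); apply => //.
    - exact: index_enum_uniq.
    - exact: sub_trivIset ts.
    - by apply: (measurable_funS measurableT) => //; exact: (measurable_int mu).
  rewrite -sum_fine// => i _; apply: integrable_fin_num => //.
  exact: (integrableS measurableT).
apply: ler_sum => i _.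
rewrite Rintegral_itvB ?bnd_simp//; last exact: (integrableS measurableT).
rewrite -Rintegral_itv_bndo_bndc; last exact: (integrableS measurableT).
by apply: le_normr_Rintegral => //; exact: (integrableS measurableT).
Qed.

Lemma ac_indefinite a b (f : R -> R[i]) : cintegrable f ->
  AC a b (fun x => cintegral `]-oo, x] f).
Proof.
move=> [i1 i2] e e0; have e2 : 0 < e / 2 by lra.
have [d1 d10 h1] := ac_indefinite_real i1 e2; have [d2 d20 h2] := ac_indefinite_real i2 e2.
exists (Num.min d1 d2); first by rewrite lt_min d10.
move=> n s t st ts; rewrite lt_min => /andP[l1 l2].
have st' i : s i <= t i by have [] := st i.
rewrite [ltRHS]splitr.
apply: le_lt_trans (ltrD (h1 n s t st' ts l1) (h2 n s t st' ts l2)).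
rewrite -big_split; apply: ler_sum => i _.
exact: cmod_le_ReIm.
Qed.

Lemma is_derive_indefinite (h : R -> R) : rintegrable h ->
  {ae mu, forall x, is_derive x (1 : R) (fun x => \int[mu]_(t in `]-oo, x]) h t) (h x)}.
Proof.
move=> ih; have := @FTC1Ny R h _ _; case=> [y||N [mN N0 NP]].
- exact: (integrableS measurableT).
- by apply: open_integrable_locally => //; exact: openT.
exists N; split => // x /= nd; apply: NP => /= -[dx fx]; apply: nd.
by rewrite -fx derive1E; exact: derivableP.
Qed.

Lemma has_cderive_indefinite (f : R -> R[i]) : cintegrable f ->
  {ae mu, forall x, has_cderive (fun x => cintegral `]-oo, x] f) x (f x)}.
Proof.
move=> [/is_derive_indefinite h1 /is_derive_indefinite h2].
apply: (@filterS2 _ _ (ae_filter_ringOfSetsType mu) _ _ _ _ h1 h2) => x d1 d2.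
by split.
Qed.

(** F minus the indefinite integral of f is absolutely continuous with zero derivative almost
    everywhere, hence takes equal values at a and b. *)
Theorem ac_ftc a b F (f : R -> R[i]) : a < b -> AC a b F -> cintegrable f ->
  {ae mu, forall x, a < x < b -> has_cderive F x (f x)} ->
  F b - F a = cintegral `]a, b[ f.
Proof.
move=> ab acF cf dF; pose P x := cintegral `]-oo, x] f.
have acG : AC a b (fun x => F x - P x) by apply: acB => //; exact: ac_indefinite.
have dG : {ae mu, forall x, a < x < b -> has_cderive (fun x => F x - P x) x 0}.
  have dP := has_cderive_indefinite cf.
  apply: (@filterS2 _ _ (ae_filter_ringOfSetsType mu) _ _ _ _ dF dP) => x d1 d2 xab.
  by rewrite -(subrr (f x)); apply: has_cderiveB => //; exact: d1.
have := ac_derive0 ab acG dG => h.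
have -> : F b - F a = P b - P a.
  by apply/eqP; rewrite -subr_eq0; move/eqP: h; rewrite -subr_eq0; apply: etrans; congr (_ == _); ring.
have [i1 i2] := cf; rewrite /P /cintegral; apply: complexP; rewrite ?Re_add ?Im_add ?Re_opp ?Im_opp/=.
- rewrite Rintegral_itvB ?bnd_simp//; [|exact: (integrableS measurableT)|exact: ltW].
  by rewrite -Rintegral_itv_bndo_bndc//; exact: (integrableS measurableT).
- rewrite Rintegral_itvB ?bnd_simp//; [|exact: (integrableS measurableT)|exact: ltW].
  by rewrite -Rintegral_itv_bndo_bndc//; exact: (integrableS measurableT).
Qed.

End AcAlgebra.

(** * Poisson kernels and Fourier estimates *)

Section CalculusOnIntervals.
Variable R : realType.
Local Notation mu := (@lebesgue_measure R).
Implicit Types (f F : R -> R) (a b : R).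

Lemma is_derive_continuous F x (d : R) : is_derive x (1 : R) F d -> {for x, continuous F}.
Proof.
by move=> [dF _]; apply: differentiable_continuous; exact/derivable1_diffP.
Qed.

Lemma Rintegral_ftc f F a b : a <= b -> (forall x, is_derive x (1 : R) F (f x)) ->
  continuous f -> \int[mu]_(x in `]a, b[) f x = F b - F a.
Proof.
rewrite le_eqVlt => /predU1P[<- _ _|ab dF cf].
  by rewrite set_itv_ge ?Rintegral_set0 ?subrr// bnd_simp ltxx.
have cF x : {for x, continuous F} by exact: is_derive_continuous (dF x).
have iab : mu.-integrable `[a, b] (EFin \o f).
  have cf' : {within `[a, b], continuous f} by exact: continuous_subspaceT.
  by apply: continuous_compact_integrable => //; exact: segment_compact.
rewrite Rintegral_itv_bndo_bndc; last by apply: integrableS iab => //; apply: subset_itv; rewrite bnd_simp.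
rewrite Rintegral_itv_obnd_cbnd; last by apply: integrableS iab => //; apply: subset_itv; rewrite bnd_simp.
rewrite /Rintegral (@continuous_FTC2 _ f F a b) //.
- exact: continuous_subspaceT.
- split.
  + by move=> x _; have [] := dF x.
  + exact/cvg_at_right_filter/cF.
  + exact/cvg_at_left_filter/cF.
- by move=> x _; rewrite derive1E; have [_ ->] := dF x.
Qed.

Lemma integral_ftcy f F a (l : R) : (forall x, a <= x -> 0 <= f x) ->
  (forall x, is_derive x (1 : R) F (f x)) -> continuous f -> F x @[x --> +oo] --> l ->
  (\int[mu]_(x in `[a, +oo[) (f x)%:E = (l - F a)%:E)%E.
Proof.
move=> f0 dF cf Fl; rewrite (@ge0_continuous_FTC2y _ f F a l)//.
- exact: continuous_subspaceT.
- exact/cvg_at_right_filter/(is_derive_continuous (dF a)).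
- by move=> x _; rewrite derive1E; have [_ ->] := dF x.
Qed.

Lemma ge0_integralT_fold f : (forall x, 0 <= f x) -> continuous f ->
  (\int[mu]_x (f x)%:E = \int[mu]_(x in `[0%R, +oo[) (f x + f (- x))%:E)%E.
Proof.
move=> f0 cf; have mf : measurable_fun setT f by exact: continuous_measurable_fun.
have cfN : continuous (fun x => f (- x)).
  by move=> x; apply: continuous_comp; [exact: opp_continuous|exact: cf].
rewrite -(setUv `[0, +oo[%classic) ge0_integral_setU//=; last 4 first.
- exact: measurableC.
- by apply/measurable_EFinP; rewrite setUv.
- by move=> x _; rewrite lee_fin.
- exact/disj_setPCl.
rewrite setCitvr integral_itv_bndo_bndc; last exact/measurable_EFinP/measurable_funTS.
rewrite -{2}oppr0 ge0_integration_by_substitutionNy//; last exact: continuous_subspaceT.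
under [RHS]eq_integral do rewrite EFinD.
rewrite ge0_integralD//.
- by move=> x _; rewrite lee_fin.
- exact/measurable_EFinP/measurable_funTS.
- by move=> x _; rewrite lee_fin.
- by apply/measurable_EFinP; apply: measurable_funTS; exact: continuous_measurable_fun.
Qed.

End CalculusOnIntervals.

(** * The Poisson kernel as the Fourier transform of a damping factor *)

Section PoissonKernel.
Variable R : realType.
Local Notation mu := (@lebesgue_measure R).

(** The Fourier transform of exp(- h |r|); its integral over the line is 2 pi. *)
Definition poisson (h s : R) : R := 2 * h / (h ^+ 2 + s ^+ 2).

Variable h : R.
Hypothesis h0 : 0 < h.

Let hs s : 0 < h ^+ 2 + s ^+ 2.
Proof. by rewrite ltr_pwDl ?sqr_ge0// exprn_gt0. Qed.

Lemma poisson_ge0 s : 0 <= poisson h s.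
Proof. by rewrite /poisson divr_ge0 ?(ltW (hs s))// mulr_ge0// ltW. Qed.

Lemma poisson_le s : poisson h s <= 2 / h.
Proof.
rewrite /poisson ler_pdivrMr// mulrAC ler_pdivlMr// -mulrA ler_wpM2l//.
by rewrite -expr2 lerDl sqr_ge0.
Qed.

Lemma poisson_far d s : 0 < d -> d <= `|s| -> poisson h s <= 2 * h / d ^+ 2.
Proof.
move=> d0 ds; rewrite /poisson ler_wpM2l ?mulr_ge0 ?(ltW h0)//.
rewrite lef_pV2 ?posrE ?exprn_gt0// ler_wpDl ?sqr_ge0//.
by rewrite -(real_normK (num_real s)) ler_sqr ?nnegrE// ltW.
Qed.

Lemma poissonN s : poisson h (- s) = poisson h s.
Proof. by rewrite /poisson sqrrN. Qed.

Lemma continuous_poisson : continuous (poisson h).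
Proof.
move=> s; apply: cvgM; first exact: cvg_cst.
apply: cvgV; first by rewrite gt_eqF.
by apply: cvgD; [exact: cvg_cst|exact: exprn_continuous].
Qed.

Definition pweight (r : R) := expR (- h * `|r|).

Lemma pweight_ge0 r : 0 <= pweight r. Proof. exact: expR_ge0. Qed.

Lemma pweight_le1 r : pweight r <= 1.
Proof. by rewrite /pweight -expR0 ler_expR mulNr oppr_le0 mulr_ge0// ltW. Qed.

Lemma continuous_pweight : continuous pweight.
Proof.
move=> r; apply: continuous_comp; last exact: continuous_expR.
by apply: cvgM; [exact: cvg_cst|exact: norm_continuous].
Qed.

Lemma cvg_expRN_bounded (g : R -> R) (M : R) : (forall x, `|g x| <= M) ->
  expR (- h * x) * g x @[x --> +oo] --> (0 : R).
Proof.
move=> gM; apply/cvgr0Pnorm_le => e e0.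
have M0 : 0 <= M by exact: le_trans (gM 0).
have ce : expR (- h * x) @[x --> +oo] --> (0 : R).
  rewrite (_ : (fun x => expR (- h * x)) = (fun z => expR (- z)) \o (fun z => h * z)); last first.
    by apply: eq_fun => x; rewrite mulNr.
  apply: (@cvg_comp _ _ _ _ _ _ (pinfty_nbhs R)); last exact: cvgr_expR.
  exact: gt0_cvgMry.
have e1 : 0 < e / (M + 1) by rewrite divr_gt0// ltr_wpDl.
move/cvgr0Pnorm_le : ce => /(_ _ e1); apply: filterS => x hx.
rewrite normrM; apply: le_trans (_ : e / (M + 1) * (M + 1) <= e).
  by apply: ler_pM => //; rewrite (le_trans (gM x))// lerDl.
by rewrite divfK// gt_eqF// ltr_wpDl.
Qed.

Lemma is_derive_expRN x : is_derive x (1 : R) (fun x => expR (- h * x)) (- h * expR (- h * x)).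
Proof.
have d1 : is_derive x (1 : R) (fun x => - h * x) (- h).
  by apply: eq_is_derive (is_deriveZ (- h) (is_derive_id x (1 : R))) => //; rewrite /GRing.scale/= mulr1.
by apply: eq_is_derive (is_derive1_comp (is_derive_expR _) d1) => //; rewrite mulrC.
Qed.

Lemma is_derive_sin_mul (s x : R) : is_derive x (1 : R) (fun x => sin (s * x)) (s * cos (s * x)).
Proof.
have d1 : is_derive x (1 : R) (fun x => s * x) s.
  by apply: eq_is_derive (is_deriveZ s (is_derive_id x (1 : R))) => //; rewrite /GRing.scale/= mulr1.
by apply: eq_is_derive (is_derive1_comp (is_derive_sin _) d1) => //; rewrite mulrC.
Qed.

Lemma is_derive_cos_mul (s x : R) : is_derive x (1 : R) (fun x => cos (s * x)) (- s * sin (s * x)).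
Proof.
have d1 : is_derive x (1 : R) (fun x => s * x) s.
  by apply: eq_is_derive (is_deriveZ s (is_derive_id x (1 : R))) => //; rewrite /GRing.scale/= mulr1.
by apply: eq_is_derive (is_derive1_comp (is_derive_cos _) d1) => //; rewrite mulrC mulrN mulNr.
Qed.

Lemma continuous_expRN_cos s : continuous (fun x : R => expR (- h * x) * (1 + cos (s * x))).
Proof.
move=> x; apply: cvgM.
  exact: is_derive_continuous (is_derive_expRN x).
by apply: cvgD; [exact: cvg_cst|exact: is_derive_continuous (is_derive_cos_mul s x)].
Qed.

(** The summand 1 keeps the integrand nonnegative, which the fundamental theorem on a half-line
    requires; the pure cosine integral is recovered later by subtraction. The antiderivative is expR
    (- h * x) * g x. *)
Lemma integral_expRN_cos s : (\int[mu]_(x in `[0%R, +oo[) (expR (- h * x) * (1 + cos (s * x)))%:E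
  = (h^-1 + h / (h ^+ 2 + s ^+ 2))%:E)%E.
Proof.
pose k := h ^+ 2 + s ^+ 2; have k0 : k != 0 by rewrite gt_eqF// hs.
have h1 : h != 0 by rewrite gt_eqF.
pose g x := - h^-1 + (s * sin (s * x) - h * cos (s * x)) / k.
transitivity ((0 - expR (- h * 0) * g 0)%:E); last first.
  rewrite mulr0 expR0 mul1r /g mulr0 sin0 cos0; congr EFin; rewrite -/k.
  by field; rewrite ?h1 ?k0.
apply: (@integral_ftcy _ _ (fun x => expR (- h * x) * g x)).
- by move=> x _; rewrite mulr_ge0 ?expR_ge0//; have := cos_geN1 (s * x); lra.
- move=> x.
  have dg : is_derive x (1 : R) g ((s * (s * cos (s * x)) + h * (s * sin (s * x))) / k).
    have d1 := is_deriveZ s (is_derive_sin_mul s x).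
    have d2 := is_deriveZ (- h) (is_derive_cos_mul s x).
    have d3 := is_deriveZ k^-1 (is_deriveD d1 d2).
    apply: eq_is_derive (is_deriveD (is_derive_cst (- h^-1) x (1 : R)) d3) => [t|].
      transitivity (- h^-1 + k^-1 * (s * sin (s * t) + - h * cos (s * t))); first by [].
      by rewrite /g; ring.
    by rewrite /GRing.scale/=; ring.
  apply: eq_is_derive (is_deriveM (is_derive_expRN x) dg) => //.
  rewrite /GRing.scale/= /g.
  transitivity (expR (- h * x) * (1 + ((h ^+ 2 + s ^+ 2) / k) * cos (s * x))).
    by field; rewrite ?h1 ?k0.
  by rewrite -/k divff// mul1r.
- exact: continuous_expRN_cos.
- apply: (@cvg_expRN_bounded _ (h^-1 + (`|s| + h) / `|k|)) => x.
  rewrite /g (le_trans (ler_normD _ _))// lerD//.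
    by rewrite normrN ger0_norm// invr_ge0 ltW.
  rewrite normrM normfV ler_wpM2r ?invr_ge0// (le_trans (ler_normB _ _))// lerD// normrM.
    by rewrite ler_piMr// ler_norml sin_geN1 sin_le1.
  by rewrite gtr0_norm// ler_piMr ?(ltW h0)// ler_norml cos_geN1 cos_le1.
Qed.

Lemma integral_expRN : (\int[mu]_(x in `[0%R, +oo[) (expR (- h * x))%:E = (h^-1)%:E)%E.
Proof.
have h1 : h != 0 by rewrite gt_eqF.
transitivity ((0 - expR (- h * 0) * (- h^-1))%:E); last first.
  by rewrite mulr0 expR0 mul1r sub0r opprK.
apply: (@integral_ftcy _ _ (fun x => expR (- h * x) * (- h^-1))).
- by move=> x _; exact: expR_ge0.
- move=> x; apply: eq_is_derive (is_deriveZ (- h^-1) (is_derive_expRN x)) => [t|].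
    exact: mulrC.
  by rewrite -[LHS]/(- h^-1 * (- h * expR (- h * x))); field.
- by move=> x; exact: is_derive_continuous (is_derive_expRN x).
- by apply: (@cvg_expRN_bounded _ `|- h^-1|) => x.
Qed.

Lemma integral_pweight : (\int[mu]_x (pweight x)%:E = (2 / h)%:E)%E.
Proof.
rewrite ge0_integralT_fold; [|exact: pweight_ge0|exact: continuous_pweight].
under eq_integral => x.
  rewrite inE/= in_itv/= andbT => x0; rewrite /pweight normrN ger0_norm//.
  rewrite -mulr2n -mulr_natl EFinM; over.
rewrite ge0_integralZl.
- by rewrite integral_expRN -EFinM.
- by [].
- apply/measurable_EFinP; apply: measurable_funTS; apply: continuous_measurable_fun => x.
  exact: is_derive_continuous (is_derive_expRN x).
- by move=> x _; rewrite lee_fin expR_ge0.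
- by rewrite lee_fin.
Qed.

Lemma rintegrable_pweight : rintegrable pweight.
Proof.
apply/integrableP; split.
  by apply/measurable_EFinP; apply: continuous_measurable_fun; exact: continuous_pweight.
under eq_integral do rewrite /= ger0_norm ?pweight_ge0//.
by rewrite integral_pweight ltry.
Qed.

Lemma Rintegral_pweight : \int[mu]_x pweight x = 2 / h.
Proof. by rewrite /Rintegral integral_pweight. Qed.

Lemma continuous_trig_mul (s : R) : continuous (fun x => cos (s * x)) /\ continuous (fun x => sin (s * x)).
Proof.
split=> x; first exact: is_derive_continuous (is_derive_cos_mul s x).
exact: is_derive_continuous (is_derive_sin_mul s x).
Qed.

Lemma rintegrable_pweight_trig s : rintegrable (fun r => pweight r * cos (s * r)) /\
  rintegrable (fun r => pweight r * sin (s * r)).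
Proof.
have [cc cs] := continuous_trig_mul s.
have mw : measurable_fun setT pweight by exact: continuous_measurable_fun continuous_pweight.
split; apply: (rintegrable_dom _ rintegrable_pweight) => [|x].
- by apply: measurable_funM => //; exact: continuous_measurable_fun.
- rewrite normrM ger0_norm ?pweight_ge0// ler_piMr ?pweight_ge0// ler_norml.
  by rewrite cos_geN1 cos_le1.
- by apply: measurable_funM => //; exact: continuous_measurable_fun.
- rewrite normrM ger0_norm ?pweight_ge0// ler_piMr ?pweight_ge0// ler_norml.
  by rewrite sin_geN1 sin_le1.
Qed.

Lemma Rintegral_pweight_cos s : \int[mu]_r (pweight r * cos (s * r)) = poisson h s.
Proof.
have [ic is_] := rintegrable_pweight_trig s; have [cc cs] := continuous_trig_mul s.
have : \int[mu]_r (pweight r + pweight r * cos (s * r)) = 2 / h + poisson h s.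
  rewrite /Rintegral; under eq_integral do rewrite -{1}[pweight _]mulr1 -mulrDr.
  rewrite (@ge0_integralT_fold _ (fun x => pweight x * (1 + cos (s * x)))).
  - under eq_integral => x.
      rewrite inE/= in_itv/= andbT => x0; rewrite /pweight normrN ger0_norm//.
      rewrite mulrN cosN -mulr2n -mulr_natl EFinM; over.
    rewrite ge0_integralZl.
    + rewrite integral_expRN_cos -EFinM/= /poisson; field.
      by rewrite gt_eqF ?hs//= gt_eqF.
    + by [].
    + apply/measurable_EFinP; apply: measurable_funTS.
      by apply: continuous_measurable_fun => x; exact: continuous_expRN_cos.
    + by move=> x _; rewrite lee_fin mulr_ge0 ?expR_ge0//; have := cos_geN1 (s * x); lra.
    + by rewrite lee_fin.
  - by move=> x; rewrite mulr_ge0 ?pweight_ge0//; have := cos_geN1 (s * x); lra.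
  - move=> x; apply: cvgM; first exact: continuous_pweight.
    by apply: cvgD; [exact: cvg_cst|exact: cc].
rewrite RintegralD//; last exact: rintegrable_pweight.
by rewrite Rintegral_pweight => /addrI.
Qed.

Lemma Rintegral_pweight_sin s : \int[mu]_r (pweight r * sin (s * r)) = 0.
Proof.
have [ic is_] := rintegrable_pweight_trig s; have [cc cs] := continuous_trig_mul s.
have : \int[mu]_r (pweight r + pweight r * sin (s * r)) = 2 / h + 0.
  rewrite addr0 -Rintegral_pweight /Rintegral; congr fine.
  under eq_integral do rewrite -{1}[pweight _]mulr1 -mulrDr.
  rewrite (@ge0_integralT_fold _ (fun x => pweight x * (1 + sin (s * x)))).
  - rewrite [RHS]ge0_integralT_fold; [|exact: pweight_ge0|exact: continuous_pweight].
    apply: eq_integral => x _; congr EFin; rewrite /pweight normrN mulrN sinN; ring.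
  - by move=> x; rewrite mulr_ge0 ?pweight_ge0//; have := sin_geN1 (s * x); lra.
  - move=> x; apply: cvgM; first exact: continuous_pweight.
    by apply: cvgD; [exact: cvg_cst|exact: cs].
rewrite RintegralD//; last exact: rintegrable_pweight.
by rewrite Rintegral_pweight => /addrI.
Qed.

Lemma cint_pweight_cis s :
  cint (fun r => cis (s * r) * real_complex R (pweight r)) = real_complex R (poisson h s).
Proof.
apply: complexP => /=.
- by rewrite -Rintegral_pweight_cos; apply: eq_Rintegral => r _; rewrite mulr0 subr0 mulrC.
- transitivity (\int[mu]_r (pweight r * sin (s * r))); last exact: Rintegral_pweight_sin.
  by apply: eq_Rintegral => r _; rewrite mulr0 add0r mulrC.
Qed.

Lemma cintegrable_pweight : cintegrable (fun r => real_complex R (pweight r)).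
Proof. by split => /=; [exact: rintegrable_pweight|exact: rintegrable0]. Qed.

Lemma continuous_poisson_shift (s : R) : continuous (fun y : R => poisson h (s - 2 * y)).
Proof.
move=> y; apply: (@continuous_comp _ _ _ (fun y : R => s - 2 * y) (poisson h)).
  apply: cvgB; first exact: cvg_cst.
  by apply: cvgM; [exact: cvg_cst|exact: cvg_id].
exact: continuous_poisson.
Qed.

(** The variable enters as 2 y because products of two solutions have exponents 2 y; this halves the
    total mass of the kernel, from 2 pi to pi. *)
Lemma Rintegral_poisson (a b s : R) : a <= b ->
  \int[mu]_(y in `]a, b[) poisson h (s - 2 * y) = atan ((s - 2 * a) / h) - atan ((s - 2 * b) / h).
Proof.
move=> ab; transitivity (- atan ((s - 2 * b) / h) - - atan ((s - 2 * a) / h)); last first.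
  by rewrite opprK addrC.
apply: (@Rintegral_ftc _ _ (fun y => - atan ((s - 2 * y) / h))) => // [y|].
- have d1 : is_derive y (1 : R) (fun y => (s - 2 * y) / h) (- 2 / h).
    have d2 := is_deriveZ (- 2 / h) (is_derive_id y (1 : R)).
    apply: eq_is_derive (is_deriveD (is_derive_cst (s / h) y (1 : R)) d2) => [t|].
      by transitivity (s / h + - 2 / h * t); [|ring].
    by rewrite add0r; exact: mulr1.
  have d3 := @is_derive1_comp _ atan (fun y => (s - 2 * y) / h) y _ _ (is_derive1_atan _) d1.
  apply: eq_is_derive (is_deriveN d3) => //.
  by rewrite /poisson; field; rewrite gt_eqF//= gt_eqF ?hs//=.
- exact: continuous_poisson_shift.
Qed.

End PoissonKernel.

(** * Square-integrable functions on the line *)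

Section SquareIntegrable.
Variable R : realType.
Local Notation mu := (@lebesgue_measure R).
Implicit Types (f g : R -> R[i]).

Definition sqint f := cmeas f /\ rintegrable (fun x => cmod (f x) ^+ 2).
(** The square of the L2 norm. All estimates are carried out on squares, hence the factors 2
    whenever two terms are added. *)
Definition sqnorm f : R := \int[mu]_x cmod (f x) ^+ 2.

Lemma sqnorm_ge0 f : 0 <= sqnorm f.
Proof. by apply: Rintegral_ge0 => x _; exact: sqr_ge0. Qed.

Lemma measurable_sqr_cmod f : cmeas f -> measurable_fun setT (fun x => cmod (f x) ^+ 2).
Proof. by move=> mf; apply: measurable_funX; exact: cmeas_cmod. Qed.

Lemma sqint_le f c : cmeas f -> (\int[mu]_x (cmod (f x) ^+ 2)%:E <= c%:E)%E ->
  sqint f /\ sqnorm f <= c.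
Proof.
move=> mf fc; have i2 : rintegrable (fun x => cmod (f x) ^+ 2).
  apply/integrableP; split; first by apply/measurable_EFinP; exact: measurable_sqr_cmod.
  apply: le_lt_trans (ltry c); apply: le_trans fc; rewrite le_eqVlt; apply/orP; left; apply/eqP.
  by apply: eq_integral => x _ /=; rewrite ger0_norm ?sqr_ge0.
split => //; rewrite -lee_fin /sqnorm /Rintegral fineK//.
exact: (integrable_fin_num measurableT i2).
Qed.

Lemma sqint_dom f (h : R -> R) : cmeas f -> rintegrable h -> (forall x, cmod (f x) ^+ 2 <= h x) ->
  sqint f /\ sqnorm f <= \int[mu]_x h x.
Proof.
move=> mf ih fh; have i2 : rintegrable (fun x => cmod (f x) ^+ 2).
  apply: (rintegrable_dom _ ih); first exact: measurable_sqr_cmod.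
  by move=> x; rewrite ger0_norm ?sqr_ge0.
by split => //; apply: le_Rintegral.
Qed.

Lemma sqintD f g : sqint f -> sqint g ->
  sqint (fun x => f x + g x) /\ sqnorm (fun x => f x + g x) <= 2 * sqnorm f + 2 * sqnorm g.
Proof.
move=> [mf if2] [mg ig2].
have i2 := rintegrableD (rintegrableZ 2 if2) (rintegrableZ 2 ig2).
have [] := @sqint_dom (fun x => f x + g x) _ (cmeasD mf mg) i2.
  move=> x; have := cmodD (f x) (g x); have := cmod_ge0 (f x + g x).
  move: (cmod (f x + g x)) (cmod (f x)) (cmod (g x)) => a b c a0 abc.
  have bc0 : 0 <= b + c by exact: le_trans abc.
  have : a ^+ 2 <= (b + c) ^+ 2 by rewrite ler_sqr ?nnegrE.
  by move/le_trans; apply; have := sqr_ge0 (b - c); nra.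
move=> i3 le3; split => //; apply: le_trans le3 _.
by rewrite RintegralD ?RintegralZl//; exact: rintegrableZ.
Qed.

Lemma sqint_bM f g M : cmeas f -> (forall x, cmod (f x) <= M) -> sqint g ->
  sqint (fun x => f x * g x) /\ sqnorm (fun x => f x * g x) <= M ^+ 2 * sqnorm g.
Proof.
move=> mf fM [mg ig2].
have [] := @sqint_dom (fun x => f x * g x) _ (cmeasM mf mg) (rintegrableZ (M ^+ 2) ig2).
  move=> x; rewrite cmodM exprMn ler_wpM2r ?sqr_ge0// ler_sqr ?nnegrE ?cmod_ge0//.
  exact: le_trans (cmod_ge0 _) (fM x).
by move=> i3 le3; split => //; rewrite (le_trans le3)// RintegralZl.
Qed.

Lemma sqintN f : sqint f -> sqint (fun x => - f x) /\ sqnorm (fun x => - f x) = sqnorm f.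
Proof.
move=> [mf i2]; split; last by rewrite /sqnorm; apply: eq_Rintegral => x _; rewrite cmodN.
by split; [exact: cmeasN|under eq_fun do rewrite cmodN].
Qed.

Lemma sqintB f g : sqint f -> sqint g ->
  sqint (fun x => f x - g x) /\ sqnorm (fun x => f x - g x) <= 2 * sqnorm f + 2 * sqnorm g.
Proof.
by move=> sf sg; have [sN <-] := sqintN sg; exact: sqintD.
Qed.

Lemma Rintegral_indic (D : set R) (h : R -> R) :
  \int[mu]_x (\1_D x * h x) = \int[mu]_(x in D) h x.
Proof.
rewrite [RHS]Rintegral_mkcond; apply: eq_Rintegral => x _; rewrite patchE indicE.
by case: (x \in D); rewrite ?mul1r ?mul0r.
Qed.

Lemma rintegrable_indic_itv (b : R) : rintegrable (fun x : R => \1_`]0, b[ x).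
Proof.
apply/integrableP; split; first by apply/measurable_EFinP; exact: measurable_indic.
rewrite (_ : (\int[mu]_x _)%E = (\int[mu]_x (\1_`]0%R, b[ x)%:E)%E); last first.
  by apply: eq_integral => x _ /=; rewrite ger0_norm// indicE.
rewrite integral_indic// setIT.
suff : (mu `]0%R, b[%classic < +oo)%E by [].
rewrite lebesgue_measure_itv/= lte_fin.
by case: ifP => // _; rewrite -EFinD ltry.
Qed.

Lemma Rintegral_indic_itv (b : R) : 0 <= b -> \int[mu]_x \1_`]0, b[ x = b.
Proof.
move=> b0; under eq_Rintegral do rewrite -[\1_ _ _]mulr1.
rewrite Rintegral_indic Rintegral_cst//= lebesgue_measure_itv/= lte_fin mul1r.
by case: ltP => [_|b0'] /=; rewrite ?subr0//; apply/eqP; rewrite eq_le b0 b0'.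
Qed.

Lemma indic_itv_ge0 (b x : R) : 0 <= (\1_`]0, b[ x : R).
Proof. by rewrite indicE. Qed.

Lemma indic_itv_le1 (b x : R) : (\1_`]0, b[ x : R) <= 1.
Proof. by rewrite indicE; case: (_ \in _). Qed.

Lemma indic_itvE (b x : R) : (\1_`]0, b[ x : R) = ((0 < x < b)%R : bool)%:R.
Proof. by rewrite indicE mem_setE in_itv. Qed.

Lemma measurable_indic_itv (b : R) : measurable_fun setT (\1_`]0, b[ : R -> R).
Proof. exact: measurable_indic. Qed.

Lemma sqint_supp_cintegrable b f : sqint f -> (forall x, ~~ (0 < x < b) -> f x = 0) ->
  cintegrable f.
Proof.
move=> [mf i2] f0; apply: (cintegrable_dom mf (rintegrableD (rintegrable_indic_itv b) i2)).
move=> x; rewrite indic_itvE; have [xb|/f0 ->] := boolP (0 < x < b).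
  by have := sqr_ge0 (cmod (f x) - 2^-1); rewrite /=; nra.
by rewrite cmod0 expr0n addr0.
Qed.

Lemma monotone_integral_le (h_ : nat -> R -> R) (h : R -> R) (c : R) :
  (forall n, measurable_fun setT (h_ n)) -> (forall n x, 0 <= h_ n x) ->
  (forall x m n, (m <= n)%N -> h_ m x <= h_ n x) ->
  (forall x, h_ n x @[n --> \oo] --> h x) ->
  (forall n, (\int[mu]_x (h_ n x)%:E <= c%:E)%E) ->
  (\int[mu]_x (h x)%:E <= c%:E)%E.
Proof.
move=> mh h0 hmn hh hc.
have k1 n : measurable_fun setT (fun x => (h_ n x)%:E) by apply/measurable_EFinP; exact: mh.
have k2 n x : [set: R] x -> (0 <= (h_ n x)%:E)%E by rewrite lee_fin.
have k3 x : [set: R] x -> {homo (fun n => (h_ n x)%:E) : m n / (m <= n)%N >-> (m <= n)%E}.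
  by move=> _ m n mn; rewrite lee_fin hmn.
have hcv : (\int[mu]_x (h_ n x)%:E)%E @[n --> \oo] --> (\int[mu]_x limn (fun n => (h_ n x)%:E))%E.
  exact: (@cvg_monotone_convergence _ _ R mu _ measurableT _ k1 k2 k3).
rewrite (_ : (\int[mu]_x (h x)%:E)%E = (\int[mu]_x limn (fun n => (h_ n x)%:E))%E).
  by apply: (cvge_le _ hcv); exact: nearW.
apply: eq_integral => x _; apply/esym/cvg_lim => //.
by apply: cvg_EFin (hh x); exact: nearW.
Qed.

End SquareIntegrable.

(** * Schur test for the Poisson kernel *)

Section Schur.
Variable R : realType.
Local Notation mu := (@lebesgue_measure R).
Variable h : R.
Hypothesis h0 : 0 < h.
Local Notation ie := (\1_`]0, pi[ : R -> R).

Let pk (x y : R) := poisson h (2 * x - 2 * y).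

Let pk_ge0 x y : 0 <= pk x y. Proof. exact: poisson_ge0. Qed.
Let pk_le x y : pk x y <= 2 / h. Proof. exact: poisson_le. Qed.

Lemma mulr_half_double (t : R) : t = 2^-1 * (t + t).
Proof. lra. Qed.

Lemma mulr_le_half_sqr (a b : R) : a * b <= 2^-1 * (a ^+ 2 + b ^+ 2).
Proof. by have := sqr_ge0 (a - b); nra. Qed.

Lemma poisson_sym (x y : R) : poisson h (2 * x - 2 * y) = poisson h (2 * y - 2 * x).
Proof. by rewrite -poissonN opprB. Qed.

Lemma measurable_poisson2 : measurable_fun setT (fun p : R * R => poisson h (2 * p.1 - 2 * p.2)).
Proof.
apply: (@measurableT_comp _ _ _ _ _ _ (poisson h)).
  by apply: continuous_measurable_fun; exact: continuous_poisson.
apply: measurable_funB; apply: measurable_funM; try exact: measurable_cst.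
- exact: measurable_fst.
- exact: measurable_snd.
Qed.

Lemma measurable_poisson_shift (s : R) : measurable_fun setT (fun y : R => poisson h (s - 2 * y)).
Proof. by apply: continuous_measurable_fun; exact: continuous_poisson_shift. Qed.

Lemma rintegrable_poissonM (u : R -> R) (s : R) : rintegrable u ->
  rintegrable (fun y => u y * poisson h (s - 2 * y)).
Proof.
move=> iu; apply: (rintegrable_dom _ (rintegrableZ (2 / h) (rintegrable_norm iu))).
  apply: measurable_funM; first exact: rintegrable_meas.
  exact: measurable_poisson_shift.
move=> y; rewrite normrM mulrC (ger0_norm (poisson_ge0 h0 _)).
by apply: ler_wpM2r => //; exact: poisson_le.
Qed.

Lemma poisson_mass (s : R) : \int[mu]_y (ie y * poisson h (s - 2 * y)) <= pi.
Proof.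
rewrite Rintegral_indic Rintegral_poisson ?pi_ge0//.
have := atan_ltpi2 ((s - 2 * 0) / h); have := atan_gtNpi2 ((s - 2 * pi) / h).
move=> h1 h2; have := pi_gt0 R; lra.
Qed.

Lemma poisson_average_le (u : R -> R) (n s : R) : measurable_fun setT u ->
  (forall y, `|u y| <= n * ie y) -> `|\int[mu]_y (u y * poisson h (s - 2 * y))| <= n * pi.
Proof.
move=> mu_ un.
have iin := rintegrableZ n (rintegrable_indic_itv (pi : R)).
have iu : rintegrable u by exact: rintegrable_dom mu_ iin un.
have n0 : 0 <= n.
  have := un (pi / 2); rewrite indic_itvE; have := pi_gt0 R => p0.
  have p2 : 0 < (pi / 2 : R) < pi by apply/andP; split; lra.
  by rewrite p2 mulr1; exact: le_trans.
have ip := rintegrable_poissonM s iu.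
apply: le_trans (le_normr_Rintegral measurableT ip) _.
apply: le_trans (_ : \int[mu]_y (n * (ie y * poisson h (s - 2 * y))) <= _).
  apply: le_Rintegral => //.
  - exact: rintegrable_norm.
  - apply: rintegrableZ; apply: rintegrable_poissonM; exact: rintegrable_indic_itv.
  move=> y _; rewrite normrM mulrA (ger0_norm (poisson_ge0 h0 _)).
  by apply: ler_wpM2r; [exact: poisson_ge0|exact: un].
rewrite RintegralZl//; last by apply: rintegrable_poissonM; exact: rintegrable_indic_itv.
by apply: ler_wpM2l => //; exact: poisson_mass.
Qed.

Section Forms.
Variables (u : R -> R).
Hypotheses (u0 : forall x, 0 <= u x) (mu_u : measurable_fun setT u).
Hypothesis (iu2 : rintegrable (fun x => u x ^+ 2)).
Hypothesis su : forall x, ~~ (0 < x < pi) -> u x = 0.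

Let iu : rintegrable u.
Proof.
apply: (rintegrable_dom mu_u (rintegrableD (rintegrable_indic_itv (pi : R)) iu2)) => x.
rewrite ger0_norm// indic_itvE; have [_|/su ->] := boolP (0 < x < pi).
  by have := sqr_ge0 (u x - 2^-1); rewrite /=; nra.
by rewrite expr0n addr0.
Qed.

(** Schur test: u x * u y is at most half of u x ^+ 2 + u y ^+ 2, and in each of the two majorants
    [k1] and [k2] the kernel has mass at most pi in the variable that u does not involve. *)
Lemma poisson_schur :
  \int[mu]_x \int[mu]_y (u x * (u y * pk x y)) <= pi * \int[mu]_x (u x ^+ 2).
Proof.
pose k x y := u x * (u y * pk x y).
pose k1 x y := u x ^+ 2 * (ie y * pk x y).
pose k2 x y := u y ^+ 2 * (ie x * pk x y).
have ii := rintegrable_indic_itv (pi : R).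
have m1 (v : R -> R) : measurable_fun setT v -> measurable_fun setT (fun p : R * R => v p.1).
  by move=> mv; apply: measurableT_comp => //; exact: measurable_fst.
have m2 (v : R -> R) : measurable_fun setT v -> measurable_fun setT (fun p : R * R => v p.2).
  by move=> mv; apply: measurableT_comp => //; exact: measurable_snd.
have mie : measurable_fun setT ie by exact: measurable_indic_itv.
have mu2 : measurable_fun setT (fun x => u x ^+ 2) by exact: measurable_funX.
have mp := measurable_poisson2.
have mk : measurable_fun setT (fun p : R * R => k p.1 p.2).
  by apply: measurable_funM; [exact: m1|apply: measurable_funM => //; exact: m2].
have mk1 : measurable_fun setT (fun p : R * R => k1 p.1 p.2).
  apply: measurable_funM; first exact: (m1 (fun x => u x ^+ 2)).
  by apply: measurable_funM => //; exact: m2.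
have mk2 : measurable_fun setT (fun p : R * R => k2 p.1 p.2).
  apply: measurable_funM; first exact: (m2 (fun x => u x ^+ 2)).
  by apply: measurable_funM => //; exact: m1.
have ie0 x : 0 <= ie x by exact: indic_itv_ge0.
have bk x y : `|k x y| <= u x * (2 / h * u y).
  rewrite /k ger0_norm; last by apply: mulr_ge0 => //; apply: mulr_ge0.
  by apply: ler_wpM2l => //; rewrite mulrC; apply: ler_wpM2r.
have bk1 x y : `|k1 x y| <= u x ^+ 2 * (2 / h * ie y).
  rewrite /k1 ger0_norm; last by apply: mulr_ge0; [exact: sqr_ge0|apply: mulr_ge0].
  by apply: ler_wpM2l; [exact: sqr_ge0|rewrite mulrC; apply: ler_wpM2r].
have bk2 x y : `|k2 x y| <= ie x * (2 / h * u y ^+ 2).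
  rewrite /k2 ger0_norm; last by apply: mulr_ge0; [exact: sqr_ge0|apply: mulr_ge0].
  rewrite mulrCA; apply: ler_wpM2l => //.
  by rewrite mulrC; apply: ler_wpM2r => //; exact: sqr_ge0.
have iu' := rintegrableZ (2 / h) iu; have iu2' := rintegrableZ (2 / h) iu2.
have ii' := rintegrableZ (2 / h) ii.
have i1 := rfubini_integrable mk1 iu2 ii' bk1.
have i2 := rfubini_integrable mk2 ii iu2' bk2.
have l1 : \int[mu]_x \int[mu]_y k1 x y <= pi * \int[mu]_x (u x ^+ 2).
  rewrite -RintegralZl//; apply: le_Rintegral => //; first exact: rintegrableZ.
  move=> x _; rewrite /k1 RintegralZl//; last exact: rintegrable_poissonM.
  by rewrite mulrC; apply: ler_wpM2r; [exact: sqr_ge0|exact: poisson_mass].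
have l2 : \int[mu]_x \int[mu]_y k2 x y <= pi * \int[mu]_x (u x ^+ 2).
  rewrite (rfubini mk2 ii iu2' bk2) -RintegralZl//; apply: le_Rintegral => //.
  - have mk2' : measurable_fun setT (fun p : R * R => k2 p.2 p.1).
      apply: (@measurableT_comp _ _ _ _ _ _ (fun p : R * R => k2 p.1 p.2) _ (fun p => (p.2, p.1))) => //.
      by apply: measurable_fun_pair; [exact: measurable_snd|exact: measurable_fst].
    apply: (rfubini_integrable mk2' iu2' ii) => x y.
    by rewrite mulrC; exact: bk2.
  - exact: rintegrableZ.
  move=> y _; rewrite /k2 RintegralZl//; last first.
    by under eq_fun do rewrite /pk poisson_sym; exact: rintegrable_poissonM.
  rewrite mulrC; apply: ler_wpM2r; first exact: sqr_ge0.
  by under eq_Rintegral do rewrite /pk poisson_sym; exact: poisson_mass.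
rewrite [leRHS]mulr_half_double.
apply: le_trans (_ : 2^-1 * (\int[mu]_x \int[mu]_y k1 x y + \int[mu]_x \int[mu]_y k2 x y) <= _).
  rewrite -RintegralD// -RintegralZl//; last exact: rintegrableD.
  apply: le_Rintegral => //.
  - exact: (rfubini_integrable mk iu iu' bk).
  - by apply: rintegrableZ; exact: rintegrableD.
  move=> x _; have s1 := rintegrable_sectionl mk1 ii' bk1 x.
  have s2 := rintegrable_sectionl mk2 iu2' bk2 x.
  rewrite -RintegralD// -RintegralZl//; last exact: rintegrableD.
  apply: le_Rintegral => //.
  - exact: (rintegrable_sectionl mk iu' bk x).
  - by apply: rintegrableZ; exact: rintegrableD.
  move=> y _; rewrite [leLHS](_ : _ = u x * u y * pk x y); last by rewrite mulrA.
  rewrite [leRHS](_ : _ = 2^-1 * (u x ^+ 2 * ie y + u y ^+ 2 * ie x) * pk x y); last first.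
    by rewrite /k1 /k2; ring.
  apply: ler_wpM2r; first exact: pk_ge0.
  rewrite !indic_itvE; have [_|/su ->] := boolP (0 < x < pi); have [_|/su ->] := boolP (0 < y < pi).
  - by rewrite /= !mulr1; exact: mulr_le_half_sqr.
  - by rewrite /= !mulr0 expr0n mul0r addr0 mulr0.
  - by rewrite /= mul0r mulr0 expr0n mul0r addr0 mulr0.
  - by rewrite /= !mulr0 addr0 mulr0.
by apply: ler_wpM2l; [rewrite invr_ge0; exact: ler0n|exact: (lerD l1 l2)].
Qed.

End Forms.
End Schur.

(** * Plancherel inequality for functions supported on the edge *)

Section FourierUpper.
Variable R : realType.
Local Notation mu := (@lebesgue_measure R).
Implicit Types (f g : R -> R[i]).

Lemma conj_mul (z w : R[i]) : (z * w)^*%C = z^*%C * w^*%C.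
Proof. exact: rmorphM. Qed.

(** The exponent is 2 x since a product of two solutions on an edge oscillates like exp(2 i x r). *)
Definition fourier f (r : R) : R[i] := cint (fun x => f x * cis (2 * x * r)).

Lemma jmeas_cis (c : R) (u : R -> R) : measurable_fun setT u ->
  jmeas (fun x r : R => cis (c * u x * r)).
Proof.
move=> mu_; apply: cmeas_cis; apply: measurable_funM; last exact: measurable_snd.
apply: measurable_funM; first exact: measurable_cst.
by apply: measurableT_comp => //; exact: measurable_fst.
Qed.

Lemma jmeas_cis2 : jmeas (fun x r : R => cis (2 * x * r)).
Proof. by apply: (@jmeas_cis 2 id); exact: measurable_id. Qed.

Lemma fourier_meas f : cintegrable f -> cmeas (fourier f).
Proof.
by move=> cf; exact: (cmeas_cint_param cf jmeas_cis2).
Qed.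

Lemma fourier_bound f r : cintegrable f -> cmod (fourier f r) <= \int[mu]_x cmod (f x).
Proof.
move=> cf; rewrite /fourier -[leRHS]mul1r; apply: cmod_cint_mulb => //.
- exact: (jmeas_secr r jmeas_cis2).
- by move=> x _; rewrite cmod_cis.
Qed.

Lemma cintegrable_fourier_kernel f r : cintegrable f ->
  cintegrable (fun x => f x * cis (2 * x * r)).
Proof.
move=> cf; apply: (@cintegrable_mulb _ _ _ 1) => //.
- exact: (jmeas_secr r jmeas_cis2).
- by move=> x _; rewrite cmod_cis.
Qed.

Section Damped.
Variables (h : R) (h0 : 0 < h) (g : R -> R[i]) (cg : cintegrable g).

(** The conjugate transform, made integrable by exp(- h |r|) so that it can serve as a test function
    in [spec]. Its own Fourier transform is [damped_kernel], a Poisson average of the conjugate of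
    g. *)
Definition damped (r : R) : R[i] := real_complex R (pweight h r) * (fourier g r)^*%C.

Definition damped_kernel (s : R) : R[i] :=
  cint (fun y => (g y)^*%C * real_complex R (poisson h (s - 2 * y))).

Lemma cintegrable_damped : cintegrable damped.
Proof.
rewrite (_ : damped = fun r => (fourier g r)^*%C * real_complex R (pweight h r)); last first.
  by apply/funext => r; rewrite /damped mulrC.
apply: (@cintegrable_bM _ _ _ (\int[mu]_x cmod (g x))).
- by apply: cmeas_conj; exact: fourier_meas.
- by move=> r; rewrite cmod_conj; exact: fourier_bound.
- exact: cintegrable_pweight.
Qed.

Lemma conj_fourier r : (fourier g r)^*%C = cint (fun y => (g y)^*%C * cis (- 2 * y * r)).
Proof.
rewrite /fourier -cint_conj; last exact: cintegrable_fourier_kernel.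
by apply: eq_cint => y; rewrite conj_mul conj_cis !mulNr.
Qed.

Lemma damped_pair s : cint (fun r => cis (s * r) * damped r) = damped_kernel s.
Proof.
pose E (y r : R) := cis (- 2 * y * r).
have mE : jmeas E by apply: (@jmeas_cis (- 2) id); exact: measurable_id.
have cgc := cintegrable_conj cg.
have EM y r : (g y)^*%C != 0 -> cmod (E y r) <= 1 by rewrite cmod_cis.
have cp : cintegrable (fun r => cis (s * r) * real_complex R (pweight h r)).
  by apply: cintegrable_cisM; exact: cintegrable_pweight.
transitivity (cint (fun r => cint (fun y => (g y)^*%C * E y r) *
    (cis (s * r) * real_complex R (pweight h r)))).
  by apply: eq_cint => r; rewrite /damped conj_fourier /E; ring.
rewrite (cfubini_param cgc mE EM cp); apply: eq_cint => y; congr (_ * _).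
rewrite -cint_pweight_cis//; apply: eq_cint => r.
by rewrite mulrA /E -cisD; congr (cis _ * _); ring.
Qed.

Lemma fourier_damped_pair f : cintegrable f ->
  cint (fun r => fourier f r * damped r) = cint (fun x => f x * damped_kernel (2 * x)).
Proof.
move=> cf; have EM x r : f x != 0 -> cmod (cis (2 * x * r)) <= 1 by rewrite cmod_cis.
rewrite (cfubini_param cf jmeas_cis2 EM cintegrable_damped).
by apply: eq_cint => x; rewrite damped_pair.
Qed.

Lemma jmeas_poisson : jmeas (fun x y : R => real_complex R (poisson h (2 * x - 2 * y))).
Proof. by apply: cmeas_real; exact: measurable_poisson2. Qed.

Lemma cmeas_damped_kernel : cmeas (fun x : R => damped_kernel (2 * x)).
Proof.
exact: (cmeas_cint_param (cintegrable_conj cg) (jmeas_swap jmeas_poisson)).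
Qed.

Lemma cmod_damped_kernel s :
  cmod (damped_kernel s) <= \int[mu]_y (cmod (g y) * poisson h (s - 2 * y)).
Proof.
rewrite /damped_kernel; apply: cmod_cint_le.
- apply: cmeasM; first by apply: cmeas_conj; exact: cintegrable_meas.
  by apply: cmeas_real; exact: measurable_poisson_shift.
- by apply: rintegrable_poissonM => //; exact: rintegrable_cmod.
- move=> y; rewrite cmodM cmod_conj cmod_real ger0_norm//; exact: poisson_ge0.
Qed.

End Damped.

Section UpperBound.
Variable g : R -> R[i].
Hypotheses (sg : sqint g) (g_supp : forall x, ~~ (0 < x < pi) -> g x = 0).

Let cg : cintegrable g. Proof. exact: sqint_supp_cintegrable sg g_supp. Qed.

(** The damped integral equals the quadratic form of g with the Poisson kernel, which the Schur test
    bounds independently of h. *)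
Lemma damped_fourier_le (h : R) : 0 < h ->
  rintegrable (fun r => pweight h r * cmod (fourier g r) ^+ 2) /\
  \int[mu]_r (pweight h r * cmod (fourier g r) ^+ 2) <= pi * sqnorm g.
Proof.
move=> h0; set u := fun x => cmod (g x).
have iw : rintegrable (fun r => pweight h r * cmod (fourier g r) ^+ 2).
  apply: (rintegrable_dom _ (rintegrableZ ((\int[mu]_x cmod (g x)) ^+ 2) (rintegrable_pweight h0))).
    apply: measurable_funM; first by apply: continuous_measurable_fun; exact: continuous_pweight.
    by apply: measurable_sqr_cmod; exact: fourier_meas.
  move=> r; rewrite ger0_norm; last by rewrite mulr_ge0 ?pweight_ge0 ?sqr_ge0.
  rewrite mulrC; apply: ler_wpM2r; first exact: pweight_ge0.
  rewrite ler_sqr ?nnegrE ?cmod_ge0//; first exact: fourier_bound.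
  by apply: Rintegral_ge0 => x _; exact: cmod_ge0.
split => //; set W := \int[mu]_r _.
have W0 : 0 <= W by apply: Rintegral_ge0 => r _; rewrite mulr_ge0 ?pweight_ge0 ?sqr_ge0.
have WE : real_complex R W = cint (fun r => fourier g r * damped h g r).
  have fE r : fourier g r * damped h g r = real_complex R (pweight h r * cmod (fourier g r) ^+ 2).
    by rewrite /damped mulrCA [fourier g r * _]mulrC conjM_cmod -rmorphM.
  under eq_cint do rewrite fE.
  by apply: complexP => //=; rewrite Rintegral_cst// mul0r.
have cW : cmod (real_complex R W) = W by rewrite cmod_real ger0_norm.
rewrite -cW WE (fourier_damped_pair h0 cg cg).
have iu : rintegrable u by exact: rintegrable_cmod.
have mu_u : measurable_fun setT u by exact: rintegrable_meas.
have iF : rintegrable (fun x => \int[mu]_y (u x * (u y * poisson h (2 * x - 2 * y)))).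
  apply: (@rfubini_integrable _ (fun x y => u x * (u y * poisson h (2 * x - 2 * y))) u
    (fun y => 2 / h * u y)) => //.
  - apply: measurable_funM; first by apply: (@measurableT_comp _ _ _ _ _ _ u) => //; exact: measurable_fst.
    apply: measurable_funM; first by apply: (@measurableT_comp _ _ _ _ _ _ u) => //; exact: measurable_snd.
    exact: measurable_poisson2.
  - exact: rintegrableZ.
  move=> x y; rewrite ger0_norm; last first.
    by apply: mulr_ge0; [exact: cmod_ge0|apply: mulr_ge0; [exact: cmod_ge0|exact: poisson_ge0]].
  apply: ler_wpM2l; first exact: cmod_ge0.
  by rewrite mulrC; apply: ler_wpM2r; [exact: cmod_ge0|exact: poisson_le].
apply: le_trans (_ : \int[mu]_x \int[mu]_y (u x * (u y * poisson h (2 * x - 2 * y))) <= _).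
  apply: cmod_cint_le => //.
  - by apply: cmeasM; [exact: cintegrable_meas|exact: cmeas_damped_kernel].
  move=> x; rewrite cmodM RintegralZl//; last exact: rintegrable_poissonM.
  by apply: ler_wpM2l; [exact: cmod_ge0|exact: cmod_damped_kernel].
have [_ i2] := sg.
apply: (poisson_schur h0) => //.
- by move=> x; exact: cmod_ge0.
- by move=> x /g_supp; rewrite /u => ->; rewrite cmod0.
Qed.

(** The damping factors increase to 1 as h = 1 / (n + 1) decreases to 0, and the uniform bound
    passes to the limit by monotone convergence. *)
Lemma fourier_upper : sqint (fourier g) /\ sqnorm (fourier g) <= pi * sqnorm g.
Proof.
apply: sqint_le; first exact: fourier_meas.
pose h (n : nat) : R := n.+1%:R^-1.
have h0 n : 0 < h n by rewrite invr_gt0.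
apply: (@monotone_integral_le _ (fun n r => pweight (h n) r * cmod (fourier g r) ^+ 2)).
- move=> n; have [/rintegrable_meas] := damped_fourier_le (h0 n); exact.
- by move=> n r; rewrite mulr_ge0 ?pweight_ge0 ?sqr_ge0.
- move=> r m n mn; apply: ler_wpM2r; first exact: sqr_ge0.
  rewrite /pweight ler_expR !mulNr lerN2; apply: ler_wpM2r => //.
  by rewrite lef_pV2 ?posrE// ler_nat.
- move=> r; rewrite -[X in _ --> X]mul1r; apply: cvgM; last exact: cvg_cst.
  rewrite /pweight -expR0; apply: continuous_cvg; first exact: continuous_expR.
  rewrite -(mul0r `|r|); apply: cvgM; last exact: cvg_cst.
  rewrite -oppr0; apply: cvgN; exact: cvg_harmonic.
- move=> n; have [i1 l1] := damped_fourier_le (h0 n).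
  rewrite -lee_fin /Rintegral fineK in l1 => //.
  exact: (integrable_fin_num measurableT i1).
Qed.

End UpperBound.
End FourierUpper.

(** * Poisson kernels as an approximate identity *)

Section ApproximateIdentity.
Variable R : realType.
Local Notation mu := (@lebesgue_measure R).
Local Notation ie := (\1_`]0, pi[ : R -> R).

Lemma half_split (e p : R) : p != 0 -> e = e / 2 / p * p + e / 2.
Proof. by move=> p0; field. Qed.

Lemma rintegrable_poissonMl (h : R) (u : R -> R) (y : R) : 0 < h -> rintegrable u ->
  rintegrable (fun x => u x * poisson h (2 * x - 2 * y)).
Proof.
by move=> h0 iu; under eq_fun do rewrite poisson_sym; exact: rintegrable_poissonM.
Qed.

Definition eta (j : nat) : R := j.+1%:R^-1.

Lemma eta_gt0 j : 0 < eta j. Proof. by rewrite invr_gt0. Qed.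

Lemma cvg_eta : eta j @[j --> \oo] --> (0 : R).
Proof. exact: cvg_harmonic. Qed.

Lemma cvg_atan_eta (d : R) : 0 < d -> atan (d / eta j) @[j --> \oo] --> (pi / 2 : R).
Proof.
move=> d0; apply: (@cvg_comp _ _ _ (fun j => d / eta j) atan _ (pinfty_nbhs R)); last exact: cvgy_atan.
apply/cvgryPge => A; near=> j; rewrite /eta invrK mulrC -ler_pdivrMr//.
have : A / d <= j%:R by near: j; exact: nbhs_infty_ger.
by move/le_trans; apply; rewrite ler_nat.
Unshelve. all: by end_near. Qed.

Lemma poisson_mass_cvg (y : R) : 0 < y < pi ->
  \int[mu]_x (ie x * poisson (eta j) (2 * x - 2 * y)) @[j --> \oo] --> (pi : R).
Proof.
move=> /andP[y0 yp].
have pE : (pi : R) = pi / 2 - - (pi / 2) by lra.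
rewrite [X in _ --> X]pE.
have : atan (2 * y / eta j) - - atan ((2 * pi - 2 * y) / eta j) @[j --> \oo] -->
    (pi / 2 - - (pi / 2) : R).
  apply: cvgB; first by apply: cvg_atan_eta; lra.
  by apply: cvgN; apply: cvg_atan_eta; lra.
apply: cvg_trans; apply: near_eq_cvg; near=> j.
under eq_Rintegral do rewrite poisson_sym.
rewrite Rintegral_indic Rintegral_poisson ?pi_ge0 ?eta_gt0//.
by rewrite mulr0 subr0 -atanN -mulNr opprB.
Unshelve. all: by end_near. Qed.

Section Continuous.
Variables (phi : R -> R) (B : R).
Hypothesis cphi : continuous phi.
Hypothesis phiB : forall x : R, 0 <= x <= pi -> `|phi x| <= B.

Let B0 : 0 <= B.
Proof. by have := phiB (x := 0); rewrite lexx pi_ge0 => /(_ isT); exact: le_trans. Qed.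

Let avg (j : nat) (y : R) : R := \int[mu]_x (phi x * ie x * poisson (eta j) (2 * x - 2 * y)).

Let mphi : measurable_fun setT (fun x => phi x * ie x).
Proof.
by apply: measurable_funM; [exact: continuous_measurable_fun|exact: measurable_indic_itv].
Qed.

Let phi_le x : `|phi x * ie x| <= B * ie x.
Proof.
rewrite normrM (ger0_norm (indic_itv_ge0 _ _)) indic_itvE.
case: (boolP (0 < x < pi)) => [/andP[x0 xp]|_]; last by rewrite !mulr0.
by rewrite !mulr1 phiB// !ltW.
Qed.

Let iphi : rintegrable (fun x => phi x * ie x).
Proof. exact: (rintegrable_dom mphi (rintegrableZ B (rintegrable_indic_itv _)) phi_le). Qed.

Lemma poisson_avg_cvg (y : R) : 0 < y < pi -> avg j y @[j --> \oo] --> pi * phi y.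
Proof.
move=> yp; have p0 := pi_gt0 R.
have m1 j := rintegrable_poissonM (eta_gt0 j) (2 * y) (rintegrable_indic_itv (pi : R)).
have m2 j := rintegrable_poissonM (eta_gt0 j) (2 * y) iphi.
have avgE j : avg j y - phi y * \int[mu]_x (ie x * poisson (eta j) (2 * x - 2 * y)) =
    \int[mu]_x ((phi x - phi y) * ie x * poisson (eta j) (2 * y - 2 * x)).
  rewrite /avg; under eq_Rintegral do rewrite poisson_sym.
  under [X in _ - _ * X]eq_Rintegral do rewrite poisson_sym.
  rewrite -RintegralZl//; last exact: m1.
  rewrite -(RintegralB measurableT (m2 j) (rintegrableZ (phi y) (m1 j))).
  by apply: eq_Rintegral => x _; ring.
suff h : avg j y - phi y * \int[mu]_x (ie x * poisson (eta j) (2 * x - 2 * y)) @[j --> \oo] --> (0 : R).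
  have h2 : avg j y - phi y * \int[mu]_x (ie x * poisson (eta j) (2 * x - 2 * y)) +
      phi y * \int[mu]_x (ie x * poisson (eta j) (2 * x - 2 * y)) @[j --> \oo] --> 0 + phi y * pi.
    by apply: (cvgD h); apply: cvgM; [exact: cvg_cst|exact: poisson_mass_cvg].
  rewrite add0r [phi y * pi]mulrC in h2; apply: (cvg_trans _ h2).
  by apply: near_eq_cvg; apply: nearW => j; rewrite /= subrK.
rewrite (_ : (fun j => _) = fun j => \int[mu]_x ((phi x - phi y) * ie x * poisson (eta j) (2 * y - 2 * x))); last first.
  by apply/funext => j; exact: avgE.
apply/cvgr0Pnorm_le => e e0.
have e1 : 0 < e / 2 / pi by rewrite !divr_gt0.
have cy : phi x @[x --> y] --> phi y by exact: cphi.
move/cvgr_dist_le : cy => /(_ _ e1)/nbhs_ballP[d /= d0 hd].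
(* Far from y, that is for |y - x| >= d, the difference of values of phi is at most 2 B and the
   kernel at most 2 eta / (2 d)^2, over an edge of length pi. *)
pose K := 2 * B * 2 / (2 * d) ^+ 2 * pi.
have cK : K * eta j @[j --> \oo] --> (0 : R).
  by rewrite -(mulr0 K); apply: cvgM; [exact: cvg_cst|exact: cvg_eta].
have e2 : 0 < e / 2 by lra.
move/cvgr0Pnorm_le : cK => /(_ _ e2); apply: filterS => j hj.
have eta0 := eta_gt0 j.
have ii := rintegrable_indic_itv (pi : R).
pose dom x := e / 2 / pi * (ie x * poisson (eta j) (2 * y - 2 * x)) +
    2 * B * (2 * eta j / (2 * d) ^+ 2) * ie x.
have idom : rintegrable dom by apply: rintegrableD; exact: rintegrableZ.
have md : measurable_fun setT (fun x => (phi x - phi y) * ie x * poisson (eta j) (2 * y - 2 * x)).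
  apply: measurable_funM; last exact: measurable_poisson_shift.
  apply: measurable_funM; last exact: measurable_indic_itv.
  by apply: measurable_funB; [exact: continuous_measurable_fun|exact: measurable_cst].
have ledom x : `|(phi x - phi y) * ie x * poisson (eta j) (2 * y - 2 * x)| <= dom x.
  rewrite /dom normrM (ger0_norm (poisson_ge0 eta0 _)) normrM (ger0_norm (indic_itv_ge0 _ _)) indic_itvE.
  case: (boolP (0 < x < pi)) => [xp|_]; last by rewrite /= !(mulr0, mul0r) addr0.
  rewrite /= !mulr1 mul1r; have pk0 := poisson_ge0 eta0 (2 * y - 2 * x).
  have [xd|xd] := ltP `|y - x| d.
    apply: ler_wpDr.
      by rewrite !mulr_ge0 ?invr_ge0 ?sqr_ge0 ?(ltW eta0).
    by apply: ler_wpM2r => //; rewrite distrC; exact: hd.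
  apply: ler_wpDl; first by apply: mulr_ge0 => //; exact: ltW.
  apply: ler_pM => //.
    apply: le_trans (ler_normB _ _) _; rewrite mulr2n mulrDl mul1r.
    move: xp yp => /andP[x0 x1] /andP[y0 y1].
    by apply: lerD; apply: phiB; rewrite !ltW.
  apply: poisson_far => //; first by lra.
  by rewrite -mulrBr normrM ger0_norm//; lra.
have im : rintegrable (fun x => (phi x - phi y) * ie x * poisson (eta j) (2 * y - 2 * x)).
  exact: rintegrable_dom md idom ledom.
apply: le_trans (le_normr_Rintegral measurableT im) _.
apply: le_trans (_ : \int[mu]_x dom x <= _).
  by apply: le_Rintegral => //; exact: rintegrable_norm.
have ip := rintegrable_poissonM eta0 (2 * y) ii.
have -> : \int[mu]_x dom x = e / 2 / pi * \int[mu]_x (ie x * poisson (eta j) (2 * y - 2 * x)) +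
    2 * B * (2 * eta j / (2 * d) ^+ 2) * pi.
  rewrite /dom (RintegralD measurableT (rintegrableZ _ ip) (rintegrableZ _ ii)).
  rewrite (RintegralZl _ measurableT ip) (RintegralZl _ measurableT ii).
  by rewrite Rintegral_indic_itv ?pi_ge0.
rewrite [leRHS](half_split _ (lt0r_neq0 p0)).
apply: lerD.
  by apply: ler_wpM2l; [exact: ltW|exact: poisson_mass].
apply: le_trans (le_trans (ler_norm _) hj); rewrite /K le_eqVlt; apply/orP; left; apply/eqP.
by field; rewrite gt_eqF.
Qed.

Section Pairing.
Variables (g : R -> R) (n : R).
Hypotheses (mg : measurable_fun setT g) (gn : forall y, `|g y| <= n * ie y).

Lemma poisson_pairing_cvg : \int[mu]_y (g y * avg j y) @[j --> \oo] --> pi * \int[mu]_y (g y * phi y).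
Proof.
have iin := rintegrableZ n (rintegrable_indic_itv (pi : R)).
have ig : rintegrable g by exact: rintegrable_dom mg iin gn.
(* The factor (1 + y^2)^-1 makes the kernel jointly integrable, so that Fubini yields measurability
   of the average in y; the factor is then divided out. *)
have mavg j : measurable_fun setT (avg j).
  have mm : measurable_fun setT (fun p : R * R => (phi p.2 * ie p.2) * poisson (eta j) (2 * p.2 - 2 * p.1) * (oneDsqr p.1)^-1).
    apply: measurable_funM; first apply: measurable_funM.
    - by apply: (@measurableT_comp _ _ _ _ _ _ (fun x => phi x * ie x)) => //; exact: measurable_snd.
    - under eq_fun do rewrite poisson_sym; exact: measurable_poisson2 (eta_gt0 j).
    - apply: (@measurableT_comp _ _ _ _ _ _ (fun x => (oneDsqr x)^-1)); last exact: measurable_fst.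
      exact: rintegrable_meas (rintegrable_oneDsqrV R).
  pose k (y x : R) := phi x * ie x * poisson (eta j) (2 * x - 2 * y) * (oneDsqr y)^-1.
  have kb y x : `|k y x| <= 2 / eta j * (oneDsqr y)^-1 * `|phi x * ie x|.
    have o0 : 0 <= (oneDsqr y)^-1 by rewrite invr_ge0 (le_trans ler01).
    rewrite /k normrM (ger0_norm o0) [leRHS]mulrAC; apply: ler_wpM2r => //.
    rewrite normrM [leLHS]mulrC (ger0_norm (poisson_ge0 (eta_gt0 j) _)).
    by apply: ler_wpM2r => //; exact: poisson_le (eta_gt0 j) _.
  have := rfubini_integrable (k := k) mm (rintegrableZ _ (rintegrable_oneDsqrV R))
    (rintegrable_norm iphi) kb.
  rewrite (_ : (fun y => _) = fun y => avg j y * (oneDsqr y)^-1); last first.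
    apply/funext => y; rewrite /k RintegralZr//.
    exact: (rintegrable_poissonMl y (eta_gt0 j) iphi).
  move=> /rintegrable_meas.
  move=> m1; rewrite (_ : avg j = fun y => avg j y * (oneDsqr y)^-1 * oneDsqr y).
    by apply: measurable_funM => //; apply: continuous_measurable_fun; exact: continuous_oneDsqr.
  by apply/funext => y; rewrite divfK.
have avgB j y : `|avg j y| <= B * pi.
  by rewrite /avg; under eq_Rintegral do rewrite poisson_sym; exact: (poisson_average_le (eta_gt0 j) (2 * y) mphi phi_le).
have idom := rintegrableZ (n * (B * pi)) (rintegrable_indic_itv (pi : R)).
have [] := @dominated_convergence _ _ R mu setT measurableT
  (fun j y => (g y * avg j y)%:E) (fun y => (g y * (pi * phi y))%:E)
  (fun y => (n * (B * pi) * ie y)%:E).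
- move=> j; apply/measurable_EFinP.
  by apply: measurable_funM; [exact: mg|exact: mavg].
- apply/measurable_EFinP; apply: measurable_funM => //.
  by apply: measurable_funM; [exact: measurable_cst|exact: continuous_measurable_fun].
- apply: aeW => y _; apply: cvg_EFin; first exact: nearW.
  have [yp|yp] := boolP (0 < y < pi).
    by apply: cvgM; [exact: cvg_cst|exact: poisson_avg_cvg].
  have -> : g y = 0.
    by apply/normr0_eq0/eqP; rewrite eq_le normr_ge0 andbT (le_trans (gn y))// indic_itvE (negbTE yp) mulr0.
  by under eq_cvg do rewrite /= mul0r; rewrite mul0r; exact: cvg_cst.
- exact: idom.
- apply: aeW => y j _; rewrite lee_fin normrM [leRHS]mulrAC.
  by apply: ler_pM; [exact: normr_ge0..|exact: gn|exact: avgB].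
move=> iF _ hc; have fin := integrable_fin_num measurableT iF.
rewrite -(fineK fin) in hc; move/fine_cvg : hc => h.
have <- : fine (\int[mu]_y (g y * (pi * phi y))%:E) = pi * \int[mu]_y (g y * phi y).
  rewrite -RintegralZl//; first by apply: eq_Rintegral => y _; rewrite mulrCA.
  apply: (rintegrable_dom _ (rintegrableZ (n * B) (rintegrable_indic_itv (pi : R)))).
    by apply: measurable_funM => //; exact: continuous_measurable_fun.
  move=> y; rewrite normrM; have [yp|yp] := boolP (0 < y < pi).
    rewrite [leRHS]mulrAC; apply: ler_pM; [exact: normr_ge0..|exact: gn|].
    by apply: phiB; case/andP: yp => y0 y1; rewrite !ltW.
  have -> : g y = 0.
    by apply/normr0_eq0/eqP; rewrite eq_le normr_ge0 andbT (le_trans (gn y))// indic_itvE (negbTE yp) mulr0.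
  rewrite normr0 mul0r indic_itvE (negbTE yp) mulr0//.
exact: h.
Qed.

End Pairing.
End Continuous.
End ApproximateIdentity.

(** * Poisson averages paired with integrable functions *)

Section FourierLower.
Variable R : realType.
Local Notation mu := (@lebesgue_measure R).
Local Notation ie := (\1_`]0, pi[ : R -> R).

Lemma mulr_div4_le (m e : R) : 0 <= m -> 0 < e -> m * (e / (4 * (m + 1))) <= e / 4.
Proof.
move=> m0 e0; have m1 : 0 < m + 1 by lra.
have -> : m * (e / (4 * (m + 1))) = m * e / 4 / (m + 1) by field; rewrite gt_eqF.
by rewrite ler_pdivrMr//; nra.
Qed.

Lemma le_dist3 (a b c d e k : R) : `|a - b| <= k -> `|b - c| <= e / 2 -> `|c - d| <= k ->
  k <= e / 4 -> `|a - d| <= e.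
Proof.
move=> h1 h2 h3 h4; have -> : a - d = (a - b) + (b - c) + (c - d) by ring.
by apply: le_trans (ler_normD _ _) _; have := ler_normD (a - b) (b - c); lra.
Qed.

Lemma approx_continuous (f : R -> R) (e : R) : rintegrable f ->
  (forall x, ~~ (0 < x < pi) -> f x = 0) -> 0 < e ->
  exists phi : R -> R, [/\ continuous phi, rintegrable (fun x => f x - phi x * ie x) &
    \int[mu]_x `|f x - phi x * ie x| <= e].
Proof.
move=> if_ f0 e0; pose D := `]0%R, pi[%classic : set R.
have mD : measurable D by exact: measurable_itv.
have muD : (mu D < +oo)%E.
  by rewrite lebesgue_measure_itv/= lte_fin pi_gt0 -EFinD ltry.
have ifD : mu.-integrable D (EFin \o f) by exact: (integrableS measurableT).
have [g_ [cg ig /fine_cvgP[_ hg]]] := approximation_continuous_integrable mD muD ifD.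
move/cvgr0Pnorm_le : hg => /(_ _ e0)[n _ /(_ n (leqnn n))] /= hn.
have eqf x : f x - g_ n x * ie x = ie x * (f x - g_ n x).
  rewrite indic_itvE; have [_|/f0 ->] := boolP (0 < x < pi); last by rewrite !(mulr0, mul0r) subr0.
  by rewrite mulr1 mul1r.
exists (g_ n); split; first exact: cg.
- under eq_fun do rewrite eqf.
  have iB := @integrableB _ _ R mu D mD _ _ ifD (ig n).
  have := (@integrable_mkcond _ _ R mu D _ mD).1 iB.
  congr (is_true (mu.-integrable _ _)); apply/funext => x /=.
  rewrite patchE indicE; case: (x \in D) => /=; by rewrite ?mul1r ?mul0r.
- apply: le_trans (ler_norm _) _; apply: le_trans hn; rewrite le_eqVlt; apply/orP; left.
  apply/eqP; congr (`|_|); under eq_Rintegral do rewrite eqf normrM (ger0_norm (indic_itv_ge0 _ _)).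
  by rewrite Rintegral_indic.
Qed.

Lemma continuous_bounded_itv (phi : R -> R) : continuous phi ->
  exists B, forall x : R, 0 <= x <= pi -> `|phi x| <= B.
Proof.
move=> cphi.
have : compact [set phi x | x in `[0, pi]%classic].
  apply: continuous_compact; first exact: continuous_subspaceT.
  exact: segment_compact.
move=> /compact_bounded[B [_ hB]]; exists (B + 1) => x x01.
by apply: hB; [rewrite ltrDl|exists x => //=; rewrite in_itv].
Qed.

Section RealApprox.
Variables (f g : R -> R) (n : R).
Hypothesis if_ : rintegrable f.
Hypothesis f0 : forall x, ~~ (0 < x < pi) -> f x = 0.
Hypotheses (mg : measurable_fun setT g) (gn : forall y, `|g y| <= n * ie y).

Let iin := rintegrableZ n (rintegrable_indic_itv (pi : R)).
Let ig : rintegrable g. Proof. exact: rintegrable_dom mg iin gn. Qed.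

Let avg (j : nat) (x : R) : R := \int[mu]_y (g y * poisson (eta R j) (2 * x - 2 * y)).

Let n0 : 0 <= n.
Proof.
have p0 := pi_gt0 R; have p2 : 0 < (pi / 2 : R) < pi by apply/andP; split; lra.
by have := gn (pi / 2); rewrite indic_itvE p2 mulr1; exact: le_trans.
Qed.

Let avg_le j x : `|avg j x| <= n * pi.
Proof. exact: (poisson_average_le (eta_gt0 R j) (2 * x) mg gn). Qed.

Section Kernel.
Variables (u : R -> R) (j : nat).
Hypothesis iu : rintegrable u.

Let k x y := u x * (g y * poisson (eta R j) (2 * x - 2 * y)).

Let mk : measurable_fun setT (fun p : R * R => k p.1 p.2).
Proof.
apply: measurable_funM.
  apply: (@measurableT_comp _ _ _ _ _ _ u); [exact: rintegrable_meas|exact: measurable_fst].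
apply: measurable_funM.
  by apply: (@measurableT_comp _ _ _ _ _ _ g) => //; exact: measurable_snd.
exact: (measurable_poisson2 (eta_gt0 R j)).
Qed.

Let kb x y : `|k x y| <= `|u x| * (2 / eta R j * `|g y|).
Proof.
rewrite /k normrM; apply: ler_wpM2l => //; rewrite normrM [leLHS]mulrC.
apply: ler_wpM2r => //; rewrite (ger0_norm (poisson_ge0 (eta_gt0 R j) _)).
exact: (poisson_le (eta_gt0 R j) (2 * x - 2 * y)).
Qed.

Let kE x : \int[mu]_y k x y = u x * avg j x.
Proof. by rewrite /k RintegralZl//; exact: (rintegrable_poissonM (eta_gt0 R j) (2 * x) ig). Qed.

Lemma rintegrable_avg : rintegrable (fun x => u x * avg j x).
Proof.
have := rfubini_integrable mk (rintegrable_norm iu) (rintegrableZ _ (rintegrable_norm ig)) kb.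
by congr (rintegrable _); apply/funext => x; rewrite kE.
Qed.

Lemma avg_swap : \int[mu]_x (u x * avg j x) =
  \int[mu]_y (g y * \int[mu]_x (u x * poisson (eta R j) (2 * x - 2 * y))).
Proof.
have := rfubini mk (rintegrable_norm iu) (rintegrableZ _ (rintegrable_norm ig)) kb.
rewrite (_ : \int[mu]_x \int[mu]_y k x y = \int[mu]_x (u x * avg j x)); last first.
  by apply: eq_Rintegral => x _; exact: kE.
move=> ->; apply: eq_Rintegral => y _; rewrite -RintegralZl//; last first.
  exact: (rintegrable_poissonMl y (eta_gt0 R j) iu).
by apply: eq_Rintegral => x _; rewrite /k mulrCA.
Qed.

Lemma avg_pairing_le : `|\int[mu]_x (u x * avg j x)| <= n * pi * \int[mu]_x `|u x|.
Proof.
apply: le_trans (le_normr_Rintegral measurableT rintegrable_avg) _.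
rewrite -RintegralZl//; last exact: rintegrable_norm.
apply: le_Rintegral => //.
- exact: (rintegrable_norm rintegrable_avg).
- by apply: rintegrableZ; exact: rintegrable_norm.
by move=> x _; rewrite normrM mulrC; apply: ler_wpM2r => //; exact: avg_le.
Qed.

End Kernel.

Let g_le y : `|g y| <= n.
Proof. by apply: le_trans (gn y) _; rewrite ler_piMr// indic_itv_le1. Qed.

Let rintegrable_pairing u : rintegrable u -> rintegrable (fun y => g y * u y).
Proof.
move=> iu; apply: (rintegrable_dom _ (rintegrableZ n (rintegrable_norm iu))).
  by apply: measurable_funM; [exact: mg|exact: rintegrable_meas].
move=> y; rewrite normrM; apply: ler_wpM2r; [exact: normr_ge0|exact: g_le].
Qed.

Let pairing_indic (u : R -> R) : \int[mu]_y (g y * u y) = \int[mu]_y (g y * (u y * ie y)).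
Proof.
apply: eq_Rintegral => y _; rewrite indic_itvE.
have [yp|/negbTE yp] := boolP (0 < y < pi); first by rewrite mulr1.
have := gn y; rewrite indic_itvE yp mulr0 normr_le0 => /eqP ->.
by rewrite !mul0r.
Qed.

Let pairing_le u : rintegrable u -> `|\int[mu]_y (g y * u y)| <= n * \int[mu]_y `|u y|.
Proof.
move=> iu; have igu := rintegrable_pairing iu.
apply: le_trans (le_normr_Rintegral measurableT igu) _.
rewrite -(RintegralZl _ measurableT (rintegrable_norm iu)).
apply: (le_Rintegral measurableT (rintegrable_norm igu) (rintegrableZ n (rintegrable_norm iu))).
move=> y _; rewrite normrM; apply: ler_wpM2r; [exact: normr_ge0|exact: g_le].
Qed.

(** As f is merely integrable, it is first replaced by a continuous function close to it in L1. The
    Poisson averages of g are bounded by n pi uniformly in j, so the replacement costs at most n pi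
    times the L1 error on both sides of the limit. *)
Lemma poisson_approx : \int[mu]_x (f x * avg j x) @[j --> \oo] --> pi * \int[mu]_y (g y * f y).
Proof.
have p0 := pi_gt0 R.
apply/cvgrPdist_le => e e0.
(* With an L1 error of e / K, each of the two replacements costs at most e / 4; the summand 1 keeps
   K positive when n = 0. *)
pose K := 4 * (n * pi + 1).
have np0 : 0 <= n * pi by rewrite mulr_ge0// ltW.
have K0 : 0 < K by rewrite /K mulr_gt0// ltr_wpDl.
have [phi [cphi ifp lfp]] := approx_continuous if_ f0 (divr_gt0 e0 K0).
have [B phiB] := continuous_bounded_itv cphi.
have e2 : 0 < e / 2 by rewrite divr_gt0.
have hc := poisson_pairing_cvg cphi phiB mg gn.
move/cvgrPdist_le : hc => /(_ _ e2).
apply: filterS => j; pose P := pi * \int[mu]_y (g y * phi y).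
pose J := \int[mu]_y (g y * \int[mu]_x (phi x * ie x * poisson (eta R j) (2 * x - 2 * y))) => hj.
have iphi : rintegrable (fun x => phi x * ie x).
  have := rintegrableB if_ ifp; congr (rintegrable _); apply/funext => x.
  by rewrite opprB addrCA subrr addr0.
have JE : J = \int[mu]_x (phi x * ie x * avg j x) by rewrite (avg_swap j iphi).
have h3 : `|J - \int[mu]_x (f x * avg j x)| <= n * pi * (e / K).
  have := le_trans (avg_pairing_le j ifp) (ler_wpM2l np0 lfp).
  rewrite JE distrC -(RintegralB measurableT (rintegrable_avg j if_) (rintegrable_avg j iphi)).
  by under eq_Rintegral do rewrite mulrBl.
have h1 : `|pi * \int[mu]_y (g y * f y) - P| <= n * pi * (e / K).
  have -> : P = pi * \int[mu]_y (g y * (phi y * ie y)) by rewrite /P pairing_indic.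
  rewrite -mulrBr normrM (gtr0_norm p0) -(RintegralB measurableT (rintegrable_pairing if_) (rintegrable_pairing iphi)).
  rewrite mulrAC mulrC; apply: ler_wpM2r; first exact: ltW.
  under eq_Rintegral do rewrite -mulrBr.
  apply: le_trans (pairing_le ifp) _; exact: ler_wpM2l.
have hK : n * pi * (e / K) <= e / 4.
  exact: mulr_div4_le.
exact: (le_dist3 h1 hj h3 hK).
Qed.

End RealApprox.
End FourierLower.

(** * Lower bound for a Fourier transform modulo higher exponents *)

Section FourierLowerBound.
Variable R : realType.
Local Notation mu := (@lebesgue_measure R).
Local Notation ie := (\1_`]0, pi[ : R -> R).

Lemma cmod_cint_sqint (f g : R -> R[i]) : sqint f -> sqint g ->
  cmod (cint (fun x => f x * g x)) <= 2^-1 * (sqnorm f + sqnorm g).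
Proof.
move=> [mf if2] [mg ig2].
rewrite /sqnorm -(RintegralD measurableT if2 ig2).
rewrite -(RintegralZl _ measurableT (rintegrableD if2 ig2)).
apply: cmod_cint_le; first exact: cmeasM.
- by apply: rintegrableZ; exact: rintegrableD.
by move=> x; rewrite cmodM; exact: mulr_le_half_sqr.
Qed.

Lemma le_half_add (x y : R) : x <= 2^-1 * (y + x) -> x <= y.
Proof. lra. Qed.

Lemma le_dist_double (x x' s y : R) : 2 * x <= s -> y < x' -> 2 * (x - x') <= s - 2 * y.
Proof. lra. Qed.

Lemma Re_damped_kernel (h : R) (g : R -> R[i]) s : cintegrable g ->
  complex.Re (damped_kernel h g s) = \int[mu]_y (complex.Re (g y) * poisson h (s - 2 * y)).
Proof.
move=> cg; rewrite -[LHS]/(\int[mu]_y complex.Re ((g y)^*%C * real_complex R (poisson h (s - 2 * y)))).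
by apply: eq_Rintegral => y _; rewrite Re_mul; case: (g y) => u v /=; ring.
Qed.

Lemma Im_damped_kernel (h : R) (g : R -> R[i]) s : 0 < h -> cintegrable g ->
  complex.Im (damped_kernel h g s) = - \int[mu]_y (complex.Im (g y) * poisson h (s - 2 * y)).
Proof.
move=> h0 [g1 g2].
rewrite -[LHS]/(\int[mu]_y complex.Im ((g y)^*%C * real_complex R (poisson h (s - 2 * y)))).
rewrite -mulN1r -RintegralZl//; last exact: rintegrable_poissonM.
by apply: eq_Rintegral => y _; rewrite Im_mul; case: (g y) => u v /=; ring.
Qed.

Section Truncated.
Variables (f g E : R -> R[i]) (b b' n M c : R).
Hypotheses (bp : b <= pi) (b'b : b' < b).
Hypotheses (sf : sqint f) (f0 : forall x, ~~ (0 < x < b) -> f x = 0).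
Hypothesis mg : cmeas g.
Hypothesis gf : forall x, g x = f x \/ g x = 0.
Hypothesis gn : forall x, cmod (g x) <= n.
Hypothesis g0 : forall x, ~~ (0 < x < b') -> g x = 0.
Hypothesis sE : spec (2 * b) M E.
Hypothesis sH : sqint (fun r => fourier f r + E r).
Hypothesis Hc : sqnorm (fun r => fourier f r + E r) <= c.

Let f_supp x : ~~ (0 < x < pi) -> f x = 0.
Proof.
move=> xp; apply: f0; apply: contra xp => /andP[-> xb] /=.
exact: lt_le_trans bp.
Qed.

Let g_supp x : ~~ (0 < x < pi) -> g x = 0.
Proof. by move=> /f_supp fx; case: (gf x) => ->. Qed.

Let cf : cintegrable f. Proof. exact: sqint_supp_cintegrable sf f_supp. Qed.

Let sg : sqint g.
Proof.
have [mf if2] := sf; split => //.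
apply: (rintegrable_dom _ if2); first exact: measurable_sqr_cmod.
move=> x; rewrite ger0_norm ?sqr_ge0//; case: (gf x) => -> //.
by rewrite cmod0 expr0n sqr_ge0.
Qed.

Let cg : cintegrable g. Proof. exact: sqint_supp_cintegrable sg g_supp. Qed.

Let gn1 y : `|complex.Re (g y)| <= n * ie y.
Proof.
rewrite indic_itvE; have [_|/g_supp ->] := boolP (0 < y < pi); last by rewrite normr0 mulr0.
by rewrite mulr1; apply: le_trans (Re_le_cmod _) (gn y).
Qed.

Let gn2 y : `|complex.Im (g y)| <= n * ie y.
Proof.
rewrite indic_itvE; have [_|/g_supp ->] := boolP (0 < y < pi); last by rewrite normr0 mulr0.
by rewrite mulr1; apply: le_trans (Im_le_cmod _) (gn y).
Qed.

Let T j : R := complex.Re (cint (fun x => f x * damped_kernel (eta R j) g (2 * x))).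

(** Since g equals f or 0 at each point, the real part of f times the conjugate of g is |g|^2. *)
Lemma truncated_cvg : T j @[j --> \oo] --> pi * sqnorm g.
Proof.
have [f1 f2] := cf; have [m1 m2] := mg; have [g1 g2] := cg.
have f10 x : ~~ (0 < x < pi) -> complex.Re (f x) = 0 by move=> /f_supp ->.
have f20 x : ~~ (0 < x < pi) -> complex.Im (f x) = 0 by move=> /f_supp ->.
have l1 := poisson_approx f1 f10 m1 gn1; have l2 := poisson_approx f2 f20 m2 gn2.
have -> : pi * sqnorm g = pi * \int[mu]_y (complex.Re (g y) * complex.Re (f y)) +
    pi * \int[mu]_y (complex.Im (g y) * complex.Im (f y)).
  rewrite -mulrDr -RintegralD//; last 2 first.
  - apply: (rintegrable_dom _ (rintegrableZ n (rintegrable_norm f1))).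
      by apply: measurable_funM => //; exact: rintegrable_meas.
    move=> x; rewrite normrM; apply: ler_wpM2r => //.
    exact: le_trans (Re_le_cmod _) (gn x).
  - apply: (rintegrable_dom _ (rintegrableZ n (rintegrable_norm f2))).
      by apply: measurable_funM => //; exact: rintegrable_meas.
    move=> x; rewrite normrM; apply: ler_wpM2r => //.
    exact: le_trans (Im_le_cmod _) (gn x).
  congr (_ * _); apply: eq_Rintegral => x _.
  by rewrite sqr_cmod; case: (gf x) => ->; rewrite ?expr2// !mul0r.
have h : \int[mu]_x (complex.Re (f x) * \int[mu]_y (complex.Re (g y) * poisson (eta R j) (2 * x - 2 * y))) +
    \int[mu]_x (complex.Im (f x) * \int[mu]_y (complex.Im (g y) * poisson (eta R j) (2 * x - 2 * y)))
    @[j --> \oo] --> pi * \int[mu]_y (complex.Re (g y) * complex.Re (f y)) +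
    pi * \int[mu]_y (complex.Im (g y) * complex.Im (f y)) by exact: cvgD.
apply: (cvg_trans _ h); apply: near_eq_cvg; apply: nearW => j.
have k1 := @rintegrable_avg _ _ _ m1 gn1 _ j f1; have k2 := @rintegrable_avg _ _ _ m2 gn2 _ j f2.
rewrite -(RintegralD measurableT k1 k2) /T.
rewrite -[RHS]/(\int[mu]_x complex.Re (f x * damped_kernel (eta R j) g (2 * x))).
apply: eq_Rintegral => x _.
by rewrite Re_mul Re_damped_kernel// (Im_damped_kernel _ (eta_gt0 R j) cg) mulrN opprK.
Qed.

(** Pair [fourier f + E] with the damped transform of g. The pairing with E is O(eta), because its
    exponents stay at distance at least 2 (b - b') from those of g; the pairing with the whole sum
    is at most half of c + pi * sqnorm g. In the limit pi * sqnorm g is bounded by this half sum,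
    hence by c. *)
Lemma truncated_lower : pi * sqnorm g <= c.
Proof.
pose D := 2 * (b - b'); have D0 : 0 < D by rewrite /D mulr_gt0// subr_gt0.
pose K := M * (2 / D ^+ 2 * \int[mu]_y cmod (g y)).
have M0 := spec_ge0 sE.
have I0 : 0 <= \int[mu]_y cmod (g y) by apply: Rintegral_ge0 => y _; exact: cmod_ge0.
have step j : T j <= 2^-1 * (c + pi * sqnorm g) + K * eta R j.
  have h0 := eta_gt0 R j; have cD := cintegrable_damped h0 cg.
  have [sgh lgh] := fourier_upper sg g_supp.
  have sD : sqint (damped (eta R j) g) /\ sqnorm (damped (eta R j) g) <= pi * sqnorm g.
    have [] := @sqint_dom _ (damped (eta R j) g) (fun r => cmod (fourier g r) ^+ 2).
    - exact: cintegrable_meas.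
    - by case: sgh.
    - move=> r; rewrite cmodM cmod_conj ler_sqr ?nnegrE ?mulr_ge0 ?cmod_ge0// cmod_real.
      rewrite (ger0_norm (pweight_ge0 _ _)) ler_piMl ?cmod_ge0//.
      exact: pweight_le1.
    by move=> s1 l1; split => //; exact: le_trans l1 lgh.
  have [mE bE sE'] := sE.
  have cE : cintegrable (fun r => E r * damped (eta R j) g r) by exact: (cintegrable_bM mE bE cD).
  have cF : cintegrable (fun r => fourier f r * damped (eta R j) g r).
    apply: (@cintegrable_bM _ _ _ (\int[mu]_x cmod (f x)) _ _ cD); first exact: fourier_meas.
    by move=> r; exact: fourier_bound.
  have hE : cmod (cint (fun r => E r * damped (eta R j) g r)) <= K * eta R j.
    rewrite /K -mulrA; apply: sE' => // s sb; rewrite (damped_pair h0 cg).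
    apply: le_trans (cmod_damped_kernel h0 cg s) _.
    rewrite mulrAC -RintegralZl//; last exact: rintegrable_cmod.
    apply: le_Rintegral => //.
    - by apply: rintegrable_poissonM => //; exact: rintegrable_cmod.
    - by apply: rintegrableZ; exact: rintegrable_cmod.
    move=> y _; have [yb|/g0 ->] := boolP (0 < y < b'); last by rewrite cmod0 mul0r mulr0.
    rewrite mulrC; apply: ler_wpM2r; first exact: cmod_ge0.
    rewrite [2 / _ * _]mulrAC; apply: poisson_far => //.
    apply: le_trans (ler_norm _); rewrite /D.
    by case/andP : yb => _ yb; exact: le_dist_double.
  have := cmod_cint_sqint sH sD.1.
  under eq_cint do rewrite mulrDl.
  rewrite cintD// (fourier_damped_pair h0 cg cf) => hX.
  have hT : T j <= cmod (cint (fun x => f x * damped_kernel (eta R j) g (2 * x)) +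
      cint (fun r => E r * damped (eta R j) g r)) +
      cmod (cint (fun r => E r * damped (eta R j) g r)).
    apply: le_trans (le_trans (ler_norm _) (Re_le_cmod _)) _.
    by rewrite -{1}(addrK (cint (fun r => E r * damped (eta R j) g r)) (cint (fun x => _))) cmodB.
  apply: le_trans hT _; apply: lerD => //; apply: le_trans hX _.
  by rewrite ler_wpM2l//; apply: lerD => //; exact: sD.2.
have lim1 : 2^-1 * (c + pi * sqnorm g) + K * eta R j @[j --> \oo] --> 2^-1 * (c + pi * sqnorm g) + K * 0.
  by apply: cvgD; [exact: cvg_cst|apply: cvgM; [exact: cvg_cst|exact: cvg_eta]].
have : pi * sqnorm g <= 2^-1 * (c + pi * sqnorm g) + K * 0.
  by apply: (ler_cvg_to truncated_cvg lim1); exact: nearW.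
rewrite mulr0 addr0; exact: le_half_add.
Qed.

End Truncated.
Lemma measurable_natr_bool d (T : measurableType d) (P : T -> bool) : measurable_fun setT P ->
  measurable_fun setT (fun x => ((P x)%:R : R)).
Proof.
move=> mP; rewrite (_ : (fun x => _) = fun x => if P x then 1 else 0); last first.
  by apply/funext => x; case: (P x).
by apply: measurable_fun_ifT.
Qed.

(* Pair fourier f + E with a damped transform of a truncation of f supported left of b: the damped
   transform has no mass on the exponents >= 2 b of E in the limit, so E drops out. *)
Theorem fourier_lower (f E : R -> R[i]) (b M c : R) : b <= pi -> sqint f ->
  (forall x, ~~ (0 < x < b) -> f x = 0) -> spec (2 * b) M E ->
  sqint (fun r => fourier f r + E r) -> sqnorm (fun r => fourier f r + E r) <= c ->
  pi * sqnorm f <= c.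
Proof.
move=> bp sf f0 sE sH Hc; have p0 := pi_gt0 R; have [mf if2] := sf.
(* Boundedness allows the use of [poisson_approx], and the margin [eta R n] keeps the support away
   from b; both restrictions disappear as n grows. *)
pose A n x := (cmod (f x) <= n%:R) && (x < b - eta R n).
pose g n x := real_complex R ((A n x)%:R) * f x.
have gE n x : g n x = if A n x then f x else 0.
  by rewrite /g; case: (A n x); rewrite ?mul1r ?mul0r.
have mA n : measurable_fun setT (fun x => ((A n x)%:R : R)).
  apply: measurable_natr_bool; apply: measurable_and.
    by apply: measurable_fun_ler; [exact: cmeas_cmod|exact: measurable_cst].
  by apply: measurable_fun_ltr; [exact: measurable_id|exact: measurable_cst].
have mg n : cmeas (g n) by apply: cmeasM => //; exact: cmeas_real.
have main n : pi * sqnorm (g n) <= c.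
  apply: (@truncated_lower f (g n) E b (b - eta R n) n%:R M) => //.
  - by rewrite ltrBlDr ltrDl eta_gt0.
  - by move=> x; rewrite gE; case: ifP; [left|right].
  - by move=> x; rewrite gE; case: ifP => [/andP[]//|_]; rewrite cmod0.
  - move=> x xb; rewrite gE; case: ifP => // /andP[_ xb'].
    have [x0|x0] := ltP 0 x; first by rewrite x0 xb' in xb.
    by apply: f0; rewrite ltNge x0.
have Amono x m n : (m <= n)%N -> A m x -> A n x.
  move=> mn /andP[h1 h2]; apply/andP; split; first by rewrite (le_trans h1)// ler_nat.
  apply: lt_le_trans h2 _; rewrite lerD2l lerN2 /eta lef_pV2 ?posrE// ler_nat//.
suff : sqnorm f <= c / pi by rewrite ler_pdivlMr// mulrC.
have [] := @sqint_le _ f (c / pi) mf; last by [].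
apply: (@monotone_integral_le _ (fun n x => cmod (g n x) ^+ 2)).
- by move=> n; exact: measurable_sqr_cmod.
- by move=> n x; exact: sqr_ge0.
- move=> x m n mn; rewrite !gE; case: ifP => [/(Amono _ _ _ mn) -> //|_].
  by rewrite cmod0 expr0n; exact: sqr_ge0.
- move=> x; apply: cvg_near_cst; have [fx0|fx0] := eqVneq (f x) 0.
    by apply: nearW => n; rewrite gE fx0; case: ifP.
  have xb : 0 < x < b by apply: contraNT fx0 => /f0 ->.
  have xb0 : 0 < b - x by rewrite subr_gt0; case/andP: xb.
  have hl : \forall n \near \oo, `|eta R n| < b - x.
    by have /cvgr0Pnorm_lt/(_ _ xb0) := @cvg_eta R.
  near=> n; rewrite gE ifT//; apply/andP; split.
    by near: n; exact: nbhs_infty_ger.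
  rewrite ltrBrDr -ltrBrDl; apply: le_lt_trans (ler_norm _) _; near: n.
  exact: hl.
- move=> n; have [mgn ign] : sqint (g n).
    split => //; apply: (rintegrable_dom _ if2); first exact: measurable_sqr_cmod.
    move=> x; rewrite ger0_norm ?sqr_ge0// gE; case: ifP => // _.
    by rewrite cmod0 expr0n; exact: sqr_ge0.
  have := main n; rewrite mulrC -ler_pdivlMr// -lee_fin /sqnorm /Rintegral fineK//.
  exact: (integrable_fin_num measurableT ign).
Unshelve. all: by end_near. Qed.

End FourierLowerBound.

(** * Wave fronts and the step-by-step estimate *)

Section Front.
Variable R : realType.
Local Notation mu := (@lebesgue_measure R).
Implicit Types (p d : R -> R) (E F : R -> R -> R[i]).

Lemma jmeas_cst (c : R[i]) : jmeas (fun _ _ : R => c).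
Proof. exact: (@cmeas_cst _ _ _ c). Qed.

(** The size of an O(1/r) term, without singularity at r = 0; its square has integral pi over the
    line. *)
Definition jap (r : R) : R := (Num.sqrt (oneDsqr r))^-1.

Lemma jap_ge0 r : 0 <= jap r. Proof. by rewrite invr_ge0 sqrtr_ge0. Qed.

Lemma sqr_jap r : jap r ^+ 2 = (oneDsqr r)^-1.
Proof. by rewrite /jap exprVn sqr_sqrtr// (le_trans ler01)// oneDsqr_ge1. Qed.

Lemma jap_le1 r : jap r <= 1.
Proof.
rewrite -ler_sqr ?nnegrE ?jap_ge0// expr1n sqr_jap.
by rewrite invf_le1 ?oneDsqr_ge1// (lt_le_trans ltr01)// oneDsqr_ge1.
Qed.

(** Adding the squares of the two bounds gives t^2 (1 + r^2) <= A^2 + B^2. *)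
Lemma le_jap (r t A B : R) : 0 <= t -> t <= A -> `|r| * t <= B -> t <= (A + B) * jap r.
Proof.
move=> t0 tA rtB.
have A0 := le_trans t0 tA; have B0 : 0 <= B by apply: le_trans rtB; rewrite mulr_ge0.
have o0 : 0 < oneDsqr r by rewrite (lt_le_trans ltr01)// oneDsqr_ge1.
rewrite -ler_sqr ?nnegrE ?mulr_ge0 ?addr_ge0 ?jap_ge0// exprMn sqr_jap ler_pdivlMr//.
rewrite /oneDsqr mulrDr mulr1 -exprMn.
have h1 : t ^+ 2 <= A ^+ 2 by rewrite ler_sqr.
have h2 : (t * r) ^+ 2 <= B ^+ 2.
  rewrite -(real_normK (num_real (t * r))) ler_sqr ?nnegrE// normrM (ger0_norm t0) mulrC//.
apply: le_trans (lerD h1 h2) _; rewrite sqrrD -addrA lerD2l lerDr.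
by rewrite mulrn_wge0// mulr_ge0.
Qed.

Lemma cmodV (z : R[i]) : cmod z^-1 = (cmod z)^-1.
Proof. exact: Normc.normcV. Qed.

Lemma sqint_jap (f : R -> R[i]) K : cmeas f -> 0 <= K -> (forall r, cmod (f r) <= K * jap r) ->
  sqint f /\ sqnorm f <= pi * K ^+ 2.
Proof.
move=> mf K0 fK.
have io := rintegrable_oneDsqrV R.
have [|s1 l1] := @sqint_dom _ f (fun r => K ^+ 2 * (oneDsqr r)^-1) mf (rintegrableZ _ io) _.
  move=> r; rewrite -sqr_jap -exprMn ler_sqr ?nnegrE ?cmod_ge0//.
  by rewrite mulr_ge0 ?jap_ge0.
split => //; apply: le_trans l1 _; rewrite (RintegralZl _ measurableT io).
by rewrite {1}/Rintegral integral_oneDsqrV/= mulrC.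
Qed.

(* E x has exponents >= p x: it is c exp(i p r) plus exponents >= p + d plus O(1/r). *)
Definition front p d (c : R[i]) (M : R) E := [/\ jmeas E, cmod c <= M &
  exists E1, jmeas E1 /\ forall x, 0 < x < pi -> [/\ spec (p x) M (E x),
    spec (p x + d x) M (E1 x) &
    forall r, cmod (E x r - c * cis (p x * r) - E1 x r) <= M * jap r]].

(** Cauchy-Schwarz, obtained by integrating (|u| - t)^2 over the interval with t the mean of |u|. *)
Lemma sqr_int_le (u : R -> R[i]) (a b : R) : a <= b -> sqint u -> cintegrable u ->
  (forall x, ~~ (a <= x < b) -> u x = 0) ->
  (\int[mu]_x cmod (u x)) ^+ 2 <= (b - a) * sqnorm u.
Proof.
move=> ab [mu_ i2] iu u0; set I := \int[mu]_x _.
have I0 : 0 <= I by apply: Rintegral_ge0 => x _; exact: cmod_ge0.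
have [abE|ab'] := eqVneq a b.
  have -> : I = 0.
    have uE x : cmod (u x) = 0.
      rewrite u0 ?cmod0// abE; apply/negP => /andP[h1 h2].
      by have := le_lt_trans h1 h2; rewrite ltxx.
    rewrite /I; under eq_Rintegral do rewrite uE.
    by rewrite Rintegral_cst// mul0r.
  by rewrite expr0n/= abE subrr mul0r.
have {}ab' : 0 < b - a by rewrite subr_gt0 lt_neqAle ab' ab.
pose t := I / (b - a).
have iab : rintegrable (fun x => (\1_`[a, b[ x : R)).
  apply/integrableP; split; first by apply/measurable_EFinP; exact: measurable_indic.
  rewrite (_ : (\int[mu]_x _)%E = (\int[mu]_x (\1_`[a, b[ x)%:E)%E); last first.
    by apply: eq_integral => x _ /=; rewrite ger0_norm// indicE.
  rewrite integral_indic// setIT.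
  suff : (mu `[a, b[%classic < +oo)%E by [].
  by rewrite lebesgue_measure_itv/= lte_fin; case: ifP => // _; rewrite -EFinD ltry.
have Iab : \int[mu]_x (\1_`[a, b[ x : R) = b - a.
  under eq_Rintegral do rewrite -[\1_ _ _]mulr1.
  rewrite Rintegral_indic; transitivity (1 * fine (mu `[a, b[%classic)); first exact: Rintegral_cst.
  by rewrite mul1r lebesgue_measure_itv/= lte_fin -subr_gt0 ab' -EFinD.
have : 0 <= \int[mu]_x (cmod (u x) ^+ 2 - (2 * t) * cmod (u x) + t ^+ 2 * \1_`[a, b[ x).
  apply: Rintegral_ge0 => x _.
  have [xab|xab] := boolP (a <= x < b).
    rewrite indicE mem_setE in_itv/= xab mulr1.
    have -> : cmod (u x) ^+ 2 - 2 * t * cmod (u x) + t ^+ 2 = (cmod (u x) - t) ^+ 2 by ring.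
    exact: sqr_ge0.
  by rewrite (u0 _ xab) cmod0 expr0n mulr0 subr0 add0r mulr_ge0 ?sqr_ge0// indicE.
have ic := rintegrable_cmod iu.
rewrite (RintegralD measurableT (rintegrableB i2 (rintegrableZ _ ic)) (rintegrableZ _ iab)).
rewrite (RintegralB measurableT i2 (rintegrableZ _ ic)).
rewrite (RintegralZl _ measurableT ic) (RintegralZl _ measurableT iab) Iab -/(sqnorm u) -/I.
have -> : sqnorm u - 2 * t * I + t ^+ 2 * (b - a) = sqnorm u - I ^+ 2 / (b - a).
  by rewrite /t; field; rewrite gt_eqF.
by rewrite subr_ge0 ler_pdivrMr// mulrC.
Qed.

End Front.

Section StageAlgebra.
Variable R : realType.

Lemma sqr_le_split (I I1 I2 x y : R) : 0 <= I -> I <= I1 + I2 ->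
  I1 ^+ 2 <= x -> I2 ^+ 2 <= y -> I ^+ 2 <= 2 * x + 2 * y.
Proof.
move=> I0 h h1 h2; have h3 : I ^+ 2 <= (I1 + I2) ^+ 2.
  by rewrite ler_sqr ?nnegrE// (le_trans I0).
by have := sqr_ge0 (I1 - I2); nra.
Qed.

(** Here P is pi, C and m are the squares of the leading coefficient and of the front constant, l
    and L the lengths of the part already treated and of the new window. The last hypothesis makes
    the contribution of L * Su at most half of the left-hand side, which absorbs it. *)
Lemma stage_algebra (P C m Sb Sa c2 I2 l L Su : R) : 0 < P -> 0 < C -> 0 <= m -> 0 <= Sb ->
  0 <= Sa -> P * C * Sb <= 2 * c2 + 2 * (P * m * I2) -> I2 <= 2 * (l * Sa) + 2 * (L * Su) ->
  l <= P -> Su <= Sb -> 0 <= L -> 2 * m * L * 4 <= C ->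
  Sb <= 4 / (P * C) * c2 + 8 * P * m / C * Sa.
Proof.
move=> P0 C0 m0 Sb0 Sa0 h1 h2 lP uS L0 h3.
have h4 : I2 <= 2 * (P * Sa) + 2 * (L * Sb).
  apply: le_trans h2 _; apply: lerD; apply: ler_wpM2l => //.
  - by apply: ler_wpM2r.
  - by apply: ler_wpM2l.
have Pm0 : 0 <= P * m by rewrite mulr_ge0// ltW.
have h5 : P * C * Sb <= 2 * c2 + 2 * (P * m * (2 * (P * Sa) + 2 * (L * Sb))).
  by apply: le_trans h1 _; rewrite lerD2l ler_wpM2l// ler_wpM2l.
have h6 : (2 * m * L * 4) * (P * Sb) <= C * (P * Sb).
  by rewrite ler_wpM2r// mulr_ge0// ltW.
have PC0 : 0 < P * C by rewrite mulr_gt0.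
have -> : 4 / (P * C) * c2 + 8 * P * m / C * Sa = (4 * c2 + 8 * P ^+ 2 * m * Sa) / (P * C).
  by field; rewrite !gt_eqF.
by rewrite ler_pdivlMr//; nra.
Qed.

End StageAlgebra.

(** * Recovering a function from its front, window by window *)

Section Stage.
Variable R : realType.
Local Notation mu := (@lebesgue_measure R).
Variables (M : R) (c0 : R[i]).
Hypothesis c00 : c0 != 0.

Section Fixed.
Variables (f : R -> R[i]) (B : R -> R -> R[i]) (J : R -> R[i]) (p MJ c2 : R).
Hypotheses (sf : sqint f) (f0 : forall x, ~~ (0 < x < pi) -> f x = 0).
Hypothesis fB : front (fun x => p + 2 * x) (fun x => 2 * pi - 2 * x) c0 M B.
Hypothesis sJ : spec (p + 2 * pi) MJ J.
Let h r := cint (fun x => f x * B x r) + J r.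
Hypothesis sh : sqint h.
Hypothesis hc : sqnorm h <= c2.

Let cut (b x : R) : R[i] := real_complex R ((x < b)%R : bool)%:R * f x.

Let cutE b x : cut b x = if x < b then f x else 0.
Proof. by rewrite /cut; case: (x < b); rewrite ?mul1r ?mul0r. Qed.

Let cf : cintegrable f. Proof. exact: sqint_supp_cintegrable sf f0. Qed.

Let cmod_cut b x : cmod (cut b x) <= cmod (f x).
Proof. by rewrite cutE; case: ifP => // _; rewrite cmod0 cmod_ge0. Qed.

Let mcut b : cmeas (cut b).
Proof.
have [mf _] := sf; apply: cmeasM => //; apply: cmeas_real; apply: measurable_natr_bool.
by apply: measurable_fun_ltr; [exact: measurable_id|exact: measurable_cst].
Qed.

Let scut b : sqint (cut b).
Proof.
have [mf if2] := sf; split; first exact: mcut.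
apply: (rintegrable_dom _ if2); first exact: measurable_sqr_cmod (mcut b).
move=> x; rewrite ger0_norm ?sqr_ge0//.
by rewrite ler_sqr ?nnegrE ?cmod_ge0.
Qed.

Let ccut b : cintegrable (cut b).
Proof. exact: (cintegrable_dom (mcut b) (rintegrable_cmod cf) (cmod_cut b)). Qed.

Let cut0 b x : ~~ (0 < x < b) -> b <= pi -> cut b x = 0.
Proof.
move=> xb bp; rewrite cutE; case: ifP => // xb'; apply: f0.
by apply: contra xb => /andP[-> _] /=.
Qed.

(** After multiplication by exp(- i p r), the leading term of the part of f below b becomes c0 times
    its Fourier transform. Apart from the remainder [r1], everything else has exponents at least 2
    b: the tail because there x >= b, the secondary waves [E1] and the term [J] because they start
    at 2 pi. *)
Lemma stage_window b : 0 <= b -> b <= pi ->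
  pi * cmod c0 ^+ 2 * sqnorm (cut b) <=
  2 * c2 + 2 * (pi * M ^+ 2 * (\int[mu]_x cmod (cut b x)) ^+ 2).
Proof.
move=> b0 bp; have [mB cM [E1 [mE1 hE1]]] := fB.
have M0 : 0 <= M by exact: le_trans (cmod_ge0 _) cM.
have cc0 : 0 < cmod c0.
  by rewrite lt_neqAle cmod_ge0 andbT eq_sym; apply: contra c00 => /eqP/cmod_eq0 ->.
pose e r := cis (- p * r).
have fx0 x : f x != 0 -> 0 < x < pi by apply: contraNT => /f0 ->.
have cut_x x : cut b x != 0 -> 0 < x < pi.
  by rewrite cutE; case: ifP => [_ /fx0//|_]; rewrite eqxx.
pose tail x := f x - cut b x.
have ctail : cintegrable tail by exact: cintegrableB.
have tail_x x : tail x != 0 -> 0 < x < pi /\ b <= x.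
  rewrite /tail cutE; case: ltP => [_|bx]; rewrite ?subrr ?eqxx// subr0 => /fx0 //.
pose r1 r := cint (fun x => cut b x * (B x r - c0 * cis ((p + 2 * x) * r) - E1 x r)).
have mker : jmeas (fun x r : R => cis ((p + 2 * x) * r)).
  apply: cmeas_cis; apply: measurable_funM; last exact: measurable_snd.
  apply: measurable_funD; first exact: measurable_cst.
  by apply: measurable_funM; [exact: measurable_cst|exact: measurable_fst].
have mr : jmeas (fun x r => B x r - c0 * cis ((p + 2 * x) * r) - E1 x r).
  apply: jmeasB; last exact: mE1; apply: jmeasB; first exact: mB.
  by apply: (@jmeasM _ (fun _ _ => c0)); [exact: jmeas_cst|exact: mker].
have r1b r : cmod (r1 r) <= M * jap r * \int[mu]_x cmod (cut b x).
  apply: cmod_cint_mulb; [exact: ccut|exact: (jmeas_secr r mr)|].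
  by move=> x /cut_x xp; have [_ _] := hE1 x xp; exact.
have mr1 : cmeas r1 by exact: (cmeas_cint_param (ccut b) mr).
have [sr1 lr1] : sqint r1 /\ sqnorm r1 <= pi * M ^+ 2 * (\int[mu]_x cmod (cut b x)) ^+ 2.
  set I := \int[mu]_x _ in r1b *.
  have [||s1 l1] := @sqint_jap _ r1 (M * I) mr1 _ _.
  - by apply: mulr_ge0 => //; apply: Rintegral_ge0 => x _; exact: cmod_ge0.
  - by move=> r; rewrite mulrAC.
  by split => //; apply: le_trans l1 _; rewrite exprMn mulrA.
pose E r := e r * (cint (fun x => tail x * B x r) + cint (fun x => cut b x * E1 x r) + J r).
have sE : exists ME, spec (2 * b) ME E.
  have s1 : spec (p + 2 * b) (M * \int[mu]_x cmod (tail x)) (fun r => cint (fun x => tail x * B x r)).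
    apply: spec_cint => // x /tail_x[xp bx]; have [sB _ _] := hE1 x xp.
    by apply: spec_le sB => //; rewrite lerD2l ler_wpM2l.
  have s2 : spec (p + 2 * b) (M * \int[mu]_x cmod (cut b x)) (fun r => cint (fun x => cut b x * E1 x r)).
    apply: spec_cint => // x /cut_x xp; have [_ sE1 _] := hE1 x xp.
    by apply: spec_le sE1 => //; rewrite -addrA lerD2l addrCA subrr addr0 ler_wpM2l.
  have s3 : spec (p + 2 * b) MJ J by apply: spec_le sJ => //; rewrite lerD2l ler_wpM2l.
  eexists; have := specM (spec_cis (lexx (- p))) (specD (specD s1 s2) s3).
  by rewrite addKr; exact.
have [ME {}sE] := sE.
have key r : fourier (cut b) r + c0^-1 * E r = c0^-1 * (e r * (h r - r1 r)).
  have cB : cintegrable (fun x => f x * B x r).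
    apply: (cintegrable_mulb cf (jmeas_secr r mB) (M := M)) => x /fx0 xp.
    by have [[_ /(_ r)]] := hE1 x xp.
  have cE1 : cintegrable (fun x => cut b x * E1 x r).
    apply: (cintegrable_mulb (ccut b) (jmeas_secr r mE1) (M := M)) => x /cut_x xp.
    by have [_ [_ /(_ r)]] := hE1 x xp.
  have cB' : cintegrable (fun x => cut b x * B x r).
    apply: (cintegrable_mulb (ccut b) (jmeas_secr r mB) (M := M)) => x /cut_x xp.
    by have [[_ /(_ r)]] := hE1 x xp.
  have cK : cintegrable (fun x => cut b x * cis ((p + 2 * x) * r)).
    apply: (cintegrable_mulb (ccut b) (jmeas_secr r mker) (M := 1)) => x _.
    by rewrite cmod_cis.
  have r1E : r1 r = cint (fun x => cut b x * B x r) -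
      c0 * cint (fun x => cut b x * cis ((p + 2 * x) * r)) - cint (fun x => cut b x * E1 x r).
    rewrite -(cintZ c0 cK) -(cintB cB' (cintegrableZ c0 cK)).
    rewrite -(cintB (cintegrableB cB' (cintegrableZ c0 cK)) cE1).
    by apply: eq_cint => x; ring.
  have tE : cint (fun x => tail x * B x r) = cint (fun x => f x * B x r) - cint (fun x => cut b x * B x r).
    by rewrite -(cintB cB cB'); apply: eq_cint => x; rewrite mulrBl.
  have fE : fourier (cut b) r = e r * cint (fun x => cut b x * cis ((p + 2 * x) * r)).
    rewrite -(cintZ (e r) cK); apply: eq_cint => x; rewrite mulrCA -cisD; congr (_ * cis _).
    ring.
  by rewrite /E /h r1E tE fE; field.
have [shr lhr] := sqintB sh sr1.
have me : cmeas (fun r => c0^-1 * e r).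
  by apply: cmeasM; [exact: cmeas_cst|exact: cmeas_cisl].
have [|sk lk] := @sqint_bM _ (fun r => c0^-1 * e r) _ (cmod c0)^-1 me _ shr.
  by move=> r; rewrite cmodM cmod_cis mulr1 cmodV.
have keyF : (fun r => fourier (cut b) r + c0^-1 * E r) = (fun r => c0^-1 * e r * (h r - r1 r)).
  by apply/funext => r; rewrite key mulrA.
have cut0' x : ~~ (0 < x < b) -> cut b x = 0 by move=> xb; exact: cut0 xb bp.
have fl := @fourier_lower _ (cut b) (fun r => c0^-1 * E r) b _ _ bp (scut b) cut0' (specZ c0^-1 sE).
rewrite keyF in fl; have := le_trans (fl _ sk (lexx _)) lk.
rewrite exprVn ler_pdivlMl ?exprn_gt0// mulrCA mulrA => /le_trans; apply.
apply: le_trans lhr _; apply: lerD; first by apply: ler_wpM2l.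
by apply: ler_wpM2l.
Qed.

(** The remainder costs the L1 norm of the cut function. That norm is split at a: below a it is
    already controlled, and on the short window it is absorbed by the left-hand side. *)
Lemma stage_step a b : 0 <= a -> a <= b -> b <= pi ->
  2 * M ^+ 2 * (b - a) * 4 <= cmod c0 ^+ 2 ->
  sqnorm (cut b) <= 4 / (pi * cmod c0 ^+ 2) * c2 +
    8 * pi * M ^+ 2 / cmod c0 ^+ 2 * sqnorm (cut a).
Proof.
move=> a0 ab bp small; have b0 := le_trans a0 ab; have ap := le_trans ab bp.
have cc0 : 0 < cmod c0.
  by rewrite lt_neqAle cmod_ge0 andbT eq_sym; apply: contra c00 => /eqP/cmod_eq0 ->.
have cc2 : 0 < cmod c0 ^+ 2 by rewrite exprn_gt0.
pose u x := cut b x - cut a x.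
have uE x : u x = if (a <= x < b) then f x else 0.
  rewrite /u !cutE; have [xa|xa] := ltP x a => /=; first by rewrite (lt_le_trans xa ab) subrr.
  by rewrite subr0.
have cu : cintegrable u by exact: cintegrableB.
have su : sqint u /\ sqnorm u <= sqnorm (cut b).
  have [_ i2] := scut b; apply: sqint_dom => //; first exact: cintegrable_meas.
  move=> x; rewrite uE cutE; case: ifP => [/andP[_ ->]//|_].
  by rewrite cmod0 expr0n; exact: sqr_ge0.
have cut0' x : ~~ (0 <= x < a) -> cut a x = 0.
  move=> xa; apply: cut0 ap; apply: contra xa => /andP[x0 ->].
  by rewrite ltW.
have cs1 := sqr_int_le a0 (scut a) (ccut a) cut0'.
have u0 x : ~~ (a <= x < b) -> u x = 0 by move=> xab; rewrite uE (negbTE xab).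
have cs2 := sqr_int_le ab su.1 cu u0.
have Ile : \int[mu]_x cmod (cut b x) <= \int[mu]_x cmod (cut a x) + \int[mu]_x cmod (u x).
  have i1 := rintegrable_cmod (ccut a); have i2 := rintegrable_cmod cu.
  rewrite -(RintegralD measurableT i1 i2); apply: le_Rintegral => //.
  - exact: (rintegrable_cmod (ccut b)).
  - exact: rintegrableD.
  move=> x _; apply: le_trans (cmodD _ _); rewrite /u addrCA subrr addr0//.
have Ib0 : 0 <= \int[mu]_x cmod (cut b x) by apply: Rintegral_ge0 => x _; exact: cmod_ge0.
apply: (stage_algebra (pi_gt0 R) cc2 (sqr_ge0 M) (sqnorm_ge0 _) (sqnorm_ge0 (cut a))
  (stage_window b0 bp) (sqr_le_split Ib0 Ile cs1 cs2) _ su.2 _ small).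
  by rewrite subr0.
by rewrite subr_ge0.
Qed.

Lemma stage_coef_ge0 : 0 <= 8 * pi * M ^+ 2 / cmod c0 ^+ 2.
Proof.
apply: divr_ge0; last exact: sqr_ge0.
by apply: mulr_ge0; [rewrite mulr_ge0// pi_ge0|exact: sqr_ge0].
Qed.

Definition stage_const n : R :=
  iter n (fun k => 4 / (pi * cmod c0 ^+ 2) + 8 * pi * M ^+ 2 / cmod c0 ^+ 2 * k) 0.

Lemma stage_iter n : 2 * M ^+ 2 * (pi / n.+1%:R) * 4 <= cmod c0 ^+ 2 ->
  sqnorm f <= stage_const n.+1 * c2.
Proof.
move=> small; have p0 := pi_gt0 R.
pose b i : R := i%:R * (pi / n.+1%:R).
have b0 i : 0 <= b i by rewrite mulr_ge0// divr_ge0// ltW.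
have bn : b n.+1 = pi by rewrite /b mulrCA divff ?mulr1// pnatr_eq0.
have bp i : (i <= n.+1)%N -> b i <= pi.
  by move=> i_n; rewrite -bn /b ler_wpM2r ?ler_nat// divr_ge0// ltW.
have bS i : b i.+1 - b i = pi / n.+1%:R by rewrite /b -natr1 mulrDl mul1r addrAC subrr add0r.
have main i : (i <= n.+1)%N -> sqnorm (cut (b i)) <= stage_const i * c2.
  elim: i => [_|i IH i_n].
    rewrite /stage_const/= mul0r /sqnorm (_ : \int[mu]_x _ = \int[mu]_x (0 : R)).
      by rewrite Rintegral_cst// mul0r.
    apply: eq_Rintegral => x _; rewrite /b mul0r cut0 ?cmod0 ?expr0n//; last exact: ltW.
    by apply/negP => /andP[h1 h2]; have := lt_trans h1 h2; rewrite ltxx.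
  have bb : b i <= b i.+1 by rewrite -subr_ge0 bS divr_ge0// ltW.
  have small' : 2 * M ^+ 2 * (b i.+1 - b i) * 4 <= cmod c0 ^+ 2 by rewrite bS.
  apply: le_trans (stage_step (b0 i) bb (bp _ i_n) small') _.
  rewrite -[stage_const i.+1]/(4 / (pi * cmod c0 ^+ 2) +
    8 * pi * M ^+ 2 / cmod c0 ^+ 2 * stage_const i).
  rewrite [leRHS]mulrDl lerD2l -[leRHS]mulrA.
  by apply: ler_wpM2l; [exact: stage_coef_ge0|exact/IH/ltnW].
have := main n.+1 (leqnn _); rewrite bn.
suff -> : cut pi = f by [].
apply/funext => x; rewrite cutE; case: ltP => // px; apply/esym/f0.
by apply/negP => /andP[_]; rewrite ltNge px.
Qed.

End Fixed.

(** The constant is chosen from [M] and [c0] alone. The number n + 1 of windows is at least 8 pi M^2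
    / |c0|^2, which is what the smallness condition of [stage_step] amounts to for windows of length
    pi / (n + 1). *)
Theorem stage : exists2 K, 0 <= K &
  forall (f : R -> R[i]) (B : R -> R -> R[i]) (J : R -> R[i]) (p MJ c2 : R),
    sqint f -> (forall x, ~~ (0 < x < pi) -> f x = 0) ->
    front (fun x => p + 2 * x) (fun x => 2 * pi - 2 * x) c0 M B ->
    spec (p + 2 * pi) MJ J ->
    sqint (fun r => cint (fun x => f x * B x r) + J r) ->
    sqnorm (fun r => cint (fun x => f x * B x r) + J r) <= c2 ->
    sqnorm f <= K * c2.
Proof.
have p0 := pi_gt0 R.
have cc0 : 0 < cmod c0.
  by rewrite lt_neqAle cmod_ge0 andbT eq_sym; apply: contra c00 => /eqP/cmod_eq0 ->.
have cc2 : 0 < cmod c0 ^+ 2 by rewrite exprn_gt0.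
pose A := 8 * pi * M ^+ 2 / cmod c0 ^+ 2.
have A0 : 0 <= A by exact: stage_coef_ge0.
pose n := Num.bound A.
have An : A <= n.+1%:R.
  by rewrite (le_trans (ltW (archi_boundP A0)))// ler_nat.
have small : 2 * M ^+ 2 * (pi / n.+1%:R) * 4 <= cmod c0 ^+ 2.
  have -> : 2 * M ^+ 2 * (pi / n.+1%:R) * 4 = 8 * pi * M ^+ 2 / n.+1%:R by ring.
  by rewrite ler_pdivrMr// [leRHS]mulrC -ler_pdivrMr.
exists (stage_const n.+1).
  rewrite /stage_const; elim: n.+1 => //= k IH.
  rewrite addr_ge0//; first by rewrite divr_ge0// mulr_ge0// ltW.
  by rewrite mulr_ge0// stage_coef_ge0.
by move=> f B J p MJ c2 sf f0 fB sJ sh hc; exact: (stage_iter sf f0 fB sJ sh hc small).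
Qed.

End Stage.

(** * Products, sums and perturbations of fronts *)

Section FrontAlgebra.
Variable R : realType.
Local Notation mu := (@lebesgue_measure R).
Implicit Types (p d : R -> R) (E F : R -> R -> R[i]) (c : R[i]).

Lemma front_ge0 p d c M E : front p d c M E -> 0 <= M.
Proof. by case=> _ /(le_trans (cmod_ge0 _)). Qed.

Lemma eq_front p p' d d' c c' M E F : p =1 p' -> d =1 d' -> c = c' ->
  (forall x r, E x r = F x r) -> front p d c M E -> front p' d' c' M F.
Proof.
move=> /funext -> /funext -> -> EF; suff -> : E = F by [].
by apply/funext => x; apply/funext.
Qed.

Lemma front_spec p d c M E x : front p d c M E -> 0 < x < pi -> spec (p x) M (E x).
Proof. by move=> [_ _ [E1 [_ h]]] /h[]. Qed.

Lemma front_le p d c M M' E : M <= M' -> front p d c M E -> front p d c M' E.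
Proof.
move=> MM' [mE cM [E1 [mE1 h]]]; split => //; first exact: le_trans MM'.
exists E1; split => // x /h[s1 s2 s3]; split; [exact: spec_le s1|exact: spec_le s2|].
by move=> r; apply: le_trans (s3 r) _; apply: ler_wpM2r; [exact: jap_ge0|].
Qed.

Lemma jmeas_cisf (u : R -> R) : measurable_fun setT u -> jmeas (fun x r : R => cis (u x * r)).
Proof.
move=> mu_; have := jmeas_cis 1 mu_.
by apply: eq_cmeas => -[x r] /=; rewrite mul1r.
Qed.

(** Leading exponentials multiply, and any product involving a secondary wave starts later by at
    least [d2]. The factor 3 serves twice: three products make up the secondary wave [G], and three
    terms make up the error. *)
Lemma frontM p d c M E p' d' c' M' F d2 : measurable_fun setT p -> measurable_fun setT p' ->
  (forall x, 0 < x < pi -> [/\ 0 <= d2 x, d2 x <= d x & d2 x <= d' x]) ->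
  front p d c M E -> front p' d' c' M' F ->
  front (fun x => p x + p' x) d2 (c * c') (3 * (M * M')) (fun x r => E x r * F x r).
Proof.
move=> mp mp' hd fE fF; have M0 := front_ge0 fE; have M'0 := front_ge0 fF.
move: fE fF => [mE cM [E1 [mE1 hE]]] [mF c'M [F1 [mF1 hF]]].
have MM : 0 <= M * M' by rewrite mulr_ge0.
have MM3 : M * M' <= 3 * (M * M') by rewrite ler_peMl// ler1n.
split; first exact: jmeasM.
  by rewrite cmodM; apply: le_trans MM3; apply: ler_pM; rewrite ?cmod_ge0.
pose G x r := c * cis (p x * r) * F1 x r + (c' * cis (p' x * r) * E1 x r + E1 x r * F1 x r).
have mc (z : R[i]) (u : R -> R) : measurable_fun setT u -> jmeas (fun x r : R => z * cis (u x * r)).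
  by move=> mu_; apply: (@jmeasM _ (fun _ _ => z)); [exact: jmeas_cst|exact: jmeas_cisf].
exists G; split.
  apply: jmeasD; first by apply: jmeasM => //; exact: mc.
  by apply: jmeasD; apply: jmeasM => //; exact: mc.
move=> x xp; have [s1 s2 s3] := hE x xp; have [t1 t2 t3] := hF x xp.
have [d0 dd dd'] := hd x xp; split.
- exact: spec_le (lexx _) MM3 (specM s1 t1).
- have u1 : spec (p x + p' x + d2 x) (M * M') (fun r => c * cis (p x * r) * F1 x r).
    have := specM (specZ c (spec_cis (lexx (p x)))) t2; apply: spec_le.
      by rewrite -addrA lerD2l lerD2l.
    by rewrite mulr1; apply: ler_wpM2r.
  have u2 : spec (p x + p' x + d2 x) (M * M') (fun r => c' * cis (p' x * r) * E1 x r).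
    have := specM (specZ c' (spec_cis (lexx (p' x)))) s2; apply: spec_le.
      by rewrite (addrC (p x)) -addrA lerD2l lerD2l.
    by rewrite mulr1 mulrC; apply: ler_wpM2l.
  have u3 : spec (p x + p' x + d2 x) (M * M') (fun r => E1 x r * F1 x r).
    have := specM s2 t2; apply: spec_le => //.
    by rewrite addrACA lerD2l (le_trans dd)// lerDl (le_trans d0).
  have := specD u1 (specD u2 u3); apply: spec_le => //.
  by rewrite le_eqVlt; apply/orP; left; apply/eqP; ring.
- move=> r; have -> : E x r * F x r - c * c' * cis ((p x + p' x) * r) - G x r =
    E x r * (F x r - c' * cis (p' x * r) - F1 x r) +
    (E x r - c * cis (p x * r) - E1 x r) * (c' * cis (p' x * r) + F1 x r).
    by rewrite /G mulrDl cisD; ring.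
  apply: le_trans (cmodD _ _) _; rewrite !cmodM.
  have j0 := jap_ge0 r.
  have -> : 3 * (M * M') * jap r = M * (M' * jap r) + M * jap r * (M' + M') by ring.
  apply: lerD; apply: ler_pM; rewrite ?cmod_ge0//.
  + exact: (spec_bound s1).
  + apply: le_trans (cmodD _ _) _; apply: lerD; last exact: (spec_bound t2).
    by rewrite cmodM cmod_cis mulr1.
Qed.

Lemma frontD p d c M E c' M' F : front p d c M E -> front p d c' M' F ->
  front p d (c + c') (M + M') (fun x r => E x r + F x r).
Proof.
move=> [mE cM [E1 [mE1 hE]]] [mF c'M [F1 [mF1 hF]]].
split; first exact: jmeasD; first by apply: le_trans (cmodD _ _) _; exact: lerD.
exists (fun x r => E1 x r + F1 x r); split; first exact: jmeasD.
move=> x xp; have [s1 s2 s3] := hE x xp; have [t1 t2 t3] := hF x xp.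
split; [exact: specD|exact: specD|move=> r].
have -> : E x r + F x r - (c + c') * cis (p x * r) - (E1 x r + F1 x r) =
  (E x r - c * cis (p x * r) - E1 x r) + (F x r - c' * cis (p x * r) - F1 x r) by ring.
by apply: le_trans (cmodD _ _) _; rewrite mulrDl; apply: lerD.
Qed.

(** An O(1/r) error carries no information on exponents, so the lower bound on those of [F] is a
    separate hypothesis; the leading term and the secondary wave are inherited from [E]. *)
Lemma front_perturb p d c M M1 M2 E F : jmeas F ->
  (forall x, 0 < x < pi -> spec (p x) M1 (F x)) ->
  (forall x r, 0 < x < pi -> cmod (F x r - E x r) <= M2 * jap r) -> 0 <= M1 -> 0 <= M2 ->
  front p d c M E -> front p d c (M + M1 + M2) F.
Proof.
move=> mF sF dF M10 M20 fE; have M0 := front_ge0 fE.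
move: fE => [mE cM [E1 [mE1 hE]]].
have M3 : M <= M + M1 + M2 by rewrite -addrA lerDl addr_ge0.
split => //; first exact: le_trans M3.
exists E1; split => // x xp; have [s1 s2 s3] := hE x xp; split.
- by apply: spec_le (sF x xp) => //; rewrite addrAC lerDr addr_ge0.
- exact: spec_le s2.
- move=> r; have -> : F x r - c * cis (p x * r) - E1 x r =
    (E x r - c * cis (p x * r) - E1 x r) + (F x r - E x r) by ring.
  apply: le_trans (cmodD _ _) _; apply: le_trans (lerD (s3 r) (dF x r xp)) _.
  by rewrite -mulrDl; apply: ler_wpM2r; [exact: jap_ge0|rewrite addrAC lerDl].
Qed.

Lemma front1 d : front (fun=> 0) d 1 1 (fun _ _ => 1).
Proof.
split; [exact: jmeas_cst|by rewrite cmod1|].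
exists (fun _ _ => 0); split; first exact: jmeas_cst.
move=> x xp; split; first by have := spec_cst (1 : R[i]); rewrite cmod1.
  by apply: spec_le (spec0 _) => //; exact: ler01.
by move=> r; rewrite mul0r cis0 mulr1 subrr subr0 cmod0 mul1r jap_ge0.
Qed.

Lemma front_exact p d c c1 E : measurable_fun setT p -> measurable_fun setT d ->
  (forall x, 0 < x < pi -> 0 <= d x) ->
  cmod c + cmod c1 <= 1 -> (forall x r, E x r = c * cis (p x * r) + c1 * cis ((p x + d x) * r)) ->
  front p d c 1 E.
Proof.
move=> mp md d0 cc EE.
have c0 := cmod_ge0 c; have c10 := cmod_ge0 c1.
have mc (z : R[i]) (u : R -> R) : measurable_fun setT u -> jmeas (fun x r : R => z * cis (u x * r)).
  by move=> mu_; apply: (@jmeasM _ (fun _ _ => z)); [exact: jmeas_cst|exact: jmeas_cisf].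
have mpd : measurable_fun setT (fun x => p x + d x) by exact: measurable_funD.
have EF : E = fun x r => c * cis (p x * r) + c1 * cis ((p x + d x) * r).
  by apply/funext => x; apply/funext.
split; first by rewrite EF; apply: jmeasD; exact: mc.
  by apply: le_trans cc; rewrite lerDl.
exists (fun x r => c1 * cis ((p x + d x) * r)); split; first exact: (mc _ (fun x => p x + d x)).
move=> x xp; split.
- rewrite EF; have := specD (specZ c (spec_cis (lexx (p x))))
    (specZ c1 (@spec_cis _ (p x) (p x + d x) _)).
  rewrite lerDl d0// => /(_ isT); apply: spec_le => //.
  by rewrite !mulr1.
- have := specZ c1 (spec_cis (lexx (p x + d x))); apply: spec_le => //.
  by rewrite mulr1; apply: le_trans cc; rewrite lerDr.
- move=> r; rewrite EE (_ : _ - _ - _ = 0); last by ring.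
  by rewrite cmod0 mul1r jap_ge0.
Qed.

End FrontAlgebra.

(** * L2 bounds for integrals against products of two solutions *)

Section UpperEstimate.
Variable R : realType.
Local Notation mu := (@lebesgue_measure R).

(** The two Fourier integrals contribute 8 pi, the remainder of size 5 M^2 contributes 2 * 25 *
    pi^2. *)
Definition upper_const (M : R) : R := (M ^+ 2) ^+ 2 * (8 * pi + 50 * pi ^+ 2).

Lemma upper_algebra (m P s6 s4 s5 s2 s3 s1 s i : R) : 0 <= m -> 0 <= P ->
  s6 <= 2 * s4 + 2 * s5 -> s4 <= m ^+ 2 * s2 -> s5 <= m ^+ 2 * s3 -> s2 <= P * s -> s3 <= P * s ->
  s1 <= P * (5 * m * i) ^+ 2 -> i ^+ 2 <= P * s ->
  2 * s6 + 2 * s1 <= m ^+ 2 * (8 * P + 50 * P ^+ 2) * s.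
Proof.
move=> m0 P0 h6 h4 h5 h2 h3 h1 hi; have m2 := sqr_ge0 m.
have k4 := le_trans h4 (ler_wpM2l m2 h2); have k5 := le_trans h5 (ler_wpM2l m2 h3).
have k1 : P * (5 * m * i) ^+ 2 <= 25 * (P * m ^+ 2) * (P * s).
  have -> : P * (5 * m * i) ^+ 2 = 25 * (P * m ^+ 2) * i ^+ 2 by ring.
  by apply: ler_wpM2l => //; rewrite mulr_ge0// mulr_ge0.
have := le_trans h1 k1; move: k4 k5 h6.
have -> : m ^+ 2 * (8 * P + 50 * P ^+ 2) * s = 8 * (m ^+ 2 * (P * s)) + 2 * (25 * (P * m ^+ 2) * (P * s)) by ring.
by move: (m ^+ 2 * (P * s)) (25 * _ * _) => u v; lra.
Qed.

Lemma sqnorm_conj (f : R -> R[i]) : sqint f ->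
  sqint (fun x => (f x)^*%C) /\ sqnorm (fun x => (f x)^*%C) = sqnorm f.
Proof.
move=> [mf i2]; split; last by rewrite /sqnorm; apply: eq_Rintegral => x _; rewrite cmod_conj.
by split; [exact: cmeas_conj|under eq_fun do rewrite cmod_conj].
Qed.

Lemma fourierN_upper (f : R -> R[i]) : sqint f -> (forall x, ~~ (0 < x < pi) -> f x = 0) ->
  sqint (fun r => cint (fun x => f x * cis (- 2 * x * r))) /\
  sqnorm (fun r => cint (fun x => f x * cis (- 2 * x * r))) <= pi * sqnorm f.
Proof.
move=> sf f0; have [sc lc] := sqnorm_conj sf.
have f0' x : ~~ (0 < x < pi) -> (f x)^*%C = 0 by move=> /f0 ->; exact: rmorph0.
have cc := sqint_supp_cintegrable sc f0'.
have [s1 l1] := fourier_upper sc f0'; have [s2 l2] := sqnorm_conj s1.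
rewrite (_ : (fun r => cint _) = fun r => (fourier (fun x => (f x)^*%C) r)^*%C).
  by split => //; rewrite l2 -lc.
by apply/funext => r; rewrite conj_fourier//; apply: eq_cint => x; rewrite conjcK.
Qed.

Section Upper.
Variables (M : R) (f A B At Bt : R -> R[i]) (y yt : R -> R -> R[i]).
Hypothesis M0 : 0 <= M.
Hypotheses (sf : sqint f) (f0 : forall x, ~~ (0 < x < pi) -> f x = 0).
Hypothesis intf0 : cint f = 0.
Hypotheses (mA : cmeas A) (mB : cmeas B) (mAt : cmeas At) (mBt : cmeas Bt).
Hypotheses (bA : forall r, cmod (A r) <= M) (bB : forall r, cmod (B r) <= M).
Hypotheses (bAt : forall r, cmod (At r) <= M) (bBt : forall r, cmod (Bt r) <= M).
Hypotheses (my : jmeas y) (myt : jmeas yt).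
Hypothesis hy : forall x r, 0 < x < pi ->
  cmod (y x r - (A r * cis (x * r) + B r * cis (- x * r))) <= M * jap r.
Hypothesis hyt : forall x r, 0 < x < pi ->
  cmod (yt x r - (At r * cis (x * r) + Bt r * cis (- x * r))) <= M * jap r.

(** The product of the two approximations yields exp(2 i x r) and exp(- 2 i x r), to which the
    Plancherel inequality applies, and a part constant in x with coefficient A Bt + B At. That
    coefficient is only bounded in r, so this part would not be square integrable; the vanishing
    mean of f removes it. *)
Lemma upper_estimate : sqint (fun r => cint (fun x => f x * (y x r * yt x r))) /\
  sqnorm (fun r => cint (fun x => f x * (y x r * yt x r))) <= upper_const M * sqnorm f.
Proof.
have cf := sqint_supp_cintegrable sf f0.
have fx0 x : f x != 0 -> 0 < x < pi by apply: contraNT => /f0 ->.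
pose z (C D : R -> R[i]) x r := C r * cis (x * r) + D r * cis (- x * r).
have mcis1 : jmeas (fun x r : R => cis (x * r)).
  by apply: (@jmeas_cisf _ id); exact: measurable_id.
have mcisN : jmeas (fun x r : R => cis (- x * r)).
  by apply: (@jmeas_cisf _ (fun x => - x)); exact: oppr_measurable.
have mz C D : cmeas C -> cmeas D -> jmeas (z C D).
  by move=> mC mD; apply: jmeasD; apply: jmeasM => //; exact: jmeas2.
have bz C D x r : cmod (C r) <= M -> cmod (D r) <= M -> cmod (z C D x r) <= 2 * M.
  move=> bC bD; apply: le_trans (cmodD _ _) _; rewrite !cmodM !cmod_cis !mulr1 mulr2n mulrDl mul1r.
  exact: lerD.
pose rem x r := y x r * yt x r - z A B x r * z At Bt x r.
have mrem : jmeas rem by apply: jmeasB; apply: jmeasM => //; exact: mz.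
have brem x r : 0 < x < pi -> cmod (rem x r) <= 5 * M ^+ 2 * jap r.
  move=> xp; have -> : rem x r = (y x r - z A B x r) * yt x r + z A B x r * (yt x r - z At Bt x r).
    by rewrite /rem; ring.
  have yt3 : cmod (yt x r) <= 3 * M.
    have -> : yt x r = (yt x r - z At Bt x r) + z At Bt x r by ring.
    apply: le_trans (cmodD _ _) _; have -> : 3 * M = M + 2 * M by ring.
    apply: lerD; last exact: bz.
    by apply: le_trans (hyt r xp) _; rewrite ler_piMr// jap_le1.
  apply: le_trans (cmodD _ _) _; rewrite !cmodM.
  have -> : 5 * M ^+ 2 * jap r = M * jap r * (3 * M) + 2 * M * (M * jap r) by ring.
  by apply: lerD; apply: ler_pM; rewrite ?cmod_ge0//; [exact: hy|exact: bz|exact: hyt].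
pose r1 r := cint (fun x => f x * rem x r).
have I0 : 0 <= \int[mu]_x cmod (f x) by apply: Rintegral_ge0 => x _; exact: cmod_ge0.
have mr1 : cmeas r1 by exact: (cmeas_cint_param cf mrem).
have [||s1 l1] := @sqint_jap _ r1 (5 * M ^+ 2 * \int[mu]_x cmod (f x)) mr1 _ _.
- by rewrite mulr_ge0// mulr_ge0// sqr_ge0.
- move=> r; rewrite mulrAC; apply: (cmod_cint_mulb cf (jmeas_secr r mrem)) => x /fx0 xp.
  exact: brem.
pose Fm r := cint (fun x => f x * cis (- 2 * x * r)).
have [s2 l2] := fourier_upper sf f0; have [s3 l3] := fourierN_upper sf f0.
have bM (C D : R -> R[i]) r : cmod (C r) <= M -> cmod (D r) <= M -> cmod (C r * D r) <= M ^+ 2.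
  by move=> bC bD; rewrite cmodM expr2; apply: ler_pM; rewrite ?cmod_ge0.
have [|s4 l4] := @sqint_bM _ (fun r => A r * At r) _ (M ^+ 2) (cmeasM mA mAt) _ s2.
  by move=> r; exact: bM.
have [|s5 l5] := @sqint_bM _ (fun r => B r * Bt r) _ (M ^+ 2) (cmeasM mB mBt) _ s3.
  by move=> r; exact: bM.
have key r : cint (fun x => f x * (y x r * yt x r)) =
    (A r * At r * fourier f r + B r * Bt r * Fm r) + r1 r.
  have c1 := cintegrable_fourier_kernel r cf.
  have c2 : cintegrable (fun x => f x * cis (- 2 * x * r)).
    have mk : jmeas (fun x r : R => cis (- 2 * x * r)).
      by apply: (@jmeas_cis _ (- 2) id); exact: measurable_id.
    by apply: (@cintegrable_mulb _ _ _ 1 cf (jmeas_secr r mk)) => x _; rewrite cmod_cis.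
  have c3 : cintegrable (fun x => f x * rem x r).
    apply: (cintegrable_mulb cf (jmeas_secr r mrem)) => x /fx0 xp; exact: (brem x r xp).
  have c4 := cintegrableZ (A r * Bt r + B r * At r) cf.
  have c5 := cintegrableZ (A r * At r) c1; have c6 := cintegrableZ (B r * Bt r) c2.
  (* The cross term, zero after integration, is inserted so that the identity holds under the
     integral sign. *)
  transitivity (A r * At r * fourier f r + B r * Bt r * Fm r + r1 r +
    (A r * Bt r + B r * At r) * cint f); last by rewrite intf0 mulr0 addr0.
  rewrite /fourier /Fm /r1 -(cintZ _ c1) -(cintZ _ c2) -(cintZ _ cf).
  rewrite -(cintD c5 c6) -(cintD (cintegrableD c5 c6) c3).
  rewrite -(cintD (cintegrableD (cintegrableD c5 c6) c3) c4).
  apply: eq_cint => x; rewrite /rem /z.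
  have -> : cis (2 * x * r) = cis (x * r) * cis (x * r) by rewrite -cisD; congr cis; ring.
  have -> : cis (- 2 * x * r) = cis (- x * r) * cis (- x * r) by rewrite -cisD; congr cis; ring.
  have : cis (x * r) * cis (- x * r) = 1 by rewrite -cisD mulNr subrr cis0.
  move: (cis (x * r)) (cis (- x * r)) (f x) (y x r) (yt x r) (A r) (B r) (At r) (Bt r).
  move=> e e' g u v a b a' b' ee.
  rewrite [RHS](_ : _ = g * (u * v) + (a * b' + b * a') * g * (1 - e * e')); last by ring.
  by rewrite ee subrr mulr0 addr0.
have [s6 l6] := sqintD s4 s5; have [s7 l7] := sqintD s6 s1.
rewrite (_ : (fun r => cint _) = fun r => A r * At r * fourier f r + B r * Bt r * Fm r + r1 r); last first.
  by apply/funext.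
split => //; apply: le_trans l7 _.
have l8 : (\int[mu]_x cmod (f x)) ^+ 2 <= pi * sqnorm f.
  have := @sqr_int_le _ f 0 pi (pi_ge0 R) sf cf; rewrite subr0; apply => x xp.
  by apply: f0; apply: contra xp => /andP[/ltW -> ->].
apply: (upper_algebra (sqr_ge0 M) (pi_ge0 R) l6 l4 l5 l2 l3 l1 l8).
Qed.

End Upper.
End UpperEstimate.

(** * Volterra equations *)

Section Sine.
Variable R : realType.
Local Notation mu := (@lebesgue_measure R).
Implicit Types u r x : R.

(* The solution of [- y'' = r ^+ 2 * y], [y 0 = 0], [y' 0 = 1]. *)
Definition sn u r : R := if r == 0 then u else sin (r * u) / r.

Lemma sn_mul u r : r * sn u r = sin (r * u).
Proof.
rewrite /sn; case: eqP => [->|/eqP r0]; first by rewrite !mul0r sin0.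
by rewrite mulrC mulfVK.
Qed.

Lemma sn0 r : sn 0 r = 0.
Proof. by rewrite /sn mulr0 sin0 mul0r; case: ifP. Qed.

Lemma is_derive_sn r x : is_derive x (1 : R) (sn^~ r) (cos (r * x)).
Proof.
have [->|r0] := eqVneq r 0.
  rewrite mul0r cos0; apply: eq_is_derive (is_derive_id x (1 : R)) => // t.
  by rewrite /sn eqxx.
apply: eq_is_derive (is_deriveZ r^-1 (is_derive_sin_mul r x)) => [t|].
  by rewrite /sn (negbTE r0) mulrC.
by rewrite /GRing.scale/= mulrA mulVf// mul1r.
Qed.

Lemma is_derive_cosr r x : is_derive x (1 : R) (fun x => cos (r * x)) (- r ^+ 2 * sn x r).
Proof.
apply: eq_is_derive (is_derive_cos_mul r x) => //.
by rewrite expr2 -mulNr -mulrA sn_mul.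
Qed.

(** An average of cosines, with no division by r: it gives joint measurability and, through
    [spec_cint], exponents at least - |u| with mass |u|. *)
Lemma sn_integral u r : sn u r = \int[mu]_x (\1_`]0, 1[ x * (u * cos (r * u * x))).
Proof.
rewrite Rintegral_indic.
have h x : is_derive x (1 : R) (fun x => sn (u * x) r) (u * cos (r * u * x)).
  have d1 : is_derive x (1 : R) (fun x => u * x) u.
    by apply: eq_is_derive (is_deriveZ u (is_derive_id x (1 : R))) => //; rewrite /GRing.scale/= mulr1.
  by apply: eq_is_derive (is_derive1_comp (is_derive_sn r (u * x)) d1) => //; rewrite mulrC mulrA.
rewrite (Rintegral_ftc (F := fun x => sn (u * x) r)) ?mulr1 ?mulr0 ?sn0 ?subr0//.
move=> x; apply: continuousM; first exact: cst_continuous.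
apply: continuous_comp; last exact: continuous_cos.
exact: mulrl_continuous.
Qed.

Lemma cmod_cos x : cmod (real_complex R (cos x)) <= 1.
Proof. by rewrite cmod_real ler_norml cos_geN1 cos_le1. Qed.

Lemma measurable_sn d (T : measurableType d) (f g : T -> R) :
  measurable_fun setT f -> measurable_fun setT g -> measurable_fun setT (fun z => sn (f z) (g z)).
Proof.
move=> mf mg.
have -> : (fun z => sn (f z) (g z)) =
    fun z => \int[mu]_x (\1_`]0, 1[ x * (f z * cos (g z * f z * x))).
  by apply/funext => z; exact: sn_integral.
apply: (@measurable_Rintegral R _ T (fun x z => \1_`]0, 1[ x * (f z * cos (g z * f z * x)))).
apply: measurable_funM.
  by apply: (measurableT_comp (measurable_indic_itv 1)); exact: measurable_fst.
have mf2 : measurable_fun setT (fun p : R * T => f p.2) by apply: measurableT_comp.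
have mg2 : measurable_fun setT (fun p : R * T => g p.2) by apply: measurableT_comp.
apply: measurable_funM => //; apply: (measurableT_comp (continuous_measurable_fun (@continuous_cos R))).
by apply: measurable_funM; [exact: measurable_funM|exact: measurable_fst].
Qed.

Lemma spec_cosr u : spec (- `|u|) 1 (fun r => real_complex R (cos (r * u))).
Proof.
have l1 : - `|u| <= u by rewrite lerNl (le_trans (ler_norm _))// normrN.
have l2 : - `|u| <= - u by rewrite lerN2 ler_norm.
have := specZ (2^-1) (specD (spec_cis l1) (spec_cis l2)).
have -> : cmod (2^-1 : R[i]) * (1 + 1) = 1 :> R.
  rewrite (_ : (2^-1 : R[i]) = real_complex R 2^-1); last by rewrite fmorphV rmorphD rmorph1.
  by rewrite cmod_real ger0_norm ?invr_ge0// mulVf.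
apply: eq_spec => r; rewrite mulNr [u * r]mulrC.
rewrite (_ : (2^-1 : R[i]) = real_complex R 2^-1); last by rewrite fmorphV rmorphD rmorph1.
apply: complexP; rewrite ?Re_mul ?Im_mul !Re_add !Im_add /= cosN sinN; lra.
Qed.

Lemma spec_sinr u : spec (- `|u|) 1 (fun r => real_complex R (sin (r * u))).
Proof.
have l1 : - `|u| <= u by rewrite lerNl (le_trans (ler_norm _))// normrN.
have l2 : - `|u| <= - u by rewrite lerN2 ler_norm.
have := specZ (Complex 0 (- 2^-1)) (specB (spec_cis l1) (spec_cis l2)).
have -> : cmod (Complex 0 (- 2^-1)) * (1 + 1) = 1 :> R.
  by rewrite /cmod /= expr0n add0r sqrrN sqrtr_sqr ger0_norm ?invr_ge0// mulVf.
apply: eq_spec => r; rewrite mulNr [u * r]mulrC.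
apply: complexP; rewrite ?Re_mul ?Im_mul !Re_add !Im_add Re_opp Im_opp /= cosN sinN; lra.
Qed.

Lemma spec_sn u : spec (- `|u|) `|u| (fun r => real_complex R (sn u r)).
Proof.
pose w (x : R) : R[i] := real_complex R (\1_`]0, 1[ x).
have i1 : rintegrable (\1_`]0, 1[ : R -> R) by exact: rintegrable_indic_itv.
have iw : cintegrable w by split => //=; exact: rintegrable0.
have mE : jmeas (fun x r => real_complex R (u * cos (r * u * x))).
  apply: cmeas_real; apply: measurable_funM; first exact: measurable_cst.
  apply: (measurableT_comp (continuous_measurable_fun (@continuous_cos R))).
  apply: measurable_funM; last exact: measurable_fst.
  by apply: measurable_funM; [exact: measurable_snd|exact: measurable_cst].
have sE x : w x != 0 -> spec (- `|u|) `|u| (fun r => real_complex R (u * cos (r * u * x))).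
  rewrite /w indic_itvE; case: (boolP (0 < x < 1)) => [/andP[x0 x1] _|_]; last by rewrite eqxx.
  have := specZ (real_complex R u) (spec_cosr (u * x)); rewrite cmod_real mulr1 => s.
  apply: eq_spec (spec_le _ (lexx _) s) => [r|]; first by rewrite mulrA rmorphM.
  rewrite lerN2 normrM ler_piMr//; rewrite ger0_norm; lra.
have := spec_cint iw mE sE.
have -> : \int[mu]_x cmod (w x) = 1.
  rewrite -[RHS](Rintegral_indic_itv (ler01 : 0 <= 1 :> R)).
  by apply: eq_Rintegral => x _; rewrite cmod_real ger0_norm// indic_itv_ge0.
rewrite mulr1; apply: eq_spec => r; rewrite sn_integral; apply: complexP => /=.
  by apply: eq_Rintegral => x _; rewrite mul0r subr0.
by rewrite (_ : (fun x : R => _) = fun=> 0) ?Rintegral_cst ?mul0r//; apply/funext => x; rewrite mulr0 mul0r addr0.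
Qed.

End Sine.

(** * Limits with geometric rate *)

Section Limits.
Variable R : realType.
Local Notation mu := (@lebesgue_measure R).

Lemma half_pow_cvg (K : R) : K * 2^-1 ^+ n @[n --> \oo] --> 0.
Proof. by apply: cvg_geometric; rewrite ger0_norm ?invr_ge0// invf_lt1// ltr1n. Qed.

Lemma le_half_pow (x y K : R) : (forall n, x <= y + K * 2^-1 ^+ n) -> x <= y.
Proof.
move=> h; apply/ler_addgt0Pr => e e0.
have /cvgrPdist_le/(_ _ e0) := half_pow_cvg K.
case=> n _ /(_ n (leqnn n)) /=; rewrite sub0r normrN => hn.
by apply: le_trans (h n) _; rewrite lerD2l (le_trans (ler_norm _)).
Qed.

Lemma measurable_half_lim d (T : measurableType d) (f : nat -> T -> R) (g : T -> R) :
  (forall n, measurable_fun setT (f n)) ->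
  (forall x, exists C, forall n, `|g x - f n x| <= C * 2^-1 ^+ n) -> measurable_fun setT g.
Proof.
move=> mf h; apply: (measurable_fun_cvg mf) => x _; have [C hC] := h x.
apply/cvgrPdist_le => e e0.
have /cvgrPdist_le/(_ _ e0) := half_pow_cvg C.
apply: filterS => n; rewrite sub0r normrN => hn.
exact: le_trans (hC n) (le_trans (ler_norm _) hn).
Qed.

Lemma cmeas_half_lim d (T : measurableType d) (f : nat -> T -> R[i]) (g : T -> R[i]) :
  (forall n, cmeas (f n)) ->
  (forall x, exists C, forall n, cmod (g x - f n x) <= C * 2^-1 ^+ n) -> cmeas g.
Proof.
move=> mf h; split.
- apply: (@measurable_half_lim _ _ (fun n x => ReC (f n x))) => [n|x]; first by have [] := mf n.
  have [C hC] := h x; exists C => n; apply: le_trans (hC n).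
  by rewrite -Re_opp -Re_add; exact: Re_le_cmod.
- apply: (@measurable_half_lim _ _ (fun n x => ImC (f n x))) => [n|x]; first by have [] := mf n.
  have [C hC] := h x; exists C => n; apply: le_trans (hC n).
  by rewrite -Im_opp -Im_add; exact: Im_le_cmod.
Qed.

(** Test functions are integrable, so convergence uniform in r passes to the tested values. *)
Lemma spec_half_lim (a M C : R) (f : nat -> R -> R[i]) (g : R -> R[i]) :
  (forall n, spec a M (f n)) ->
  (forall r n, cmod (g r - f n r) <= C * 2^-1 ^+ n) -> spec a M g.
Proof.
move=> sf h; have mg : cmeas g.
  by apply: (@cmeas_half_lim _ _ f) => [n|r]; [exact: spec_meas (sf n)|exists C => n; exact: h].
have bg r : cmod (g r) <= M.
  apply: (@le_half_pow _ _ C) => n.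
  have -> : g r = f n r + (g r - f n r) by rewrite addrC subrK.
  by apply: le_trans (cmodD _ _) _; apply: lerD; [exact: spec_bound (sf n) r|exact: h].
split => // u c iu hu.
apply: (@le_half_pow _ _ (C * \int[mu]_x cmod (u x))) => n.
have i1 : cintegrable (fun r => f n r * u r).
  exact: cintegrable_bM (spec_meas (sf n)) (spec_bound (sf n)) iu.
have mgf : cmeas (fun r => g r - f n r) by apply: cmeasB => //; exact: spec_meas (sf n).
have i2 : cintegrable (fun r => (g r - f n r) * u r).
  by apply: (cintegrable_bM mgf _ iu) => r; exact: h.
have -> : cint (fun r => g r * u r) =
    cint (fun r => f n r * u r) + cint (fun r => (g r - f n r) * u r).
  by rewrite -cintD//; apply: eq_cint => r; rewrite -mulrDl addrC subrK.
apply: le_trans (cmodD _ _) _; apply: lerD; first by have [_ _] := sf n; exact.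
rewrite mulrAC -(RintegralZl _ measurableT (rintegrable_cmod iu)).
apply: (cmod_cint_le (cmeasM mgf (cintegrable_meas iu)) (rintegrableZ _ (rintegrable_cmod iu))) => r.
by rewrite cmodM ler_wpM2r ?cmod_ge0.
Qed.

Lemma weight_le (I p e E : R) : 0 <= I -> 0 <= e -> 1 <= p -> p * I <= 2^-1 * e -> e <= E -> I <= E.
Proof. by move=> I0 e0 p1 h eE; nra. Qed.

Lemma picard_const_le (M e : R) : 0 <= M -> 1 <= e -> M + 2 * M * (2^-1 * e) <= 2 * M * e.
Proof. by move=> M0 e1; nra. Qed.

End Limits.

(** * Volterra operators and solutions of their fixed-point equation *)

Section Volterra.
Variable R : realType.
Local Notation mu := (@lebesgue_measure R).
Local Notation "[ 'in' x ]" := (0 <= x <= pi) (only parsing).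
Variables (d : R -> R) (Q : R -> R[i]) (kappa : R).
Hypotheses (md : measurable_fun setT d) (d0p : forall x, [in x] -> 0 <= d x <= pi).
Hypotheses (iQ : cintegrable Q) (Q0 : forall t, ~~ (0 < t < pi) -> Q t = 0).
Hypothesis k0 : 0 <= kappa.

(** The weight exp(kappa d t) is taken out of the unknown: in the norm sup of |z t| exp(- kappa d
    t), [vol] contracts by 1/2. The function [d] is the distance to the end point carrying the
    Cauchy data, and will be x or pi - x. *)
Definition vker (x t : R) : R[i] :=
  real_complex R (((d t < d x)%R : bool)%:R * expR (kappa * d t)) * Q t.

Hypothesis vker_le : forall x, [in x] ->
  pi * \int[mu]_t cmod (vker x t) <= 2^-1 * expR (kappa * d x).

Let snk (x t r : R) : R[i] := real_complex R (expR (- (kappa * d t)) * sn (d x - d t) r).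

Definition vol (z : R -> R -> R[i]) (x r : R) : R[i] :=
  cint (fun t => Q t * (real_complex R (((d t < d x)%R : bool)%:R * sn (d x - d t) r) * z t r)).

Let volE z x r : vol z x r = cint (fun t => vker x t * (snk x t r * z t r)).
Proof.
apply: eq_cint => t; rewrite /vker /snk mulrA [_ * Q t]mulrC -!mulrA; congr (_ * _).
rewrite !mulrA -!rmorphM; congr (real_complex R _ * _).
by rewrite mulrA -[X in _ = X * _]mulrA -expRD subrr expR0 mulr1.
Qed.

Let vker_supp x t : [in x] -> vker x t != 0 -> [/\ 0 < t < pi, 0 <= d t & 0 < d x - d t <= pi].
Proof.
move=> xp; rewrite /vker; have [tp|/Q0 ->] := boolP (0 < t < pi); last by rewrite mulr0 eqxx.
case: ltP => [dtx _|_]; last by rewrite mul0r rmorph0 mul0r eqxx.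
have /andP[t1 t2] : 0 <= d t <= pi by apply: d0p; case/andP: tp => /ltW -> /ltW ->.
have /andP[x1 x2] := d0p xp.
by split => //; rewrite subr_gt0 dtx lerBlDr (le_trans x2)// lerDl.
Qed.

Let mvker : cmeas (fun p : R * R => vker p.1 p.2).
Proof.
have m1 : measurable_fun setT (fun p : R * R => d p.1) by exact: measurableT_comp.
have m2 : measurable_fun setT (fun p : R * R => d p.2) by exact: measurableT_comp.
apply: cmeasM; last exact: (jmeas2 (cintegrable_meas iQ)).
apply: cmeas_real; apply: measurable_funM.
  by apply: measurable_natr_bool; exact: measurable_fun_ltr.
apply: (measurableT_comp (@measurable_expR R)).
by apply: measurable_funM => //; exact: measurable_cst.
Qed.

Let ivker x : cintegrable (vker x).
Proof.
have mdx : measurable_fun setT (fun t => ((d t < d x)%R : bool)%:R * expR (kappa * d t) : R).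
  apply: measurable_funM.
    by apply: measurable_natr_bool; apply: measurable_fun_ltr => //; exact: measurable_cst.
  by apply: (measurableT_comp (@measurable_expR R)); apply: measurable_funM => //; exact: measurable_cst.
apply: (cintegrable_dom _ (rintegrableZ (expR (kappa * pi)) (rintegrable_cmod iQ))).
  by apply: cmeasM; [exact: cmeas_real|exact: cintegrable_meas].
move=> t; rewrite cmodM cmod_real; have [tp|/Q0 ->] := boolP (0 < t < pi); last first.
  by rewrite cmod0 !mulr0.
apply: ler_wpM2r; first exact: cmod_ge0.
have /andP[t1 t2] : 0 <= d t <= pi by apply: d0p; case/andP: tp => /ltW -> /ltW ->.
rewrite normrM (ger0_norm (expR_ge0 _)).
apply: le_trans (_ : 1 * expR (kappa * d t) <= _).
  by apply: ler_wpM2r; [exact: expR_ge0|case: (d t < d x)%R; rewrite ?normr1 ?normr0 ?ler01].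
by rewrite mul1r ler_expR ler_wpM2l.
Qed.

Let snk_spec x t : 0 < d x - d t <= pi ->
  spec (- (d x - d t)) (expR (- (kappa * d t)) * pi) (snk x t).
Proof.
move=> /andP[h1 h2]; have := specZ (real_complex R (expR (- (kappa * d t)))) (spec_sn (d x - d t)).
rewrite (gtr0_norm h1) cmod_real (ger0_norm (expR_ge0 _)) => h.
have h3 : expR (- (kappa * d t)) * (d x - d t) <= expR (- (kappa * d t)) * pi.
  by rewrite ler_wpM2l ?expR_ge0.
by apply: eq_spec (spec_le (lexx _) h3 h) => r; rewrite /snk rmorphM.
Qed.

Let msnk : cmeas (fun p : R * (R * R) => snk p.2.1 p.1 p.2.2).
Proof.
have m1 : measurable_fun setT (fun p : R * (R * R) => d p.1) by exact: measurableT_comp.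
have m21 : measurable_fun setT (fun p : R * (R * R) => p.2.1) by exact: measurableT_comp.
have m22 : measurable_fun setT (fun p : R * (R * R) => p.2.2) by exact: measurableT_comp.
have m2 : measurable_fun setT (fun p : R * (R * R) => d p.2.1) by exact: (measurableT_comp md m21).
apply: cmeas_real; apply: measurable_funM.
  apply: (measurableT_comp (@measurable_expR R)); apply: measurableT_comp => //.
  by apply: measurable_funM => //; exact: measurable_cst.
by apply: measurable_sn => //; exact: measurable_funB.
Qed.

Lemma jmeas_vol z : jmeas z -> jmeas (vol z).
Proof.
move=> mz; have h : cmeas (fun p : R * R => cint (fun t => vker p.1 t * (snk p.1 t p.2 * z t p.2))).
  apply: (@cmeas_cint R _ (R * R)%type (fun t p => vker p.1 t * (snk p.1 t p.2 * z t p.2))).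
  apply: cmeasM.
    apply: (@cmeas_comp _ _ _ _ _ (fun p : R * (R * R) => (p.2.1, p.1)) (fun p => vker p.1 p.2)) => //.
    by apply: measurable_fun_pair => //; exact: measurableT_comp.
  apply: cmeasM => //.
  apply: (@cmeas_comp _ _ _ _ _ (fun p : R * (R * R) => (p.1, p.2.2)) (fun p => z p.1 p.2)) => //.
  by apply: measurable_fun_pair => //; exact: measurableT_comp.
by apply: eq_cmeas h => p; rewrite volE.
Qed.

Let cmeas_snk x r : cmeas (fun t => snk x t r).
Proof.
apply: (@cmeas_comp _ _ _ _ _ (fun t : R => (t, (x, r))) (fun p => snk p.2.1 p.1 p.2.2)) => //.
Qed.

Let jmeas_snk x : jmeas (snk x).
Proof.
apply: (@cmeas_comp _ _ _ _ _ (fun p : R * R => (p.1, (x, p.2))) (fun p => snk p.2.1 p.1 p.2.2)) => //.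
by apply: measurable_fun_pair => //; exact: measurable_fun_pair.
Qed.

Let snkM_le z x t r K : 0 <= K -> [in x] -> vker x t != 0 ->
  (forall t, 0 < t < pi -> cmod (z t r) <= K * expR (kappa * d t)) ->
  cmod (snk x t r * z t r) <= K * pi.
Proof.
move=> K0 xp wt hz; have [tp dt0 dp] := vker_supp xp wt.
have h := spec_bound (snk_spec dp) r.
rewrite cmodM; apply: le_trans (ler_pM (cmod_ge0 _) (cmod_ge0 _) h (hz t tp)) _.
by rewrite mulrCA mulrAC -expRD addNr expR0 mul1r mulrC.
Qed.

Lemma cintegrable_vol z x r K : 0 <= K -> cmeas (z^~ r) -> [in x] ->
  (forall t, 0 < t < pi -> cmod (z t r) <= K * expR (kappa * d t)) ->
  cintegrable (fun t => vker x t * (snk x t r * z t r)).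
Proof.
move=> K0 mz xp hz; apply: (cintegrable_mulb (ivker x) (M := K * pi)).
  by apply: cmeasM.
by move=> t wt; exact: snkM_le.
Qed.

Lemma vol_le z x r K : 0 <= K -> cmeas (z^~ r) -> [in x] ->
  (forall t, 0 < t < pi -> cmod (z t r) <= K * expR (kappa * d t)) ->
  cmod (vol z x r) <= K * (2^-1 * expR (kappa * d x)).
Proof.
move=> K0 mz xp hz; rewrite volE.
have := @cmod_cint_mulb _ (vker x) (fun t => snk x t r * z t r) (K * pi) (ivker x) _ _.
move=> /(_ (cmeasM (cmeas_snk x r) mz) (fun t wt => snkM_le K0 xp wt hz)) h.
apply: le_trans h _; rewrite -mulrA; apply: ler_wpM2l => //; exact: vker_le.
Qed.

Lemma volB z z' x r K K' : 0 <= K -> 0 <= K' -> cmeas (z^~ r) -> cmeas (z'^~ r) -> [in x] ->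
  (forall t, 0 < t < pi -> cmod (z t r) <= K * expR (kappa * d t)) ->
  (forall t, 0 < t < pi -> cmod (z' t r) <= K' * expR (kappa * d t)) ->
  vol z x r - vol z' x r = vol (fun t r => z t r - z' t r) x r.
Proof.
move=> K0 K'0 mz mz' xp hz hz'; rewrite !volE -cintB; last 2 first.
- exact: cintegrable_vol hz.
- exact: cintegrable_vol hz'.
by apply: eq_cint => t; rewrite -!mulrBr.
Qed.

(** Waves travel at unit speed: the kernel has exponents at least - (d x - d t), z t at least a - d
    t, and the sum a - d x is independent of t. *)
Lemma vol_spec a K z : 0 <= K -> jmeas z ->
  (forall t, 0 < t < pi -> spec (a - d t) (K * expR (kappa * d t)) (z t)) ->
  forall x, [in x] -> spec (a - d x) (K * (2^-1 * expR (kappa * d x))) (vol z x).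
Proof.
move=> K0 mz sz x xp.
have sE t : vker x t != 0 -> spec (a - d x) (K * pi) (fun r => snk x t r * z t r).
  move=> /(vker_supp xp)[tp dt0 dp]; have := specM (snk_spec dp) (sz t tp).
  rewrite (_ : - (d x - d t) + (a - d t) = a - d x); last by ring.
  by rewrite mulrCA mulrAC -expRD addNr expR0 mul1r mulrC.
have mE : jmeas (fun t r => snk x t r * z t r) by exact: (jmeasM (jmeas_snk x) mz).
apply: eq_spec (spec_le (lexx _) _ (spec_cint (ivker x) mE sE)) => [r|]; first by rewrite volE.
by rewrite -mulrA; apply: ler_wpM2l => //; exact: vker_le.
Qed.

(** Multiplying the kernel by r turns [sn] into a sine, so r times the integral is still bounded:
    the operator gains a factor 1/r. *)
Lemma vol_jap z x r K : 0 <= K -> cmeas (z^~ r) -> [in x] ->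
  (forall t, 0 < t < pi -> cmod (z t r) <= K * expR (kappa * d t)) ->
  cmod (vol z x r) <= (2 * K * expR (kappa * pi)) * jap r.
Proof.
move=> K0 mz xp hz; have /andP[x0 xpi] := d0p xp.
have ep : expR (kappa * d x) <= expR (kappa * pi) by rewrite ler_expR ler_wpM2l.
have e0 := expR_ge0 (kappa * pi); have ex0 := expR_ge0 (kappa * d x).
have p1 : 1 <= (pi : R) by have := pi_ge2 R; lra.
have i0 : 0 <= \int[mu]_t cmod (vker x t) by apply: Rintegral_ge0 => t _; exact: cmod_ge0.
have il : \int[mu]_t cmod (vker x t) <= expR (kappa * pi).
  exact: weight_le i0 ex0 p1 (vker_le xp) ep.
have -> : 2 * K * expR (kappa * pi) = K * expR (kappa * pi) + K * expR (kappa * pi) by rewrite -mulrA mulr_natl mulr2n.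
apply: le_jap; first exact: cmod_ge0.
  apply: le_trans (vol_le K0 mz xp hz) _; apply: ler_wpM2l => //.
  by apply: le_trans ep; rewrite ler_piMl// invf_le1// ler1n.
have -> : `|r| * cmod (vol z x r) = cmod (real_complex R r * vol z x r) by rewrite cmodM cmod_real.
rewrite volE -cintZ; last exact: cintegrable_vol hz.
have -> : cint (fun t => real_complex R r * (vker x t * (snk x t r * z t r))) =
          cint (fun t => vker x t * (real_complex R r * snk x t r * z t r)).
  by apply: eq_cint => t; rewrite mulrCA !mulrA.
apply: le_trans (_ : K * \int[mu]_t cmod (vker x t) <= _); last by apply: ler_wpM2l.
apply: (cmod_cint_mulb (ivker x)).
  by apply: cmeasM => //; apply: cmeasM => //; exact: cmeas_cst.
move=> t /(vker_supp xp)[tp dt0 dp].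
rewrite /snk -rmorphM cmodM cmod_real mulrCA normrM sn_mul (ger0_norm (expR_ge0 _)).
apply: le_trans (_ : expR (- (kappa * d t)) * 1 * (K * expR (kappa * d t)) <= _).
  apply: ler_pM; rewrite ?cmod_ge0 ?mulr_ge0 ?expR_ge0//; last exact: hz.
  by apply: ler_wpM2l; [exact: expR_ge0|rewrite ler_norml sin_geN1 sin_le1].
by rewrite mulr1 mulrCA -expRD addNr expR0 mulr1.
Qed.

Section Equation.
Variables (a M0 : R) (y0 y : R -> R -> R[i]).
Hypotheses (my0 : jmeas y0) (sy0 : forall x, [in x] -> spec (a - d x) M0 (y0 x)).
Hypothesis hy : forall x r, [in x] -> y x r = y0 x r + vol y x r.
Hypothesis yout : forall x r, ~~ [in x] -> y x r = 0.
Hypotheses (my : forall r, cmeas (y^~ r)) (yb : forall r, exists B, forall x, cmod (y x r) <= B).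

Let mask (x : R) : R[i] := real_complex R ((0 <= x <= pi)%R : bool)%:R.

(** The solution [y] is given, not constructed; the iterates, which visibly belong to the class,
    converge to it because of the contraction and pass the class on to it. *)
Let picard := fix picard n (x r : R) : R[i] :=
  if n is n'.+1 then mask x * (y0 x r + vol (picard n') x r) else 0.

Let edge_in (x : R) : 0 < x < pi -> [in x].
Proof. by case/andP => /ltW -> /ltW ->. Qed.

Let maskE x : [in x] -> mask x = 1. Proof. by rewrite /mask => ->. Qed.

Let M00 : 0 <= M0.
Proof. by apply: spec_ge0 (sy0 (x := 0) _); rewrite lexx pi_ge0. Qed.

Let jmeas_picard n : jmeas (picard n).
Proof.
elim: n => [|n IH] /=; first exact: jmeas_cst.
apply: jmeasM; last by apply: jmeasD => //; exact: jmeas_vol.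
apply: jmeas1; apply: cmeas_real; apply: measurable_natr_bool.
by apply: measurable_and; apply: measurable_fun_ler.
Qed.

Let picard_spec n x : [in x] -> spec (a - d x) (2 * M0 * expR (kappa * d x)) (picard n x).
Proof.
have e1 z : [in z] -> 1 <= expR (kappa * d z).
  by move=> /d0p/andP[z0 _]; rewrite -expR0 ler_expR mulr_ge0.
elim: n x => [|n IH] x xp /=.
  apply: (spec_le (lexx _) _ (spec0 (a - d x))); rewrite mulr_ge0 ?expR_ge0// mulr_ge0//.
have K0 : 0 <= 2 * M0 by rewrite mulr_ge0.
have h := specD (sy0 xp) (vol_spec K0 (jmeas_picard n) (fun t tp => IH t (edge_in tp)) xp).
apply: eq_spec (spec_le (lexx _) _ h) => [r|]; first by rewrite maskE// mul1r.
exact: picard_const_le (e1 x xp).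
Qed.

(** At first [y] is bounded only for each r separately. The contraction nevertheless brings the
    iterates to it at rate 2^-n, and [y_le] then derives in the limit a bound independent of r, with
    which this lemma is applied again in [ycvg]. *)
Let picard_cvg B r : 0 <= B -> (forall x, [in x] -> cmod (y x r) <= B * expR (kappa * d x)) ->
  forall n x, [in x] -> cmod (y x r - picard n x r) <= B * 2^-1 ^+ n * expR (kappa * d x).
Proof.
move=> B0 yB; elim=> [|n IH] x xp /=; first by rewrite subr0 expr0 mulr1 yB.
rewrite maskE// mul1r hy// opprD addrACA subrr add0r.
rewrite (@volB y (picard n) x r B (2 * M0))//; last 4 first.
- by rewrite mulr_ge0.
- exact: jmeas_secr.
- by move=> t /edge_in tp; exact: yB.
- by move=> t /edge_in tp; exact: (spec_bound (picard_spec n tp) r).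
have b0 : 0 <= B * 2^-1 ^+ n by rewrite mulr_ge0// exprn_ge0// invr_ge0.
rewrite exprSr mulrA -[leRHS]mulrA; apply: (@vol_le (fun t r => y t r - picard n t r)) => //.
  by apply: cmeasB => //; exact: jmeas_secr.
by move=> t /edge_in tp; exact: IH.
Qed.

Let y_le x r : [in x] -> cmod (y x r) <= 2 * M0 * expR (kappa * d x).
Proof.
move=> xp; have [B yB] := yb r.
have B0 : 0 <= B by exact: le_trans (cmod_ge0 _) (yB x).
have yB' z : [in z] -> cmod (y z r) <= B * expR (kappa * d z).
  move=> /d0p/andP[z0 _]; apply: le_trans (yB z) _; rewrite ler_peMr//.
  by rewrite -expR0 ler_expR mulr_ge0.
apply: (@le_half_pow _ _ _ (B * expR (kappa * d x))) => n.
have -> : y x r = picard n x r + (y x r - picard n x r) by rewrite addrC subrK.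
apply: le_trans (cmodD _ _) _; apply: lerD; first exact: (spec_bound (picard_spec n xp) r).
by rewrite mulrAC; exact: (picard_cvg B0 yB').
Qed.

Let ycvg x r n : cmod (y x r - picard n x r) <= 2 * M0 * expR (kappa * d x) * 2^-1 ^+ n.
Proof.
have K0 : 0 <= 2 * M0 by rewrite mulr_ge0.
have [xp|xp] := boolP (0 <= x <= pi).
  by rewrite mulrAC; apply: picard_cvg => // z zp; exact: y_le.
rewrite (yout _ xp) sub0r cmodN; have -> : picard n x r = 0.
  by case: n => //= n; rewrite /mask (negbTE xp) mul0r.
by rewrite cmod0 !mulr_ge0 ?expR_ge0 ?exprn_ge0 ?invr_ge0.
Qed.

Lemma volterra_jmeas : jmeas y.
Proof.
apply: (@cmeas_half_lim _ _ _ (fun n (p : R * R) => picard n p.1 p.2)) => [n|p].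
  exact: jmeas_picard.
by exists (2 * M0 * expR (kappa * d p.1)) => n; exact: ycvg.
Qed.

Lemma volterra_spec x : [in x] -> spec (a - d x) (4 * M0 * expR (kappa * pi)) (y x).
Proof.
move=> xp; have /andP[x0 xpi] := d0p xp.
have ep : expR (kappa * d x) <= expR (kappa * pi) by rewrite ler_expR ler_wpM2l.
have e0 := expR_ge0 (kappa * d x).
apply: (spec_le (lexx _) _ (spec_half_lim (fun n => picard_spec n xp) (fun r => ycvg x r))).
by apply: ler_pM; rewrite ?mulr_ge0// ler_wpM2r// ler_nat.
Qed.

Lemma volterra_jap x r : [in x] -> cmod (y x r - y0 x r) <= (4 * M0 * expR (kappa * pi)) * jap r.
Proof.
move=> xp; rewrite hy// addrAC subrr add0r.
have K0 : 0 <= 2 * M0 by rewrite mulr_ge0.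
apply: le_trans (vol_jap K0 (my r) xp _) _; first by move=> t /edge_in; exact: y_le.
by rewrite mulrA -natrM.
Qed.

End Equation.
End Volterra.

(** * The choice of the exponential weight *)

Section VolterraWeight.
Variable R : realType.
Local Notation mu := (@lebesgue_measure R).

Lemma young_half (th s e : R) : 0 < th -> e * s <= 2^-1 * (th * s ^+ 2 + th^-1 * e ^+ 2).
Proof.
move=> th0; have h : 0 <= th * (s - th^-1 * e) ^+ 2 by rewrite mulr_ge0 ?sqr_ge0// ltW.
have e1 : th * (s - th^-1 * e) ^+ 2 = th * s ^+ 2 - 2 * (e * s) + th^-1 * e ^+ 2.
  by field; rewrite gt_eqF.
by rewrite e1 in h; lra.
Qed.

(** The right-hand side is 1 / (1 + (k u)^2). Comparing the exponential with a Poisson kernel allows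
    its integral to be bounded by [poisson_mass]. *)
Lemma expR_le_poisson (k u : R) : 0 < k -> 0 <= u ->
  expR (- (k * u)) ^+ 2 <= k^-1 * poisson (2 / k) (2 * u).
Proof.
move=> k0 u0; rewrite expr2 -expRD -opprD expRN.
have e1 : 1 + 2 * (k * u) ^+ 2 <= expR (k * u + k * u).
  have ku : 0 <= k * u + k * u by rewrite addr_ge0// mulr_ge0// ltW.
  by apply: le_trans (expR_ge1Dxn 1 ku); rewrite (_ : (2`!%:R : R) = 2)//; lra.
have -> : k^-1 * poisson (2 / k) (2 * u) = (1 + (k * u) ^+ 2)^-1.
  have : 0 < 1 + (k * u) ^+ 2 by have := sqr_ge0 (k * u); lra.
  have p1 : 0 < 4 + (2 * u * k) ^+ 2 by have := sqr_ge0 (2 * u * k); lra.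
  by rewrite /poisson => p0; field; rewrite !gt_eqF.
have p0 : 0 < 1 + (k * u) ^+ 2 by have := sqr_ge0 (k * u); lra.
rewrite lef_pV2 ?posrE ?expR_gt0//; apply: le_trans e1.
by have := sqr_ge0 (k * u); lra.
Qed.

Lemma poisson_dist (h x t : R) : poisson h (2 * x - 2 * t) = poisson h (2 * `|x - t|).
Proof.
by rewrite /poisson -mulrBr [in RHS]exprMn real_normK ?num_real// -exprMn.
Qed.

Lemma vker_le_young (d : R -> R) (Q : R -> R[i]) (k th x t : R) : 0 < k -> 0 < th ->
  `|d x - d t| = `|x - t| -> (~~ (0 < t < pi) -> Q t = 0) ->
  cmod (vker d Q k x t) <= expR (k * d x) * 2^-1 * (th * cmod (Q t) ^+ 2
    + th^-1 * k^-1 * (\1_`]0, pi[ t * poisson (2 / k) (2 * x - 2 * t))).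
Proof.
move=> k0 th0 dd Q0; have h0 : 0 < 2 / k by rewrite divr_gt0.
set g := (leRHS); have g0 : 0 <= g.
  apply: mulr_ge0; first by rewrite mulr_ge0 ?expR_ge0 ?invr_ge0.
  apply: addr_ge0; first by rewrite mulr_ge0 ?sqr_ge0// ltW.
  apply: mulr_ge0; first by rewrite mulr_ge0// invr_ge0 ltW.
  by rewrite mulr_ge0 ?indic_itv_ge0// poisson_ge0.
rewrite /vker cmodM cmod_real normrM (ger0_norm (expR_ge0 _)).
have [tp|/Q0 ->] := boolP (0 < t < pi); last by rewrite cmod0 mulr0.
case: ltP => [dtx|_]; last by rewrite normr0 !mul0r.
rewrite normr1 mul1r /g indic_itvE tp mul1r.
have uE : d x - d t = `|x - t| by rewrite -dd gtr0_norm ?subr_gt0.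
have -> : expR (k * d t) = expR (k * d x) * expR (- (k * `|x - t|)).
  by rewrite -expRD -uE; congr expR; ring.
rewrite -[in leRHS]mulrA -[leLHS]mulrA; apply: ler_wpM2l; first exact: expR_ge0.
apply: le_trans (young_half _ _ th0) _; apply: ler_wpM2l => //; rewrite lerD2l -mulrA.
apply: ler_wpM2l; first by rewrite invr_ge0 ltW.
rewrite poisson_dist; exact: (expR_le_poisson k0 (normr_ge0 _)).
Qed.

(** With theta = 1 / (2 p b) and kappa = 4 p^3 b, the two terms of the Young inequality are both
    equal to 1 / (2 p). *)
Lemma weight_const (p b e : R) : 0 < p -> 0 < b ->
  2^-1 * e = p * (e * 2^-1 * ((2 * p * b)^-1 * b + (2 * p * b)^-1^-1 * (4 * p ^+ 3 * b)^-1 * p)).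
Proof. by move=> p0 b0; field; rewrite (gt_eqF b0) (gt_eqF p0). Qed.

(* With the weight expR (kappa d) the Volterra operator becomes a contraction of factor 1/2. *)
Lemma vker_weight (d : R -> R) (Q : R -> R[i]) (b : R) : 0 < b -> measurable_fun setT d ->
  (forall x t, `|d x - d t| = `|x - t|) -> sqint Q ->
  (forall t, ~~ (0 < t < pi) -> Q t = 0) -> sqnorm Q <= b ->
  forall x, pi * \int[mu]_t cmod (vker d Q (4 * pi ^+ 3 * b) x t)
    <= 2^-1 * expR (4 * pi ^+ 3 * b * d x).
Proof.
move=> b0 md dd [mQ iQ2] Q0 Qb x; have p0 := pi_gt0 R.
set k := 4 * pi ^+ 3 * b; pose th := (2 * pi * b)^-1.
have k0 : 0 < k by rewrite /k !mulr_gt0// exprn_gt0.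
have th0 : 0 < th by rewrite invr_gt0 !mulr_gt0.
have h0 : 0 < 2 / k by rewrite divr_gt0.
pose P t := \1_`]0, pi[ t * poisson (2 / k) (2 * x - 2 * t).
have iP : rintegrable P by exact: (rintegrable_poissonM h0 (2 * x) (rintegrable_indic_itv pi)).
pose g t := expR (k * d x) * 2^-1 * (th * cmod (Q t) ^+ 2 + th^-1 * k^-1 * P t).
have ig : rintegrable g by apply: rintegrableZ; apply: rintegrableD; exact: rintegrableZ.
have vg t : cmod (vker d Q k x t) <= g t.
  exact: (vker_le_young k0 th0 (dd x t) (Q0 t)).
have -> : 2^-1 * expR (k * d x) = pi * (expR (k * d x) * 2^-1 * (th * b + th^-1 * k^-1 * pi)).
  exact: weight_const.
rewrite (ler_pM2l p0).
have mv : measurable_fun setT (fun t => cmod (vker d Q k x t)).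
  apply: cmeas_cmod; apply: cmeasM => //; apply: cmeas_real; apply: measurable_funM.
    by apply: measurable_natr_bool; apply: measurable_fun_ltr => //; exact: measurable_cst.
  by apply: (measurableT_comp (@measurable_expR R)); apply: measurable_funM => //; exact: measurable_cst.
have iv : rintegrable (fun t => cmod (vker d Q k x t)).
  by apply: (rintegrable_dom mv ig) => t; rewrite ger0_norm ?cmod_ge0.
apply: le_trans (_ : \int[mu]_t g t <= _).
  by apply: le_Rintegral.
rewrite (RintegralZl _ measurableT); last by apply: rintegrableD; exact: rintegrableZ.
rewrite (RintegralD measurableT (rintegrableZ _ iQ2) (rintegrableZ _ iP)).
rewrite (RintegralZl _ measurableT iQ2) (RintegralZl _ measurableT iP).
apply: ler_wpM2l; first by rewrite mulr_ge0 ?expR_ge0 ?invr_ge0.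
apply: lerD; apply: ler_wpM2l; [exact: ltW|exact: Qb| |exact: (poisson_mass h0)].
by apply: mulr_ge0; rewrite invr_ge0; exact: ltW.
Qed.

End VolterraWeight.

(** * Sturm-Liouville solutions on one edge *)

Section Solutions.
Variable R : realType.
Local Notation mu := (@lebesgue_measure R).
Local Notation AC := absolutely_continuous.
Implicit Types (y dy z dz Q : R -> R[i]) (r s t : R).

(** The equation at lambda = r^2, as a first-order system for the pair (y, y'); absolute continuity
    of [dy] gives meaning to y' at the end points. *)
Definition sol Q r y dy := [/\ AC 0 pi y, AC 0 pi dy,
  forall x, 0 < x < pi -> has_cderive y x (dy x) &
  {ae mu, forall x, 0 < x < pi -> has_cderive dy x ((Q x - real_complex R r ^+ 2) * y x)}].

Lemma SL_sol q Q r y dy : (forall x, 0 < x < pi -> Q x = q x) ->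
  SL_solution q (real_complex R r ^+ 2) y dy -> sol Q r y dy.
Proof.
move=> Qq [acy acdy dy_ ae]; split => //.
apply: (@filterS _ _ (ae_filter_ringOfSetsType mu) _ _ _ ae) => x h xp.
have [|d2 hd e] := h; first by rewrite /edge /= in_itv.
have -> : (Q x - real_complex R r ^+ 2) * y x = d2; last by [].
by rewrite mulrBl -e Qq// opprD opprK addrCA subrr addr0.
Qed.

Lemma sol_lin Q r a b y dy z dz : sol Q r y dy -> sol Q r z dz ->
  sol Q r (fun x => a * y x - b * z x) (fun x => a * dy x - b * dz x).
Proof.
move=> [y1 y2 y3 y4] [z1 z2 z3 z4]; split.
- by apply: acB; apply: acM => //; exact: ac_cst.
- by apply: acB; apply: acM => //; exact: ac_cst.
- by move=> x xp; apply: has_cderiveB; apply: has_cderiveZ; [exact: y3|exact: z3].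
apply: (@filterS2 _ _ (ae_filter_ringOfSetsType mu) _ _ _ _ y4 z4) => x hy hz xp.
have -> : (Q x - real_complex R r ^+ 2) * (a * y x - b * z x) =
  a * ((Q x - real_complex R r ^+ 2) * y x) - b * ((Q x - real_complex R r ^+ 2) * z x) by ring.
by apply: has_cderiveB; apply: has_cderiveZ; [exact: hy|exact: hz].
Qed.

Lemma ac_real a b (f df : R -> R) K : (forall x, is_derive x (1 : R) f (df x)) ->
  (forall x, `|df x| <= K) -> AC a b (fun x => real_complex R (f x)).
Proof.
move=> hf hK; apply: (@ac_lip _ _ _ _ K) => x z _ xz _.
rewrite -rmorphB cmod_real; move: xz; rewrite le_eqVlt => /predU1P[->|xz].
  by rewrite !subrr normr0 mulr0.
have [|c _ ->] := @MVT R f df x z xz (fun t _ => hf t).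
  by apply: continuous_subspaceT => t; exact: is_derive_continuous (hf t).
have zx : 0 <= z - x by rewrite subr_ge0 ltW.
by rewrite normrM (ger0_norm zx); apply: ler_wpM2r.
Qed.

Lemma is_derive_reflect (f : R -> R) (c x d : R) : is_derive (c - x) (1 : R) f d ->
  is_derive x (1 : R) (fun t => f (c - t)) (- d).
Proof.
move=> hf; have d1 : is_derive x (1 : R) (fun t : R => c - t) (-1).
  apply: eq_is_derive (is_deriveB (is_derive_cst c x (1 : R)) (is_derive_id x (1 : R))) => //.
  by rewrite sub0r.
by apply: eq_is_derive (@is_derive1_comp R f (fun t => c - t) x d (-1) hf d1) => //; rewrite mulrN1.
Qed.

Lemma norm_r2sn (u r : R) : `|r ^+ 2 * sn u r| <= `|r|.
Proof. by rewrite expr2 -mulrA sn_mul normrM ler_piMr// ler_norml sin_geN1 sin_le1. Qed.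

Lemma norm_cos (u : R) : `|cos u| <= 1. Proof. by rewrite ler_norml cos_geN1 cos_le1. Qed.

Lemma sol_sn (c r : R) : sol (fun=> 0) r (fun t => real_complex R (sn (c - t) r))
  (fun t => real_complex R (- cos (r * (c - t)))).
Proof.
have d1 x : is_derive x (1 : R) (fun t => sn (c - t) r) (- cos (r * (c - x))).
  exact: (is_derive_reflect (is_derive_sn r (c - x))).
have d2 x : is_derive x (1 : R) (fun t => - cos (r * (c - t))) (- (r ^+ 2 * sn (c - x) r)).
  have := is_deriveN (is_derive_reflect (is_derive_cosr r (c - x))).
  by apply: eq_is_derive => //; rewrite mulNr !opprK.
split.
- by apply: (@ac_real _ _ _ _ 1 d1) => x; rewrite normrN norm_cos.
- by apply: (@ac_real _ _ _ _ `|r| d2) => x; rewrite normrN norm_r2sn.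
- by move=> x _; exact: has_cderive_real.
apply: aeW => x _; rewrite sub0r -rmorphXn -rmorphN -rmorphM mulNr.
exact: has_cderive_real.
Qed.

Lemma sol_cos (c r : R) : sol (fun=> 0) r (fun t => real_complex R (cos (r * (c - t))))
  (fun t => real_complex R (r ^+ 2 * sn (c - t) r)).
Proof.
have d1 x : is_derive x (1 : R) (fun t => cos (r * (c - t))) (r ^+ 2 * sn (c - x) r).
  have := is_derive_reflect (is_derive_cosr r (c - x)).
  by apply: eq_is_derive => //; rewrite mulNr opprK.
have d2 x : is_derive x (1 : R) (fun t => r ^+ 2 * sn (c - t) r) (- r ^+ 2 * cos (r * (c - x))).
  have := is_deriveZ (r ^+ 2) (is_derive_reflect (is_derive_sn r (c - x))).
  by apply: eq_is_derive => //; rewrite /GRing.scale/= mulrN mulNr.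
split.
- by apply: (@ac_real _ _ _ _ `|r| d1) => x; exact: norm_r2sn.
- apply: (@ac_real _ _ _ _ (r ^+ 2) d2) => x; rewrite mulNr normrN normrM.
  by rewrite (ger0_norm (sqr_ge0 _)) ler_piMr ?sqr_ge0 ?norm_cos.
- by move=> x _; exact: has_cderive_real.
apply: aeW => x _; rewrite sub0r -rmorphXn -rmorphN -rmorphM.
exact: has_cderive_real.
Qed.

(** Outside [0, pi] a solution has arbitrary values; they are erased wherever measurability or
    integration in x over the whole line is at stake. *)
Definition mask (x : R) : R[i] := real_complex R ((0 <= x <= pi)%R : bool)%:R.

Lemma maskE x : 0 <= x <= pi -> mask x = 1. Proof. by rewrite /mask => ->. Qed.

Lemma mask0 x : ~~ (0 <= x <= pi) -> mask x = 0. Proof. by rewrite /mask => /negbTE ->. Qed.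

Lemma clamp_dist (p x z : R) : 0 <= p ->
  `|Num.min (Num.max x 0) p - Num.min (Num.max z 0) p| <= `|x - z|.
Proof.
move=> p0; have h1 := ler_norm (x - z); have h2 := ler_norm (z - x).
rewrite distrC in h2; move: (`|x - z|) h1 h2 => n h1 h2; rewrite ler_norml.
case: (ltP x 0) => hx; case: (ltP z 0) => hz; rewrite ?(max_r (ltW hx)) ?(max_l hx)
  ?(max_r (ltW hz)) ?(max_l hz); rewrite ?(min_l p0).
- by apply/andP; split; lra.
- by case: (leP z p) => hzp; rewrite ?(min_l hzp) ?(min_r (ltW hzp)); apply/andP; split; lra.
- by case: (leP x p) => hxp; rewrite ?(min_l hxp) ?(min_r (ltW hxp)); apply/andP; split; lra.
by case: (leP x p) => hxp; rewrite ?(min_l hxp) ?(min_r (ltW hxp));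
  case: (leP z p) => hzp; rewrite ?(min_l hzp) ?(min_r (ltW hzp)); apply/andP; split; lra.
Qed.

Let clamp (x : R) : R := Num.min (Num.max x 0) pi.

Let clamp_lip (x z : R) : `|clamp x - clamp z| <= `|x - z|.
Proof.
exact: clamp_dist (pi_ge0 R).
Qed.

Let clamp_in x : 0 <= clamp x <= pi.
Proof. by rewrite /clamp le_min le_max lexx orbT ge_min lexx orbT pi_ge0. Qed.

Let clampE x : 0 <= x <= pi -> clamp x = x.
Proof. by move=> /andP[x0 xp]; rewrite /clamp (max_l x0) (min_l xp). Qed.

(** Composition with the projection [clamp] onto [0, pi] extends y to a continuous function on the
    line. *)
Lemma ac_cmeas y : AC 0 pi y -> cmeas (fun x => mask x * y x).
Proof.
move=> acy; have cy (p : R[i] -> R) : (forall u v, `|p u - p v| <= cmod (u - v)) ->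
    continuous (fun x => p (y (clamp x))).
  move=> hp x; apply/cvgrPdist_lt => e e0; have [d d0 hd] := ac_unif acy e0.
  near=> t; apply: le_lt_trans (hp _ _) _.
  have xt : `|clamp x - clamp t| < d by apply: le_lt_trans (clamp_lip _ _) _; near: t; exact: cvgr_dist_lt.
  have /andP[x0 xp] := clamp_in x; have /andP[t0 tp] := clamp_in t.
  have [l|l] := leP (clamp x) (clamp t).
    by rewrite cmod_distC; apply: hd => //; rewrite distrC ger0_norm ?subr_ge0// in xt.
  by apply: hd => //; [exact: ltW|rewrite gtr0_norm ?subr_gt0// in xt].
have h : cmeas (fun x => mask x * y (clamp x)).
  apply: cmeasM.
    apply: cmeas_real; apply: measurable_natr_bool.
    by apply: measurable_and; apply: measurable_fun_ler.
  split; apply: continuous_measurable_fun; apply: cy => u v.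
    by rewrite -Re_opp -Re_add; exact: Re_le_cmod.
  by rewrite -Im_opp -Im_add; exact: Im_le_cmod.
apply: eq_cmeas h => x; have [xp|xp] := boolP (0 <= x <= pi); first by rewrite clampE.
by rewrite mask0// !mul0r.
Unshelve. all: by end_near.
Qed.

Lemma ac_mask_bounded y : AC 0 pi y -> exists B, forall x, cmod (mask x * y x) <= B.
Proof.
move=> /ac_bounded[B B0 hB]; exists B => x; have [xp|xp] := boolP (0 <= x <= pi).
  by rewrite maskE// mul1r; case/andP: xp => *; exact: hB.
by rewrite mask0// mul0r cmod0.
Qed.

Lemma cint_itv (f : R -> R[i]) s t :
  cintegral `]s, t[ f = cint (fun x => real_complex R ((s < x < t)%R : bool)%:R * f x).
Proof.
have e x : (\1_`]s, t[ x : R) = ((s < x < t)%R : bool)%:R by rewrite indicE mem_setE in_itv.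
apply: complexP => /=; rewrite -(Rintegral_indic `]s, t[%classic); apply: eq_Rintegral => x _.
  by rewrite e Re_mul /= mul0r subr0.
by rewrite e Im_mul /= mul0r addr0.
Qed.

Section Lagrange.
Variables (Q Qt : R -> R[i]) (r : R) (y dy z dz : R -> R[i]).
Hypotheses (iQ : cintegrable Q) (iQt : cintegrable Qt).
Hypotheses (hy : sol Q r y dy) (hz : sol Qt r z dz).

Lemma cintegrable_lagrange :
  cintegrable (fun x => (Q x - Qt x) * ((mask x * y x) * (mask x * z x))).
Proof.
have [acy _ _ _] := hy; have [acz _ _ _] := hz.
have [B yB] := ac_mask_bounded acy; have [B' zB] := ac_mask_bounded acz.
apply: (@cintegrable_mulb _ _ _ (B * B') (cintegrableB iQ iQt)).
  by apply: cmeasM; exact: ac_cmeas.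
by move=> x _; rewrite cmodM; apply: ler_pM; rewrite ?cmod_ge0.
Qed.

(** The function y z' - y' z is absolutely continuous, and its derivative is - (Q - Qt) y z, since
    the terms in r^2 cancel. *)
Lemma lagrange s t : 0 <= s -> s <= t -> t <= pi ->
  (y s * dz s - dy s * z s) - (y t * dz t - dy t * z t) =
  cint (fun x => real_complex R ((s < x < t)%R : bool)%:R *
    ((Q x - Qt x) * ((mask x * y x) * (mask x * z x)))).
Proof.
move=> s0 + tp; rewrite le_eqVlt => /predU1P[->|st].
  rewrite subrr (_ : (fun x => _) = fun=> 0) ?cint0//; apply/funext => x.
  have -> : (t < x < t) = false by apply/negbTE/negP => /andP[/lt_trans h/h]; rewrite ltxx.
  by rewrite mul0r.
have [y1 y2 y3 y4] := hy; have [z1 z2 z3 z4] := hz.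
rewrite -cint_itv -opprB -[RHS]opprK; congr (- _).
rewrite (@ac_ftc R s t (fun x => y x * dz x - dy x * z x)
  (fun x => - ((Q x - Qt x) * ((mask x * y x) * (mask x * z x)))))//.
- rewrite !cint_itv -cintN; last first.
    apply: (@cintegrable_bM _ _ _ 1); last exact: cintegrable_lagrange.
      apply: cmeas_real; apply: measurable_natr_bool.
      by apply: measurable_and; apply: measurable_fun_ltr.
    by move=> x; rewrite cmod_real; case: (_ < _ < _); rewrite ?normr1 ?normr0.
  by apply: eq_cint => x; rewrite mulrN.
- by apply: ac_sub s0 tp _; apply: acB; apply: acM.
- exact: cintegrableN cintegrable_lagrange.
apply: (@filterS2 _ _ (ae_filter_ringOfSetsType mu) _ _ _ _ y4 z4) => x h1 h2 /andP[sx xt].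
have xp : 0 < x < pi by rewrite (le_lt_trans s0 sx) (lt_le_trans xt tp).
have xp' : 0 <= x <= pi by case/andP: xp => /ltW -> /ltW ->.
have := has_cderiveB (has_cderiveM (y3 x xp) (h2 xp)) (has_cderiveM (h1 xp) (z3 x xp)).
congr (has_cderive _ _ _); rewrite maskE// !mul1r; ring.
Qed.

End Lagrange.
End Solutions.

(** * Integral equations from either end of an edge *)

Section IntegralEquations.
Variable R : realType.
Local Notation mu := (@lebesgue_measure R).
Local Notation rc := (real_complex R).
Variables (b : R) (Q : R -> R[i]).
Hypotheses (b0 : 0 < b) (sQ : sqint Q) (Q0 : forall t, ~~ (0 < t < pi) -> Q t = 0).
Hypothesis Qb : sqnorm Q <= b.

(** The factor 4 exp(kappa pi) of the Volterra bounds, with kappa = 4 pi^3 b as chosen in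
    [vker_weight]. *)
Definition growth : R := 4 * expR (4 * pi ^+ 3 * b * pi).

Lemma growth_ge0 : 0 <= growth. Proof. by rewrite mulr_ge0 ?expR_ge0. Qed.

Let iQ : cintegrable Q. Proof. exact: sqint_supp_cintegrable sQ Q0. Qed.

Let cintegrable0 : cintegrable (fun=> 0 : R[i]).
Proof. by split; exact: rintegrable0. Qed.

Lemma snN (u r : R) : sn (- u) r = - sn u r.
Proof. by rewrite /sn mulrN sinN mulNr; case: ifP. Qed.

Let QM (t : R) (u v : R[i]) : (0 < t < pi -> u = v) -> Q t * u = Q t * v.
Proof. by have [tp ->//|/Q0 ->] := boolP (0 < t < pi); rewrite !mul0r. Qed.

Let edge_in (x : R) : 0 < x < pi -> 0 <= x <= pi.
Proof. by case/andP => /ltW -> /ltW ->. Qed.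

Section Family.
Variables y dy : R -> R -> R[i].
Hypothesis hy : forall r, sol Q r (y^~ r) (dy^~ r).

Let ym x r := mask x * y x r.

(** Lagrange identity on [0, x] against the free solution sin(r (x - t)) / r, which vanishes at t =
    x with derivative -1. The backward equation uses the same solution on [x, pi]. *)
Lemma forward_equation x r : 0 <= x <= pi ->
  ym x r = y 0 r * rc (cos (r * x)) + dy 0 r * rc (sn x r) + vol id Q ym x r.
Proof.
move=> /andP[x0 xp]; rewrite /ym maskE ?x0//= mul1r.
have := lagrange iQ cintegrable0 (hy r) (sol_sn x r) (lexx 0) x0 xp.
rewrite !subr0 subrr mulr0 cos0 sn0 !rmorphN rmorph1 rmorph0 mulr0 subr0 mulrN mulrN1 opprK.
set I := cint _; set J := vol _ _ _ _ _ => h.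
have -> : J = I; last by rewrite -h; ring.
apply: eq_cint => t; rewrite subr0 [RHS]mulrCA; apply: QM => tp.
rewrite /= !maskE ?edge_in// !mul1r rmorphM -!mulrA; case/andP: tp => -> _ /=.
by rewrite [y _ _ * _]mulrC.
Qed.

Lemma backward_equation x r : 0 <= x <= pi ->
  ym x r = y pi r * rc (cos (r * (pi - x))) - dy pi r * rc (sn (pi - x) r)
    + vol (fun t => pi - t) Q ym x r.
Proof.
move=> /andP[x0 xp]; rewrite /ym maskE ?x0//= mul1r.
have := lagrange iQ cintegrable0 (hy r) (sol_sn x r) x0 xp (lexx pi).
rewrite subrr mulr0 cos0 sn0 !rmorphN rmorph1 rmorph0 mulr0 subr0 mulrN1.
have -> : cos (r * (x - pi)) = cos (r * (pi - x)) by rewrite -(opprB pi x) mulrN cosN.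
have -> : sn (x - pi) r = - sn (pi - x) r by rewrite -(opprB pi x) snN.
rewrite rmorphN.
set I := cint _; set J := vol _ _ _ _ _ => h.
have -> : J = - I; last by rewrite -h; ring.
rewrite -cintN; last first.
  apply: (@cintegrable_bM _ _ _ 1); last exact: cintegrable_lagrange (hy r) (sol_sn x r).
    apply: cmeas_real; apply: measurable_natr_bool.
    by apply: measurable_and; apply: measurable_fun_ltr.
  by move=> t; rewrite cmod_real; case: (_ < _ < _); rewrite ?normr1 ?normr0.
apply: eq_cint => t; rewrite subr0 [X in _ = - X]mulrCA -mulrN; apply: QM => tp.
rewrite /= !maskE ?edge_in// !mul1r rmorphM ltrD2l ltrN2.
have -> : pi - x - (pi - t) = - (x - t) by ring.
rewrite snN rmorphN -!mulrA; case/andP: tp => _ ->; rewrite andbT.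
by ring.
Qed.

(** Lagrange identity against cos(r (pi - t)), whose value at pi is 1 and whose derivative there is
    0, so that y'(pi) is isolated. *)
Lemma derivative_equation r : dy pi r =
  dy 0 r * rc (cos (r * pi)) - y 0 r * rc (r ^+ 2 * sn pi r)
  + cint (fun t => Q t * (rc (cos (r * (pi - t))) * ym t r)).
Proof.
have := lagrange iQ cintegrable0 (hy r) (sol_cos pi r) (lexx 0) (pi_ge0 R) (lexx pi).
rewrite subrr mulr0 cos0 sn0 subr0 mulr0 rmorph1 rmorph0 mulr0 mulr1 sub0r opprK.
set I := cint _; set J := cint _ => h; have -> : J = I; last by rewrite -h; ring.
apply: eq_cint => t; rewrite subr0 [RHS]mulrCA; apply: QM => tp.
by rewrite /ym tp mul1r !maskE ?edge_in// !mul1r mulrC.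
Qed.

Section Class.
Variables (d : R -> R) (a M0 : R) (y0 : R -> R -> R[i]).
Hypotheses (md : measurable_fun setT d) (d0p : forall x, 0 <= x <= pi -> 0 <= d x <= pi).
Hypothesis dd : forall x t, `|d x - d t| = `|x - t|.
Hypothesis my0 : jmeas y0.
Hypothesis sy0 : forall x, 0 <= x <= pi -> spec (a - d x) M0 (y0 x).
Hypothesis eqy : forall x r, 0 <= x <= pi -> ym x r = y0 x r + vol d Q ym x r.

Let k0 : 0 <= 4 * pi ^+ 3 * b.
Proof. by rewrite !mulr_ge0 ?exprn_ge0 ?pi_ge0// ltW. Qed.

Let W (x : R) (_ : 0 <= x <= pi) := vker_weight b0 md dd sQ Q0 Qb x.

Let yout x r : ~~ (0 <= x <= pi) -> ym x r = 0.
Proof. by move=> xp; rewrite /ym mask0// mul0r. Qed.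

Let my r : cmeas (ym^~ r). Proof. by have [+ _ _ _] := hy r; exact: ac_cmeas. Qed.

Let yb r : exists B, forall x, cmod (ym x r) <= B.
Proof. by have [+ _ _ _] := hy r; exact: ac_mask_bounded. Qed.

Let gE : 4 * M0 * expR (4 * pi ^+ 3 * b * pi) = growth * M0.
Proof. by rewrite /growth mulrAC. Qed.

Lemma solution_jmeas : jmeas (fun x r => mask x * y x r).
Proof. exact: (volterra_jmeas md d0p iQ Q0 k0 W my0 sy0 eqy yout my yb). Qed.

Lemma solution_spec x : 0 <= x <= pi -> spec (a - d x) (growth * M0) (y x).
Proof.
move=> xp; have := volterra_spec md d0p iQ Q0 k0 W my0 sy0 eqy yout my yb xp.
by rewrite gE; apply: eq_spec => r; rewrite /ym maskE// mul1r.
Qed.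

Lemma solution_jap x r : 0 <= x <= pi -> cmod (y x r - y0 x r) <= growth * M0 * jap r.
Proof.
move=> xp; have := volterra_jap md d0p iQ Q0 k0 W my0 sy0 eqy my yb r xp.
by rewrite gE /ym maskE// mul1r.
Qed.

End Class.
End Family.
End IntegralEquations.

(** * Bounds on S, S', C, C' uniform over a ball of potentials *)

Section Edge.
Variable R : realType.
Local Notation mu := (@lebesgue_measure R).
Local Notation rc := (real_complex R).

(** One constant dominating every bound listed in [edge_const_bounds]; pi + b majorizes the L1 norm
    of the potential. *)
Definition edge_const (b : R) : R := 1 + growth b * ((1 + pi) * (1 + (pi + b))).

(* Potential on one edge (extended by 0) with S, S', C, C' as functions of x and of rho,
   where lambda = rho ^+ 2. *)
Record edge_data (b : R) (Q : R -> R[i]) (S dS C dC : R -> R -> R[i]) : Prop := EdgeData {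
  ed_sqint : sqint Q;
  ed_supp : forall t, ~~ (0 < t < pi) -> Q t = 0;
  ed_le : sqnorm Q <= b;
  ed_solS : forall r, sol Q r (S^~ r) (dS^~ r);
  ed_solC : forall r, sol Q r (C^~ r) (dC^~ r);
  ed_S0 : forall r, S 0 r = 0;
  ed_dS0 : forall r, dS 0 r = 1;
  ed_C0 : forall r, C 0 r = 1;
  ed_dC0 : forall r, dC 0 r = 0 }.

Lemma solZ (Q : R -> R[i]) r y dy a : sol Q r y dy -> sol Q r (fun x => a * y x) (fun x => a * dy x).
Proof.
move=> h; have := sol_lin a 0 h h.
by under eq_fun do rewrite mul0r subr0; under [X in sol _ _ _ X]eq_fun do rewrite mul0r subr0.
Qed.

Lemma Rintegral_cmod_le (Q : R -> R[i]) b : sqint Q -> (forall t, ~~ (0 < t < pi) -> Q t = 0) ->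
  sqnorm Q <= b -> \int[mu]_x cmod (Q x) <= pi + b.
Proof.
move=> sQ Q0 Qb; have iQ := sqint_supp_cintegrable sQ Q0; have [mQ i2] := sQ.
have ii := rintegrable_indic_itv (pi : R).
apply: le_trans (_ : \int[mu]_x (\1_`]0, pi[ x + cmod (Q x) ^+ 2) <= _).
  apply: le_Rintegral => //; [exact: rintegrable_cmod|exact: rintegrableD|].
  move=> x _; rewrite indic_itvE; have [xp|/Q0 ->] := boolP (0 < x < pi).
    by have := sqr_ge0 (cmod (Q x) - 2^-1); rewrite /=; nra.
  by rewrite cmod0 expr0n addr0.
rewrite (RintegralD measurableT ii i2) Rintegral_indic_itv ?pi_ge0//.
by rewrite lerD2l.
Qed.

Lemma edge_const_bounds (G p L : R) : 0 <= G -> 0 <= p -> 0 <= L ->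
  [/\ G <= 1 + G * ((1 + p) * (1 + L)), G * p <= 1 + G * ((1 + p) * (1 + L)),
      1 + L * (G * p) <= 1 + G * ((1 + p) * (1 + L)),
      L * (G * p + G) <= 1 + G * ((1 + p) * (1 + L)) & L * G <= 1 + G * ((1 + p) * (1 + L))].
Proof.
move=> G0 p0 L0; have h1 := mulr_ge0 G0 p0; have h2 := mulr_ge0 G0 L0.
have h3 := mulr_ge0 h1 L0.
by split; nra.
Qed.

Lemma jmeas_sinr : jmeas (fun x r => rc (sin (r * x))).
Proof.
apply: cmeas_real; apply: (measurableT_comp (continuous_measurable_fun (@continuous_sin R))).
by apply: measurable_funM; [exact: measurable_snd|exact: measurable_fst].
Qed.

Lemma jmeas_cosr : jmeas (fun x r => rc (cos (r * x))).
Proof.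
apply: cmeas_real; apply: (measurableT_comp (continuous_measurable_fun (@continuous_cos R))).
by apply: measurable_funM; [exact: measurable_snd|exact: measurable_fst].
Qed.

Lemma jmeas_sn : jmeas (fun x r => rc (sn x r)).
Proof. by apply: cmeas_real; apply: measurable_sn; [exact: measurable_fst|exact: measurable_snd]. Qed.

Lemma jmeas_pi (E : R -> R -> R[i]) : jmeas E -> jmeas (fun x r => E (pi - x) r).
Proof.
move=> mE; apply: (@cmeas_comp _ _ _ _ _ (fun p : R * R => (pi - p.1, p.2)) (fun p => E p.1 p.2)) => //.
apply: measurable_fun_pair => //; apply: measurable_funB => //; exact: measurable_cst.
Qed.

Section Bounds.
Variables (b : R) (Q : R -> R[i]) (S dS C dC : R -> R -> R[i]).
Hypotheses (b0 : 0 < b) (ed : edge_data b Q S dS C dC).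

Let sQ := ed_sqint ed.
Let Q0 := ed_supp ed.
Let Qb := ed_le ed.
Let K := edge_const b.
Let G := growth b.
Let L := pi + b.

Let L0 : 0 <= L. Proof. by rewrite addr_ge0 ?pi_ge0// ltW. Qed.
Let KB := edge_const_bounds (growth_ge0 b) (pi_ge0 R) L0.

Let id0 (x : R) : 0 <= x <= pi -> 0 <= id x <= pi. Proof. by []. Qed.
Let mid : measurable_fun setT (@id R). Proof. exact: measurable_id. Qed.
Let did (x t : R) : `|id x - id t| = `|x - t|. Proof. by []. Qed.

Let absx (x : R) : 0 <= x <= pi -> - `|x| = 0 - x.
Proof. by move=> /andP[x0 _]; rewrite ger0_norm// sub0r. Qed.

Let absp (x : R) : 0 <= x <= pi -> `|x| <= pi.
Proof. by move=> /andP[x0 xp]; rewrite ger0_norm. Qed.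

Let sy_rS x : 0 <= x <= pi -> spec (0 - id x) 1 (fun r => rc (sin (r * x))).
Proof. by move=> xp; have := spec_sinr x; rewrite absx. Qed.

Let sol_rS r := solZ (rc r) (ed_solS ed r).

Let eq_rS x r : 0 <= x <= pi -> mask x * (rc r * S x r) =
  rc (sin (r * x)) + vol id Q (fun x r => mask x * (rc r * S x r)) x r.
Proof.
move=> xp; have := forward_equation sQ Q0 (y := fun x r => rc r * S x r) sol_rS r xp.
move=> ->; rewrite (ed_S0 ed) (ed_dS0 ed) mulr0 mul0r add0r mulr1 -rmorphM sn_mul//.
Qed.

Lemma rS_jmeas : jmeas (fun x r => mask x * (rc r * S x r)).
Proof. exact: (solution_jmeas b0 sQ Q0 Qb sol_rS mid id0 did jmeas_sinr sy_rS eq_rS). Qed.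

Lemma rS_spec x : 0 <= x <= pi -> spec (- x) K (fun r => rc r * S x r).
Proof.
move=> xp; have := solution_spec b0 sQ Q0 Qb sol_rS mid id0 did jmeas_sinr sy_rS eq_rS xp.
by rewrite mulr1 sub0r; apply: spec_le => //; have [] := KB.
Qed.

Lemma rS_jap x r : 0 <= x <= pi -> cmod (rc r * S x r - rc (sin (r * x))) <= K * jap r.
Proof.
move=> xp; have := solution_jap b0 sQ Q0 Qb sol_rS mid id0 did jmeas_sinr sy_rS eq_rS r xp.
by rewrite mulr1 => h; apply: le_trans h _; apply: ler_wpM2r; [exact: jap_ge0|have [] := KB].
Qed.

Let sy_S x : 0 <= x <= pi -> spec (0 - id x) pi (fun r => rc (sn x r)).
Proof.
by move=> xp; apply: spec_le (spec_sn x); [rewrite absx|exact: absp].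
Qed.

Let eq_S x r : 0 <= x <= pi -> mask x * S x r =
  rc (sn x r) + vol id Q (fun x r => mask x * S x r) x r.
Proof.
move=> xp; have -> := forward_equation sQ Q0 (ed_solS ed) r xp.
by rewrite (ed_S0 ed) (ed_dS0 ed) mul0r add0r mul1r.
Qed.

Lemma S_jmeas : jmeas (fun x r => mask x * S x r).
Proof. exact: (solution_jmeas b0 sQ Q0 Qb (ed_solS ed) mid id0 did jmeas_sn sy_S eq_S). Qed.

Let S_spec' x : 0 <= x <= pi -> spec (0 - id x) (G * pi) (S x).
Proof. exact: (solution_spec b0 sQ Q0 Qb (ed_solS ed) mid id0 did jmeas_sn sy_S eq_S). Qed.

Lemma S_spec x : 0 <= x <= pi -> spec (- x) K (S x).
Proof. by move=> /S_spec'; rewrite sub0r; apply: spec_le => //; have [] := KB. Qed.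

(** The bounds on S and on r S are combined by [le_jap]; this decay of S is what makes the
    correction to S'(pi) an O(1/r) term. *)
Let S_jap x r : 0 <= x <= pi -> cmod (S x r) <= (G * pi + G) * jap r.
Proof.
move=> xp; apply: le_jap; [exact: cmod_ge0|exact: (spec_bound (S_spec' xp) r)|].
have := solution_spec b0 sQ Q0 Qb sol_rS mid id0 did jmeas_sinr sy_rS eq_rS xp.
by rewrite mulr1 => /spec_bound/(_ r); rewrite cmodM cmod_real.
Qed.

Let sy_C x : 0 <= x <= pi -> spec (0 - id x) 1 (fun r => rc (cos (r * x))).
Proof. by move=> xp; have := spec_cosr x; rewrite absx. Qed.

Let eq_C x r : 0 <= x <= pi -> mask x * C x r =
  rc (cos (r * x)) + vol id Q (fun x r => mask x * C x r) x r.
Proof.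
move=> xp; have -> := forward_equation sQ Q0 (ed_solC ed) r xp.
by rewrite (ed_C0 ed) (ed_dC0 ed) mul0r addr0 mul1r.
Qed.

Let C_jmeas : jmeas (fun x r => mask x * C x r).
Proof. exact: (solution_jmeas b0 sQ Q0 Qb (ed_solC ed) mid id0 did jmeas_cosr sy_C eq_C). Qed.

Let C_spec' x : 0 <= x <= pi -> spec (0 - id x) G (C x).
Proof.
move=> xp; have := solution_spec b0 sQ Q0 Qb (ed_solC ed) mid id0 did jmeas_cosr sy_C eq_C xp.
by rewrite mulr1.
Qed.

Lemma C_spec x : 0 <= x <= pi -> spec (- x) K (C x).
Proof. by move=> /C_spec'; rewrite sub0r; apply: spec_le => //; have [] := KB. Qed.

Lemma C_jap x r : 0 <= x <= pi -> cmod (C x r - rc (cos (r * x))) <= K * jap r.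
Proof.
move=> xp; have := solution_jap b0 sQ Q0 Qb (ed_solC ed) mid id0 did jmeas_cosr sy_C eq_C r xp.
by rewrite mulr1 => h; apply: le_trans h _; apply: ler_wpM2r; [exact: jap_ge0|have [] := KB].
Qed.

Let iQ : cintegrable Q. Proof. exact: sqint_supp_cintegrable sQ Q0. Qed.

Let Qin t : Q t != 0 -> 0 < t < pi. Proof. by apply: contraNT => /Q0 ->. Qed.

Let edge_in (x : R) : 0 < x < pi -> 0 <= x <= pi.
Proof. by case/andP => /ltW -> /ltW ->. Qed.

Let pin : 0 <= (pi : R) <= pi. Proof. by rewrite pi_ge0 lexx. Qed.

Let iL : \int[mu]_x cmod (Q x) <= L. Proof. exact: Rintegral_cmod_le. Qed.

Lemma dS_spec : spec (- pi) K (dS pi).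
Proof.
have mE : jmeas (fun t r => rc (cos (r * (pi - t))) * (mask t * S t r)).
  by apply: jmeasM; [exact: (jmeas_pi jmeas_cosr)|exact: S_jmeas].
have sE t : Q t != 0 -> spec (- pi) (G * pi) (fun r => rc (cos (r * (pi - t))) * (mask t * S t r)).
  move=> /Qin tp; have t1 := edge_in tp; have := specM (spec_cosr (pi - t)) (S_spec' t1).
  have -> : - `|pi - t| + (0 - id t) = - pi.
    by case/andP: t1 => _ h; rewrite ger0_norm ?subr_ge0//=; ring.
  by rewrite mul1r; apply: eq_spec => r; rewrite maskE// mul1r.
have := specD (spec_le (_ : - pi <= - `|pi|) (lexx _) (spec_cosr pi)) (spec_cint iQ mE sE).
rewrite ger0_norm ?pi_ge0// => /(_ (lexx _)) h.
apply: eq_spec (spec_le (lexx _) _ h) => [r|].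
  rewrite (derivative_equation sQ Q0 (ed_solS ed)) (ed_S0 ed) (ed_dS0 ed).
  by rewrite mul1r mul0r subr0.
have [_ _ h3 _ _] := KB; apply: le_trans h3; rewrite lerD2l mulrC.
by apply: ler_wpM2r; rewrite ?mulr_ge0 ?growth_ge0 ?pi_ge0.
Qed.

Lemma dS_jap r : cmod (dS pi r - rc (cos (r * pi))) <= K * jap r.
Proof.
rewrite (derivative_equation sQ Q0 (ed_solS ed)) (ed_S0 ed) (ed_dS0 ed).
rewrite mul1r mul0r subr0 addrAC subrr add0r.
have GG : 0 <= (G * pi + G) * jap r.
  by rewrite mulr_ge0 ?jap_ge0// addr_ge0 ?mulr_ge0 ?growth_ge0 ?pi_ge0.
have mE := jmeas_secr r (jmeasM (jmeas_pi jmeas_cosr) S_jmeas).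
apply: le_trans (cmod_cint_mulb iQ mE (M := (G * pi + G) * jap r) _) _.
  move=> t /Qin tp; rewrite cmodM maskE ?edge_in// mul1r.
  by apply: le_trans (ler_pM (cmod_ge0 _) (cmod_ge0 _) (cmod_cos _) (S_jap r (edge_in tp))) _; rewrite mul1r.
apply: le_trans (ler_wpM2l GG iL) _; rewrite mulrC mulrA.
by apply: ler_wpM2r; [exact: jap_ge0|have [] := KB].
Qed.

Lemma dC_cmeas : cmeas (dC pi).
Proof.
have mE := cmeas_cint_param iQ (jmeasM (jmeas_pi jmeas_cosr) C_jmeas).
have m1 : cmeas (fun r : R => - rc (r ^+ 2 * sn pi r)).
  apply: cmeasN; apply: cmeas_real; apply: measurable_funM; first exact: measurable_funX.
  by apply: measurable_sn; [exact: measurable_cst|exact: measurable_id].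
apply: eq_cmeas (cmeasD m1 mE) => r.
rewrite (derivative_equation sQ Q0 (ed_solC ed)) (ed_C0 ed) (ed_dC0 ed).
by rewrite mul0r mul1r sub0r.
Qed.

(** C' grows like r, and only its difference with the free value - r sin(r pi) is bounded. *)
Lemma dC_le r : cmod (dC pi r + rc (r * sin (r * pi))) <= K.
Proof.
rewrite (derivative_equation sQ Q0 (ed_solC ed)) (ed_C0 ed) (ed_dC0 ed).
rewrite mul0r mul1r sub0r expr2 -mulrA sn_mul addrAC addNr add0r.
have mE := jmeas_secr r (jmeasM (jmeas_pi jmeas_cosr) C_jmeas).
apply: le_trans (cmod_cint_mulb iQ mE (M := G) _) _.
  move=> t /Qin tp; rewrite cmodM maskE ?edge_in// mul1r.
  have h := spec_bound (C_spec' (edge_in tp)) r.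
  by apply: le_trans (ler_pM (cmod_ge0 _) (cmod_ge0 _) (cmod_cos _) h) _; rewrite mul1r.
apply: le_trans (ler_wpM2l (growth_ge0 b) iL) _; rewrite mulrC.
by have [] := KB.
Qed.

Lemma edge_const_ge1 : 1 <= K.
Proof.
rewrite lerDl mulr_ge0 ?growth_ge0// mulr_ge0// addr_ge0 ?pi_ge0//.
Qed.

Lemma wronskian r : C pi r * dS pi r - dC pi r * S pi r = 1.
Proof.
have := lagrange iQ iQ (ed_solC ed r) (ed_solS ed r) (lexx 0) (pi_ge0 R) (lexx pi).
rewrite (_ : (fun x => _) = fun=> 0); last by apply/funext => x; rewrite subrr mul0r mulr0.
rewrite cint0 (ed_S0 ed) (ed_dS0 ed) (ed_C0 ed) (ed_dC0 ed) mulr0 mulr1 subr0.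
by move/eqP; rewrite subr_eq0 => /eqP.
Qed.

End Bounds.
End Edge.

(** * The star graph *)

Section GraphAlgebra.
Variables (F : comNzRingType) (N : nat) (o : 'I_N).
Implicit Types (S C D : 'I_N -> F) (j k : 'I_N).

Definition gP S j k : F := \prod_(l | (l != j) && (l != k)) S l.
(** [gX] and [gY] describe the rest of the graph as seen from edge k: Delta = S_k X + S_k' Y and
    Delta_k = C_k X + C_k' Y, where neither X nor Y involves edge k. *)
Definition gX S D C k : F := C o * gP S o k + \sum_(j | (j != o) && (j != k)) D j * gP S j k.
Definition gY S k : F := \prod_(l | l != k) S l.
Definition gDelta S D C : F := C o * \prod_(l | l != o) S l
  + \sum_(j | j != o) D j * \prod_(l | l != j) S l.
Definition gDeltaK S D C (B : 'I_N -> F) k : F := C k * gX S D C k + B k * gY S k.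

Lemma gYD1 S j k : j != k -> gY S k = S j * gP S j k.
Proof. by move=> jk; rewrite /gY (bigD1 j)//=; congr (_ * _); apply: eq_bigl => l; rewrite andbC. Qed.

Lemma gPC S j k : gP S j k = gP S k j.
Proof. by apply: eq_bigl => l; rewrite andbC. Qed.

Lemma gDeltaE S D C k : k != o -> gDelta S D C = S k * gX S D C k + D k * gY S k.
Proof.
move=> ko; rewrite /gDelta -/(gY S o) (gYD1 S ko) (bigD1 k)//= -/(gY S k) gPC /gX mulrDr.
rewrite mulr_sumr mulrCA -addrA; congr (_ + _); rewrite addrC; congr (_ + _).
apply: eq_bigr => j /andP[_ jk]; rewrite -/(gY S j) (gYD1 S (_ : k != j)) 1?eq_sym//.
by rewrite gPC mulrCA.
Qed.

(** The left-hand side is the boundary term at pi in the Lagrange identity of edge k; it splits into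
    boundary terms of the other edges, to which the identity can be applied in turn. *)
Lemma gCross S D C (St Dt Ct : 'I_N -> F) k : k != o ->
  gX S D C k * gY St k - gY S k * gX St Dt Ct k =
  gP S o k * gP St o k * (C o * St o - S o * Ct o)
  + \sum_(j | (j != o) && (j != k)) gP S j k * gP St j k * (D j * St j - S j * Dt j).
Proof.
move=> ko; rewrite /gX mulrDl mulrDr mulr_suml mulr_sumr opprD addrACA -sumrB.
congr (_ + _).
  by rewrite !(@gYD1 _ o k) 1?eq_sym//; ring.
by apply: eq_bigr => j /andP[_ jk]; rewrite !(gYD1 _ jk); ring.
Qed.

Lemma card_neq k : #|[pred l | l != k]| = N.-1.
Proof. by rewrite -[in RHS](card_ord N) -(cardC1 k); apply: eq_card. Qed.

Lemma card_neq2 j k : j != k -> #|[pred l | (l != j) && (l != k)]| = N.-2.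
Proof.
move=> jk; have := cardD1 j [pred l | l != k]; rewrite card_neq inE jk add1n => h.
by rewrite -[N.-2]/(N.-1.-1) h /=; apply: eq_card => l; rewrite !inE.
Qed.

Lemma prod_scale (P : pred 'I_N) z S : \prod_(l | P l) (z * S l) = z ^+ #|P| * \prod_(l | P l) S l.
Proof. by rewrite big_split prodr_const. Qed.

Lemma gP_scale z S j k : j != k -> gP (fun l => z * S l) j k = z ^+ N.-2 * gP S j k.
Proof. by move=> jk; rewrite /gP prod_scale card_neq2. Qed.

Lemma gY_scale z S k : gY (fun l => z * S l) k = z ^+ N.-1 * gY S k.
Proof. by rewrite /gY prod_scale card_neq. Qed.

Lemma gX_scale z S D C k : k != o ->
  gX (fun l => z * S l) D C k = z ^+ N.-2 * gX S D C k.
Proof.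
move=> ko; rewrite /gX gP_scale 1?eq_sym// mulrDr mulrCA mulr_sumr; congr (_ + _).
by apply: eq_bigr => j /andP[_ jk]; rewrite gP_scale// mulrCA.
Qed.

End GraphAlgebra.

(** * Fronts of sines and cosines, finite sums and products of fronts *)

Section FrontTools.
Variable R : realType.
Local Notation rc := (real_complex R).
Implicit Types (p d : R -> R).

(** The number i / 2, which is the coefficient of exp(- i t) in sin t. *)
Definition hi : R[i] := Complex 0 2^-1.

Lemma cmod_hi : cmod hi = 2^-1.
Proof. by rewrite /cmod /hi /= expr0n add0r sqrtr_sqr ger0_norm ?invr_ge0. Qed.

Lemma sin_cis (t : R) : rc (sin t) = hi * cis (- t) - hi * cis t.
Proof. by apply: complexP; rewrite /hi /cis /= cosN sinN; lra. Qed.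

Lemma cos_cis (t : R) : rc (cos t) = rc 2^-1 * cis (- t) + rc 2^-1 * cis t.
Proof. by apply: complexP; rewrite /cis /= cosN sinN; lra. Qed.

Lemma half_half : (2^-1 + 2^-1 : R) = 1. Proof. by lra. Qed.

Lemma front_sin (u : R -> R) : measurable_fun setT u -> (forall x, 0 < x < pi -> 0 <= u x) ->
  front (fun x => - u x) (fun x => 2 * u x) hi 1 (fun x r => rc (sin (r * u x))).
Proof.
move=> mu_ u0; apply: (@front_exact _ _ _ _ (- hi)).
- exact: measurableT_comp.
- by apply: measurable_funM => //; exact: measurable_cst.
- by move=> x /u0 ux; rewrite mulr_ge0.
- by rewrite cmodN cmod_hi half_half.
move=> x r; rewrite sin_cis [- hi * _]mulNr; congr (_ * cis _ - _ * cis _); ring.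
Qed.

Lemma front_cos (u : R -> R) : measurable_fun setT u -> (forall x, 0 < x < pi -> 0 <= u x) ->
  front (fun x => - u x) (fun x => 2 * u x) (rc 2^-1) 1 (fun x r => rc (cos (r * u x))).
Proof.
move=> mu_ u0; apply: (@front_exact _ _ _ _ (rc 2^-1)).
- exact: measurableT_comp.
- by apply: measurable_funM => //; exact: measurable_cst.
- by move=> x /u0 ux; rewrite mulr_ge0.
- by rewrite cmod_real ger0_norm ?invr_ge0// half_half.
move=> x r; rewrite cos_cis; congr (_ * cis _ + _ * cis _); ring.
Qed.

Lemma front_const_spec (p : R) d c M (E : R -> R[i]) :
  front (fun=> p) d c M (fun _ => E) -> spec p M E.
Proof.
have p0 := pi_gt0 R; move=> fE; apply: (front_spec (x := pi / 2) fE); apply/andP; split.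
  by rewrite divr_gt0.
by rewrite ltr_pdivrMr// ltr_pMr// ltr1n.
Qed.

Lemma front0 p d : front p d 0 0 (fun _ _ => 0).
Proof.
split; [exact: jmeas_cst|by rewrite cmod0|].
exists (fun _ _ => 0); split; first exact: jmeas_cst.
move=> x xp; split; [exact: spec0|exact: spec0|move=> r].
by rewrite !mul0r !subr0 cmod0.
Qed.

Lemma front_sum (I : finType) (P : pred I) p d c M (E : I -> R -> R -> R[i]) :
  (forall j, P j -> front p d c M (E j)) ->
  front p d (#|P|%:R * c) (#|P|%:R * M) (fun x r => \sum_(j | P j) E j x r).
Proof.
move=> h; rewrite cardE.
have -> : (fun x r => \sum_(j | P j) E j x r) =
    fun x r => \sum_(j <- (enum P)) E j x r.
  by apply/funext => x; apply/funext => r; rewrite big_enum.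
have : all P (enum P) by apply/allP => j; rewrite mem_enum.
elim: (enum P) => [_|j s IH /= /andP[Pj Ps]].
  rewrite /= !mul0r; apply: eq_front (front0 p d) => // x r.
  by rewrite big_nil.
rewrite -add1n !natrD !mulrDl !mul1r; apply: eq_front (frontD (h j Pj) (IH Ps)) => // x r.
by rewrite big_cons.
Qed.

Lemma front_prod (I : finType) (P : pred I) (q g : R) c M (E : I -> R -> R[i]) : 0 <= g ->
  (forall j, front (fun=> q) (fun=> g) c M (fun _ => E j)) ->
  front (fun=> #|P|%:R * q) (fun=> g) (c ^+ #|P|) ((3 * M) ^+ #|P|) (fun _ r => \prod_(j | P j) E j r).
Proof.
move=> g0 h; rewrite cardE.
have -> : (fun _ r => \prod_(j | P j) E j r) =
    fun (_ : R) r => \prod_(j <- (enum P)) E j r.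
  by apply/funext => x; apply/funext => r; rewrite big_enum.
elim: (enum P) => [|j s IH] /=.
  by rewrite !expr0; apply: eq_front (front1 (fun=> g)) => // [x|x r]; rewrite ?mul0r ?big_nil.
have hg (x : R) : 0 < x < pi -> [/\ 0 <= g, g <= g & g <= g] by [].
have m1 (u : R) : measurable_fun setT (fun _ : R => u) by exact: measurable_cst.
have := frontM (m1 _) (m1 _) hg (h j) IH.
rewrite !exprS -mulrA; apply: eq_front => // [x|x r]; last by rewrite big_cons.
by rewrite -[in RHS]add1n natrD mulrDl mul1r.
Qed.

End FrontTools.

(** * The solutions psi_k and chi, and their fronts *)

Section Graph.
Variable R : realType.
Local Notation mu := (@lebesgue_measure R).
Local Notation rc := (real_complex R).
Variables (N : nat) (o : 'I_N) (b : R).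
Hypotheses (hN : (2 <= N)%N) (b0 : 0 < b).

(** Each factor r S_l(pi) is a front of constant 3 * [edge_const], and each multiplication of fronts
    costs another 3. *)
Definition prod_const : R := (9 * edge_const b) ^+ N.
Definition sum_const : R := N%:R * (9 * edge_const b * prod_const).
Definition psi0_const : R := prod_const + sum_const.
Definition psi_const : R := 3 * psi0_const + growth b * psi0_const + growth b * psi0_const.
(** The product Y cos contributes (i/2)^(N-1) / 2, and X sin contributes N - 1 times the same
    quantity, one for each of the N - 1 terms of X. *)
Definition psi_lead : R[i] := rc (N%:R * 2^-1) * hi R ^+ N.-1.

Let K := edge_const b.
Let T := prod_const.

Let K1 : 1 <= K. Proof. exact: edge_const_ge1. Qed.
Let K0 : 0 <= K. Proof. exact: le_trans ler01 K1. Qed.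
Let K9 : 1 <= 9 * K.
Proof. by apply: le_trans K1 _; rewrite ler_peMl// ler1n. Qed.

Let T0 : 0 <= T. Proof. by rewrite exprn_ge0// (le_trans ler01). Qed.

Lemma psi_lead_neq0 : psi_lead != 0.
Proof.
rewrite mulf_neq0 ?expf_neq0//.
  rewrite eq_complex /= eqxx andbT mulf_neq0 ?invr_eq0 ?pnatr_eq0//.
  by case: N hN.
by rewrite eq_complex /= eqxx /= invr_eq0 pnatr_eq0.
Qed.

Variables (Q : 'I_N -> R -> R[i]) (S dS C dC : 'I_N -> R -> R -> R[i]).
Hypothesis ed : forall j, edge_data b (Q j) (S j) (dS j) (C j) (dC j).

(** Multiplication by r compensates the 1/r decay of S_l(pi); the leading part becomes sin(r pi), so
    that all products keep a nonzero leading coefficient. *)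
Definition sp l r : R[i] := rc r * S l pi r.
Definition Ps j k r : R[i] := gP (sp^~ r) j k.
Definition Ys k r : R[i] := gY (sp^~ r) k.
Definition Xs k r : R[i] := gX o (sp^~ r) (fun j => dS j pi r) (fun j => C j pi r) k.
Definition Dl r : R[i] := gDelta o (fun j => S j pi r) (fun j => dS j pi r) (fun j => C j pi r).
Definition Dk k r : R[i] := gDeltaK o (fun j => S j pi r) (fun j => dS j pi r)
  (fun j => C j pi r) (fun j => dC j pi r) k.

Let pin : 0 <= (pi : R) <= pi. Proof. by rewrite pi_ge0 lexx. Qed.
Let mcst (u : R) : measurable_fun setT (fun _ : R => u). Proof. exact: measurable_cst. Qed.
Let p20 : 0 <= 2 * pi :> R. Proof. by rewrite mulr_ge0 ?pi_ge0. Qed.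
Let K3 : 1 + K + K <= 3 * K.
Proof. by rewrite (_ : 3 * K = K + K + K); [rewrite !lerD2r|ring]. Qed.

Let front_sp l : front (fun=> - pi) (fun=> 2 * pi) (hi R) (3 * K) (fun _ => sp l).
Proof.
have s := rS_spec b0 (ed l) pin.
apply: front_le K3 _; apply: front_perturb (front_sin (mcst pi) _) => //.
- exact: (jmeas2 (spec_meas s)).
- by move=> x r _; exact: (rS_jap b0 (ed l) r pin).
- by move=> x _; exact: pi_ge0.
Qed.

Let front_C l : front (fun=> - pi) (fun=> 2 * pi) (rc 2^-1) (3 * K) (fun _ => C l pi).
Proof.
have s := C_spec b0 (ed l) pin.
apply: front_le K3 _; apply: front_perturb (front_cos (mcst pi) _) => //.
- exact: (jmeas2 (spec_meas s)).
- by move=> x r _; exact: (C_jap b0 (ed l) r pin).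
- by move=> x _; exact: pi_ge0.
Qed.

Let front_dS l : front (fun=> - pi) (fun=> 2 * pi) (rc 2^-1) (3 * K) (fun _ => dS l pi).
Proof.
have s := dS_spec b0 (ed l).
apply: front_le K3 _; apply: front_perturb (front_cos (mcst pi) _) => //.
- exact: (jmeas2 (spec_meas s)).
- by move=> x r _; exact: (dS_jap b0 (ed l) r).
- by move=> x _; exact: pi_ge0.
Qed.

Let powT n : (n <= N)%N -> (3 * (3 * K)) ^+ n <= T.
Proof.
move=> nN; have -> : 3 * (3 * K) = 9 * K by rewrite mulrA -natrM.
exact: ler_weXn2l.
Qed.

Lemma front_Ps j k : j != k ->
  front (fun=> N.-2%:R * - pi) (fun=> 2 * pi) (hi R ^+ N.-2) T (fun _ => Ps j k).
Proof.
move=> jk; have := front_prod [pred l | (l != j) && (l != k)] p20 front_sp.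
rewrite card_neq2// => h; apply: front_le h; apply: powT.
by case: N => // -[//|n]; rewrite leqW.
Qed.

Let front_Ys k : front (fun=> N.-1%:R * - pi) (fun=> 2 * pi) (hi R ^+ N.-1) T (fun _ => Ys k).
Proof.
have := front_prod [pred l | l != k] p20 front_sp.
by rewrite card_neq => h; apply: front_le h; apply: powT; exact: leq_pred.
Qed.

Let N21 : N.-1 = N.-2.+1. Proof. by case: N hN => // -[]. Qed.

Let front_term k j E : j != k -> front (fun=> - pi) (fun=> 2 * pi) (rc 2^-1) (3 * K) (fun _ => E) ->
  front (fun=> N.-1%:R * - pi) (fun=> 2 * pi) (rc 2^-1 * hi R ^+ N.-2) (9 * K * T)
    (fun _ r => E r * Ps j k r).
Proof.
move=> jk fE; have hg (x : R) : 0 < x < pi -> [/\ 0 <= 2 * pi :> R, 2 * pi <= 2 * pi :> R & 2 * pi <= 2 * pi :> R] by [].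
have := frontM (mcst _) (mcst _) hg fE (front_Ps jk).
rewrite (_ : 3 * (3 * K * T) = 9 * K * T); last by rewrite !mulrA -natrM.
by apply: eq_front => // x; rewrite N21 -[in RHS]add1n natrD mulrDl mul1r.
Qed.

Let front_Xs k : k != o -> front (fun=> N.-1%:R * - pi) (fun=> 2 * pi)
  (N.-1%:R * (rc 2^-1 * hi R ^+ N.-2)) sum_const (fun _ => Xs k).
Proof.
move=> ko; have ok : o != k by rewrite eq_sym.
have f2 := front_sum (P := [pred j | (j != o) && (j != k)])
  (fun j => fun Pj => front_term (proj2 (andP Pj)) (front_dS j)).
have := frontD (front_term ok (front_C o)) f2.
rewrite card_neq2// => h.
have h1 : 9 * K * T + N.-2%:R * (9 * K * T) <= sum_const.
  rewrite -[X in X + _]mul1r -mulrDl; apply: ler_wpM2r; first by rewrite !mulr_ge0.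
  by rewrite nat1r ler_nat -N21 leq_pred.
apply: front_le h1 _; apply: eq_front h => //.
by rewrite [in RHS]N21 -[in RHS]add1n natrD mulrDl mul1r.
Qed.

Lemma Ps_spec j k : j != k -> spec (N.-2%:R * - pi) T (Ps j k).
Proof. by move=> /front_Ps/front_const_spec. Qed.

Let Ys_spec k : spec (N.-1%:R * - pi) T (Ys k).
Proof. exact: (front_const_spec (front_Ys k)). Qed.

Let Xs_spec k : k != o -> spec (N.-1%:R * - pi) sum_const (Xs k).
Proof. by move=> /front_Xs/front_const_spec. Qed.

(** By the Wronskian identity, Cauchy data r^(N-1) (Delta, - Delta_k) at 0 become (Ys, - r Xs) at
    pi, where edge k no longer enters. The solution is therefore studied through the backward
    equation. *)
Definition psi k x r : R[i] := rc r ^+ N.-1 * Dl r * C k x r - rc r ^+ N.-1 * Dk k r * S k x r.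
Definition dpsi k x r : R[i] := rc r ^+ N.-1 * Dl r * dC k x r - rc r ^+ N.-1 * Dk k r * dS k x r.

Lemma sol_psi k r : sol (Q k) r ((psi k)^~ r) ((dpsi k)^~ r).
Proof. exact: sol_lin (ed_solC (ed k) r) (ed_solS (ed k) r). Qed.

Lemma psi_pi k r : k != o -> psi k pi r = Ys k r.
Proof.
move=> ko; rewrite /psi /Ys gY_scale /Dl (gDeltaE _ _ _ ko) /Dk /gDeltaK -!mulrA -mulrBr.
by congr (_ * _); rewrite -[RHS]mulr1 -(wronskian (ed k) r); ring.
Qed.

Lemma dpsi_pi k r : k != o -> dpsi k pi r = - (rc r * Xs k r).
Proof.
move=> ko; rewrite /dpsi /Xs gX_scale// /Dl (gDeltaE _ _ _ ko) /Dk /gDeltaK -!mulrA -mulrBr.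
rewrite [in RHS]mulrA -exprS -N21 -[RHS]mulrN; congr (_ * _).
by rewrite -[RHS]mulr1 -(wronskian (ed k) r); ring.
Qed.

Lemma psi_0 k r : psi k 0 r = rc r ^+ N.-1 * Dl r.
Proof. by rewrite /psi (ed_C0 (ed k)) (ed_S0 (ed k)) mulr1 mulr0 subr0. Qed.

Lemma dpsi_0 k r : dpsi k 0 r = - (rc r ^+ N.-1 * Dk k r).
Proof. by rewrite /dpsi (ed_dC0 (ed k)) (ed_dS0 (ed k)) mulr1 mulr0 sub0r. Qed.

Let d := fun x : R => pi - x.
Let md : measurable_fun setT d.
Proof. by apply: measurable_funB => //; exact: measurable_cst. Qed.
Let d0p x : 0 <= x <= pi -> 0 <= d x <= pi.
Proof. by move=> /andP[x0 xp]; rewrite /d subr_ge0 xp lerBlDr lerDl. Qed.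
Let dd x t : `|d x - d t| = `|x - t|.
Proof. by rewrite /d (_ : pi - x - (pi - t) = - (x - t)) ?normrN//; ring. Qed.

Definition psi0 k x r : R[i] := Ys k r * rc (cos (r * (pi - x))) + Xs k r * rc (sin (r * (pi - x))).

Let psi0_const0 : 0 <= psi0_const.
Proof. by rewrite addr_ge0// mulr_ge0// !mulr_ge0. Qed.

Section PsiClass.
Variable k : 'I_N.
Hypothesis ko : k != o.

Let psi0_jmeas : jmeas (psi0 k).
Proof.
apply: jmeasD; apply: jmeasM.
- exact: (jmeas2 (spec_meas (Ys_spec k))).
- exact: (jmeas_pi (@jmeas_cosr R)).
- exact: (jmeas2 (spec_meas (Xs_spec ko))).
- exact: (jmeas_pi (@jmeas_sinr R)).
Qed.

Let psi0_spec x : 0 <= x <= pi -> spec (N.-1%:R * - pi - d x) psi0_const (psi0 k x).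
Proof.
move=> xp; have /andP[d0 _] := d0p xp.
have := specD (specM (Ys_spec k) (spec_cosr (d x))) (specM (Xs_spec ko) (spec_sinr (d x))).
by rewrite (ger0_norm d0) !mulr1.
Qed.

Let psi_eq x r : 0 <= x <= pi ->
  mask x * psi k x r = psi0 k x r + vol d (Q k) (fun x r => mask x * psi k x r) x r.
Proof.
move=> xp; rewrite (backward_equation (ed_sqint (ed k)) (ed_supp (ed k)) (sol_psi k) r xp).
rewrite psi_pi// dpsi_pi// mulNr opprK; congr (_ + _ + _).
by rewrite mulrAC -rmorphM sn_mul mulrC.
Qed.

Lemma psi_jmeas : jmeas (fun x r => mask x * psi k x r).
Proof.
exact: (solution_jmeas b0 (ed_sqint (ed k)) (ed_supp (ed k)) (ed_le (ed k)) (sol_psi k)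
  md d0p dd psi0_jmeas psi0_spec psi_eq).
Qed.

Lemma psi_spec x : 0 <= x <= pi -> spec (N.-1%:R * - pi - d x) (growth b * psi0_const) (psi k x).
Proof.
exact: (solution_spec b0 (ed_sqint (ed k)) (ed_supp (ed k)) (ed_le (ed k)) (sol_psi k)
  md d0p dd psi0_jmeas psi0_spec psi_eq).
Qed.

Lemma psi_jap x r : 0 <= x <= pi ->
  cmod (psi k x r - psi0 k x r) <= growth b * psi0_const * jap r.
Proof.
exact: (solution_jap b0 (ed_sqint (ed k)) (ed_supp (ed k)) (ed_le (ed k)) (sol_psi k)
  md d0p dd psi0_jmeas psi0_spec psi_eq).
Qed.

Let d0' x : 0 < x < pi -> 0 <= d x.
Proof. by move=> /andP[_ xp]; rewrite subr_ge0 ltW. Qed.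

Lemma psi_front : front (fun x => N.-1%:R * - pi - (pi - x)) (fun x => 2 * (pi - x)) psi_lead
  psi_const (fun x r => mask x * psi k x r).
Proof.
have hg (x : R) : 0 < x < pi -> [/\ 0 <= 2 * d x, 2 * d x <= 2 * pi & 2 * d x <= 2 * d x].
  move=> xp; have h := d0' xp; case/andP: xp => x0 xp; split => //; first by rewrite mulr_ge0.
  by rewrite ler_wpM2l// lerBlDr lerDl ltW.
have mNd : measurable_fun setT (fun x => - d x) by exact: measurableT_comp.
have f1 := frontM (mcst _) mNd hg (front_Ys k) (front_cos md d0').
have f2 := frontM (mcst _) mNd hg (front_Xs ko) (front_sin md d0').
have := frontD f1 f2; rewrite !mulr1 -mulrDr -/psi0_const => f3.
have G0 : 0 <= growth b * psi0_const by rewrite mulr_ge0 ?growth_ge0.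
have edge_in (x : R) : 0 < x < pi -> 0 <= x <= pi by case/andP => /ltW -> /ltW ->.
have := @front_perturb _ _ _ _ _ _ _ _ (fun x r => mask x * psi k x r) psi_jmeas _ _ G0 G0 f3.
move=> h; apply: eq_front (h _ _) => //.
- rewrite /psi_lead [in RHS]N21 [in LHS]N21 exprSr.
  have -> : rc (N%:R * 2^-1) = (1 + N.-2.+1%:R) * rc 2^-1.
    by rewrite rmorphM rmorph_nat nat1r -N21 prednK// ltnW.
  by rewrite N21 -natr1; ring.
- move=> x xp; apply: eq_spec (psi_spec (edge_in x xp)) => r.
  by rewrite maskE ?mul1r ?edge_in.
- by move=> x r xp; rewrite maskE ?mul1r ?edge_in//; exact: psi_jap (edge_in x xp).
Qed.

(** The free part [psi0] brought to the form required by [upper_estimate]: the phases exp(- i pi r)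
    and exp(i pi r) are absorbed into the coefficients. *)
Lemma psi_upper : exists A B : R -> R[i], [/\ cmeas A, cmeas B,
  (forall r, cmod (A r) <= psi_const), (forall r, cmod (B r) <= psi_const) &
  forall x r, 0 < x < pi ->
    cmod (mask x * psi k x r - (A r * cis (x * r) + B r * cis (- x * r))) <= psi_const * jap r].
Proof.
have G0 : 0 <= growth b * psi0_const by rewrite mulr_ge0 ?growth_ge0.
have mY := spec_meas (Ys_spec k); have mX := spec_meas (Xs_spec ko).
have c1 : psi0_const <= psi_const.
  by rewrite /psi_const -!addrA ler_wpDr// ?addr_ge0// ler_peMl// ler1n.
have c2 : growth b * psi0_const <= psi_const by rewrite /psi_const lerDr addr_ge0// mulr_ge0.
have bYX r : cmod (rc 2^-1 * Ys k r) + cmod (hi R * Xs k r) <= psi0_const.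
  rewrite !cmodM cmod_hi cmod_real ger0_norm ?invr_ge0//.
  have h1 := spec_bound (Ys_spec k) r; have h2 := spec_bound (Xs_spec ko) r.
  have h01 := cmod_ge0 (Ys k r); have h02 := cmod_ge0 (Xs k r).
  apply: lerD; [apply: le_trans h1|apply: le_trans h2]; by rewrite ler_piMl// invf_le1// ler1n.
exists (fun r => (rc 2^-1 * Ys k r + hi R * Xs k r) * cis (- pi * r)).
exists (fun r => (rc 2^-1 * Ys k r - hi R * Xs k r) * cis (pi * r)); split.
- apply: cmeasM; last exact: cmeas_cisl.
  by apply: cmeasD; apply: cmeasM => //; exact: cmeas_cst.
- apply: cmeasM; last exact: cmeas_cisl.
  by apply: cmeasB; apply: cmeasM => //; exact: cmeas_cst.
- by move=> r; rewrite cmodM cmod_cis mulr1; apply: le_trans (cmodD _ _) (le_trans (bYX r) c1).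
- by move=> r; rewrite cmodM cmod_cis mulr1; apply: le_trans (cmodB _ _) (le_trans (bYX r) c1).
move=> x r /andP[/ltW x0 /ltW xp]; have xx : 0 <= x <= pi by rewrite x0.
rewrite maskE// mul1r.
have -> : (rc 2^-1 * Ys k r + hi R * Xs k r) * cis (- pi * r) * cis (x * r) +
   (rc 2^-1 * Ys k r - hi R * Xs k r) * cis (pi * r) * cis (- x * r) = psi0 k x r.
  rewrite /psi0 cos_cis sin_cis -![_ * cis _ * cis _]mulrA -!cisD.
  have -> : - pi * r + x * r = - (r * (pi - x)) by ring.
  have -> : pi * r + - x * r = r * (pi - x) by ring.
  by ring.
apply: le_trans (psi_jap r xx) _; apply: ler_wpM2r c2; exact: jap_ge0.
Qed.

End PsiClass.

(** Normalized by chi(pi) = 0 and chi'(pi) = - r, so that its free part is sin(r (pi - x)). *)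
Definition chi x r : R[i] := sp o r * C o x r - rc r * C o pi r * S o x r.
Definition dchi x r : R[i] := sp o r * dC o x r - rc r * C o pi r * dS o x r.

Lemma sol_chi r : sol (Q o) r (chi^~ r) (dchi^~ r).
Proof. exact: sol_lin (ed_solC (ed o) r) (ed_solS (ed o) r). Qed.

Lemma chi_pi r : chi pi r = 0. Proof. by rewrite /chi /sp; ring. Qed.

Lemma dchi_pi r : dchi pi r = - rc r.
Proof. by rewrite /dchi /sp -[RHS]mulr1 -(wronskian (ed o) r); ring. Qed.

Lemma chi_0 r : chi 0 r = sp o r.
Proof. by rewrite /chi (ed_C0 (ed o)) (ed_S0 (ed o)) mulr1 mulr0 subr0. Qed.

Lemma dchi_0 r : dchi 0 r = - (rc r * C o pi r).
Proof. by rewrite /dchi (ed_dC0 (ed o)) (ed_dS0 (ed o)) mulr1 mulr0 sub0r. Qed.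

Section ChiClass.

Let chi0 (x r : R) : R[i] := rc (sin (r * (pi - x))).

Let chi0_jmeas : jmeas chi0. Proof. exact: (jmeas_pi (@jmeas_sinr R)). Qed.

Let chi0_spec x : 0 <= x <= pi -> spec (0 - d x) 1 (chi0 x).
Proof. by move=> /d0p/andP[h _]; have := spec_sinr (d x); rewrite ger0_norm// sub0r. Qed.

Let chi_eq x r : 0 <= x <= pi ->
  mask x * chi x r = chi0 x r + vol d (Q o) (fun x r => mask x * chi x r) x r.
Proof.
move=> xp; rewrite (backward_equation (ed_sqint (ed o)) (ed_supp (ed o)) sol_chi r xp).
by rewrite chi_pi dchi_pi mul0r mulNr opprK add0r -rmorphM sn_mul.
Qed.

Lemma chi_jmeas : jmeas (fun x r => mask x * chi x r).
Proof.
exact: (solution_jmeas b0 (ed_sqint (ed o)) (ed_supp (ed o)) (ed_le (ed o)) sol_chi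
  md d0p dd chi0_jmeas chi0_spec chi_eq).
Qed.

Lemma chi_spec x : 0 <= x <= pi -> spec (0 - d x) (growth b) (chi x).
Proof.
move=> xp; have := solution_spec b0 (ed_sqint (ed o)) (ed_supp (ed o)) (ed_le (ed o)) sol_chi
  md d0p dd chi0_jmeas chi0_spec chi_eq xp.
by rewrite mulr1.
Qed.

Lemma chi_front : front (fun x => - (pi - x)) (fun x => 2 * (pi - x)) (hi R)
  (1 + growth b + growth b) (fun x r => mask x * chi x r).
Proof.
have edge_in (x : R) : 0 < x < pi -> 0 <= x <= pi by case/andP => /ltW -> /ltW ->.
have d0' x : 0 < x < pi -> 0 <= d x by move=> /andP[_ xp]; rewrite subr_ge0 ltW.
apply: front_perturb (front_sin md d0'); rewrite ?growth_ge0//; first exact: chi_jmeas.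
- move=> x xp; rewrite -[- d x]sub0r; apply: eq_spec (chi_spec (edge_in x xp)) => r.
  by rewrite maskE ?mul1r ?edge_in.
- move=> x r xp; rewrite maskE ?mul1r ?edge_in//.
  have := solution_jap b0 (ed_sqint (ed o)) (ed_supp (ed o)) (ed_le (ed o)) sol_chi
    md d0p dd chi0_jmeas chi0_spec chi_eq r (edge_in x xp).
  by rewrite mulr1.
Qed.

End ChiClass.

Definition delta_const : R := (K + K * K) * psi0_const.

Let sc0 : 0 <= sum_const. Proof. by rewrite mulr_ge0// !mulr_ge0. Qed.

Let scaled_Dl k r : k != o ->
  rc r ^+ N.-1 * Dl r = sp k r * Xs k r + dS k pi r * Ys k r.
Proof.
move=> ko; rewrite /Dl (gDeltaE _ _ _ ko) /Xs gX_scale// /Ys gY_scale /sp N21 exprS; ring.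
Qed.

Let scaled_Dk k r : k != o ->
  rc r ^+ N.-2 * Dk k r = C k pi r * Xs k r + dC k pi r * (S o pi r * Ps o k r).
Proof.
move=> ko; have ok : o != k by rewrite eq_sym.
rewrite /Dk /gDeltaK (gYD1 _ ok) /Xs gX_scale// /Ps gP_scale//; ring.
Qed.

Lemma Dl_le k r : k != o -> cmod (rc r ^+ N.-1 * Dl r) <= delta_const.
Proof.
move=> ko; rewrite (scaled_Dl _ ko).
have h1 := spec_bound (rS_spec b0 (ed k) pin) r; have h2 := spec_bound (Xs_spec ko) r.
have h3 := spec_bound (dS_spec b0 (ed k)) r; have h4 := spec_bound (Ys_spec k) r.
apply: le_trans (cmodD _ _) _.
apply: le_trans (_ : K * sum_const + K * T <= _).
  apply: lerD; first by rewrite (cmodM (sp k r)); apply: ler_pM => //; exact: cmod_ge0.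
  by rewrite cmodM; apply: ler_pM => //; exact: cmod_ge0.
rewrite -mulrDr [sum_const + _]addrC; apply: ler_wpM2r => //.
by rewrite lerDl mulr_ge0.
Qed.

Lemma Dk_le k r : k != o -> cmod (rc r ^+ N.-2 * Dk k r) <= delta_const.
Proof.
move=> ko; have ok : o != k by rewrite eq_sym.
rewrite (scaled_Dk _ ko).
have h1 := spec_bound (C_spec b0 (ed k) pin) r; have h2 := spec_bound (Xs_spec ko) r.
have h3 := spec_bound (rS_spec b0 (ed o) pin) r; have h4 := spec_bound (Ps_spec ok) r.
have h5 := spec_bound (S_spec b0 (ed o) pin) r; have h6 := dC_le b0 (ed k) r.
(* C_k' is of order r and S_o of order 1/r. Subtracting the growing part of C_k' leaves a bounded
   factor times S_o, and that part itself is a sine times r S_o, which is bounded too. *)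
have -> : dC k pi r * (S o pi r * Ps o k r) =
    ((dC k pi r + rc (r * sin (r * pi))) * S o pi r - rc (sin (r * pi)) * (rc r * S o pi r)) * Ps o k r.
  by rewrite rmorphM; ring.
have h7 : cmod ((dC k pi r + rc (r * sin (r * pi))) * S o pi r
    - rc (sin (r * pi)) * (rc r * S o pi r)) <= K * K + K.
  apply: le_trans (cmodB _ _) _; apply: lerD.
    by rewrite cmodM; apply: ler_pM; rewrite ?cmod_ge0.
  rewrite cmodM; apply: le_trans (_ : 1 * K <= _); last by rewrite mul1r.
  by apply: ler_pM; rewrite ?cmod_ge0// cmod_real ler_norml sin_geN1 sin_le1.
apply: le_trans (cmodD _ _) _.
apply: le_trans (_ : K * sum_const + (K * K + K) * T <= _).
  by apply: lerD; rewrite cmodM; apply: ler_pM => //; exact: cmod_ge0.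
rewrite [K * K + K]addrC /delta_const (_ : psi0_const = sum_const + T); last exact: addrC.
rewrite [leRHS]mulrDr lerD2r.
by apply: ler_wpM2r => //; rewrite lerDl mulr_ge0.
Qed.

Lemma Dl_cmeas k : k != o -> cmeas (fun r => rc r ^+ N.-1 * Dl r).
Proof.
move=> ko; have m1 : cmeas (fun r => sp k r * Xs k r + dS k pi r * Ys k r).
  apply: cmeasD; apply: cmeasM.
  - exact: spec_meas (rS_spec b0 (ed k) pin).
  - exact: spec_meas (Xs_spec ko).
  - exact: spec_meas (dS_spec b0 (ed k)).
  - exact: spec_meas (Ys_spec k).
by apply: eq_cmeas m1 => r; rewrite (scaled_Dl _ ko).
Qed.

Lemma Dk_cmeas k : k != o -> cmeas (fun r => rc r ^+ N.-2 * Dk k r).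
Proof.
move=> ko; have ok : o != k by rewrite eq_sym.
have m1 : cmeas (fun r => C k pi r * Xs k r + dC k pi r * (S o pi r * Ps o k r)).
  apply: cmeasD; apply: cmeasM.
  - exact: spec_meas (C_spec b0 (ed k) pin).
  - exact: spec_meas (Xs_spec ko).
  - exact: (dC_cmeas b0 (ed k)).
  apply: cmeasM; first exact: spec_meas (S_spec b0 (ed o) pin).
  exact: spec_meas (Ps_spec ok).
by apply: eq_cmeas m1 => r; rewrite (scaled_Dk _ ko).
Qed.

End Graph.

(** * Two potentials on the graph: the Lagrange identity and its consequences *)

Section Pair.
Variable R : realType.
Local Notation mu := (@lebesgue_measure R).
Local Notation rc := (real_complex R).

Definition pairing (f : R -> R[i]) (y z : R -> R -> R[i]) r : R[i] :=
  cint (fun x => f x * ((mask x * y x r) * (mask x * z x r))).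

Lemma spec_sum (I : finType) (P : pred I) a (E : I -> R -> R[i]) :
  (forall j, P j -> exists M, spec a M (E j)) -> exists M, spec a M (fun r => \sum_(j | P j) E j r).
Proof.
move=> h; have -> : (fun r => \sum_(j | P j) E j r) = fun r => \sum_(j <- enum P) E j r.
  by apply/funext => r; rewrite big_enum.
have : all P (enum P) by apply/allP => j; rewrite mem_enum.
elim: (enum P) => [_|j s IH /= /andP[/h[M hM] /IH[M' hM']]].
  by exists 0; apply: eq_spec (spec0 a) => r; rewrite big_nil.
by exists (M + M'); apply: eq_spec (specD hM hM') => r; rewrite big_cons.
Qed.

(** Adding one term to n others costs 2 c + 2 (4^n c), which is at most 4^(n+1) c. *)
Lemma sqint_sum (I : finType) (P : pred I) c (E : I -> R -> R[i]) : 0 <= c ->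
  (forall j, P j -> sqint (E j) /\ sqnorm (E j) <= c) ->
  sqint (fun r => \sum_(j | P j) E j r) /\
  sqnorm (fun r => \sum_(j | P j) E j r) <= 4 ^+ #|P| * c.
Proof.
move=> c0 h; rewrite cardE.
have -> : (fun r => \sum_(j | P j) E j r) = fun r => \sum_(j <- enum P) E j r.
  by apply/funext => r; rewrite big_enum.
have : all P (enum P) by apply/allP => j; rewrite mem_enum.
elim: (enum P) => [_|j s IH /= /andP[/h[s1 l1] /IH[s2 l2]]] /=.
  have z r : \sum_(j <- [::]) E j r = 0 by rewrite big_nil.
  have -> : (fun r => \sum_(j <- [::]) E j r) = fun=> 0 by apply/funext.
  have m0 : cmeas (fun _ : R => 0 : R[i]) by exact: cmeas_cst.
  have [|s0 l0] := @sqint_jap _ (fun _ : R => 0 : R[i]) 0 m0 (lexx 0) _.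
    by move=> r; rewrite cmod0 mul0r.
  by split => //; apply: le_trans l0 _; rewrite expr0n mulr0 expr0 mul1r.
have -> : (fun r => \sum_(j0 <- (j :: s)) E j0 r) = fun r => E j r + \sum_(j0 <- s) E j0 r.
  by apply/funext => r; rewrite big_cons.
have [s3 l3] := sqintD s1 s2; split => //; apply: le_trans l3 _.
apply: le_trans (_ : 2 * c + 2 * (4 ^+ size s * c) <= _).
  by apply: lerD; apply: ler_wpM2l.
have e1 : 1 <= 4 ^+ size s :> R by rewrite exprn_ege1// ler1n.
rewrite exprS; have h1 : c <= 4 ^+ size s * c by rewrite ler_peMl.
by lra.
Qed.

Section PairIntegrals.
Variables (Q Qt : R -> R[i]).
Hypotheses (sQ : sqint Q) (sQt : sqint Qt).
Hypotheses (Q0 : forall t, ~~ (0 < t < pi) -> Q t = 0) (Qt0 : forall t, ~~ (0 < t < pi) -> Qt t = 0).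

Let f x := Q x - Qt x.

Lemma diff_supp t : ~~ (0 < t < pi) -> f t = 0.
Proof. by move=> tp; rewrite /f Q0// Qt0// subrr. Qed.

Lemma diff_sqint : sqint f. Proof. by have [] := sqintB sQ sQt. Qed.

Let iQ := sqint_supp_cintegrable sQ Q0.
Let iQt := sqint_supp_cintegrable sQt Qt0.

Lemma lagrange_pairing (y dy z dz : R -> R -> R[i]) r :
  sol Q r (y^~ r) (dy^~ r) -> sol Qt r (z^~ r) (dz^~ r) ->
  (y 0 r * dz 0 r - dy 0 r * z 0 r) - (y pi r * dz pi r - dy pi r * z pi r) = pairing f y z r.
Proof.
move=> hy hz; rewrite (lagrange iQ iQt hy hz (lexx 0) (pi_ge0 R) (lexx pi)).
apply: eq_cint => x; have [xp|/diff_supp] := boolP (0 < x < pi); first by rewrite mul1r.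
by rewrite -/(f x) => ->; rewrite !mul0r.
Qed.

Lemma pairing_spec a M M' y z : jmeas (fun x r => mask x * y x r) ->
  jmeas (fun x r => mask x * z x r) ->
  (forall x, 0 <= x <= pi -> spec (a / 2) M (y x)) ->
  (forall x, 0 <= x <= pi -> spec (a / 2) M' (z x)) ->
  exists M1, spec a M1 (pairing f y z).
Proof.
move=> my mz sy sz; exists (M * M' * \int[mu]_x cmod (f x)).
apply: spec_cint; [exact: cintegrableB|exact: (jmeasM my mz)|].
move=> x fx; have xp : 0 < x < pi by apply: contraNT fx => /diff_supp ->.
have xx : 0 <= x <= pi by case/andP: xp => /ltW -> /ltW ->.
have := specM (sy x xx) (sz x xx); rewrite -splitr.
by apply: eq_spec => r; rewrite maskE// !mul1r.
Qed.

End PairIntegrals.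

Variables (N : nat) (o : 'I_N) (b : R).
Hypotheses (hN : (2 <= N)%N) (b0 : 0 < b).

Let N21 : N.-1 = N.-2.+1. Proof. by case: N hN => // -[]. Qed.

Let K := edge_const b.
Let T := prod_const N b.
Let K1 : 1 <= K. Proof. exact: edge_const_ge1. Qed.
Let K0 : 0 <= K. Proof. exact: le_trans ler01 K1. Qed.
Let T0 : 0 <= T.
Proof. by rewrite exprn_ge0// mulr_ge0. Qed.

Section Graphs.
Variables (Q : 'I_N -> R -> R[i]) (S dS C dC : 'I_N -> R -> R -> R[i]).
Variables (Qt : 'I_N -> R -> R[i]) (St dSt Ct dCt : 'I_N -> R -> R -> R[i]).
Hypothesis ed : forall j, edge_data b (Q j) (S j) (dS j) (C j) (dC j).
Hypothesis edt : forall j, edge_data b (Qt j) (St j) (dSt j) (Ct j) (dCt j).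

Let fq j x := Q j x - Qt j x.
Let rS j x r := rc r * S j x r.
Let rSt j x r := rc r * St j x r.
Let ps := psi o S dS C dC.
Let pst := psi o St dSt Ct dCt.
Let ch := chi o S C.
Let cht := chi o St Ct.
Let D := Dl o S dS C.
Let Dt := Dl o St dSt Ct.

(** The value at 0 of psi_k psi~_k' - psi_k' psi~_k. *)
Definition gcross k r : R[i] := rc r ^+ N.-1 * Dk o S dS C dC k r * (rc r ^+ N.-1 * Dt r)
  - rc r ^+ N.-1 * D r * (rc r ^+ N.-1 * Dk o St dSt Ct dCt k r).

Let lp j := lagrange_pairing (ed_sqint (ed j)) (ed_sqint (edt j)) (ed_supp (ed j)) (ed_supp (edt j)).

(** On edge k the Lagrange identity gives [gcross] minus its boundary term at pi, which is r (X Y~ -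
    Y X~). By [gCross] the latter is a sum over the other edges, each term being a Lagrange identity
    for chi on edge o or for r S_j on edge j. *)
Lemma gcrossE k r : k != o -> gcross k r = pairing (fq k) (ps k) (pst k) r
  + (Ps S o k r * Ps St o k r * pairing (fq o) ch cht r
  + \sum_(j | (j != o) && (j != k)) Ps S j k r * Ps St j k r * pairing (fq j) (rS j) (rSt j) r).
Proof.
move=> ko.
have <- := lp (sol_psi o ed k r) (sol_psi o edt k r).
have <- := lp (sol_chi o ed r) (sol_chi o edt r).
rewrite !(psi_pi ed) ?(psi_pi edt) ?(dpsi_pi hN ed) ?(dpsi_pi hN edt)//.
rewrite !(psi_0 o ed) !(psi_0 o edt) !(dpsi_0 o ed) !(dpsi_0 o edt).
rewrite !(chi_0 o ed) !(chi_0 o edt) !(dchi_0 o ed) !(dchi_0 o edt) !chi_pi.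
have hj j : pairing (fq j) (rS j) (rSt j) r =
    rc r * (dS j pi r * sp St j r - sp S j r * dSt j pi r).
  have <- := @lp j (rS j) (fun x r => rc r * dS j x r) (rSt j) (fun x r => rc r * dSt j x r) r
    (solZ (rc r) (ed_solS (ed j) r)) (solZ (rc r) (ed_solS (edt j) r)).
  by rewrite /rS /rSt (ed_S0 (ed j)) (ed_S0 (edt j)) /sp; ring.
under eq_bigr do rewrite hj mulrCA.
have := gCross (sp S ^~ r) (fun j => dS j pi r) (fun j => C j pi r) (sp St ^~ r)
  (fun j => dSt j pi r) (fun j => Ct j pi r) ko.
rewrite -!/(Xs _ _ _ _ _ _) -!/(Ys _ _ _) -!/(Ps _ _ _ _) => h.
rewrite -mulr_sumr.
have -> : \sum_(i | (i != o) && (i != k)) Ps S i k r * Ps St i k r *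
    (dS i pi r * sp St i r - sp S i r * dSt i pi r) =
    Xs o S dS C k r * Ys St k r - Ys S k r * Xs o St dSt Ct k r
    - Ps S o k r * Ps St o k r * (C o pi r * sp St o r - sp S o r * Ct o pi r).
  by rewrite h addrAC subrr add0r.
by rewrite /gcross /D /Dt !mul0r; ring.
Qed.

Let d0p (x : R) : 0 <= x <= pi -> - pi <= 0 - (pi - x).
Proof. by move=> /andP[x0 _]; rewrite sub0r lerN2 lerBlDr lerDl. Qed.

Let half2pi : (- 2 * pi) / 2 = - pi :> R. Proof. by field. Qed.

Let chi_pairing_spec : exists M, spec (- 2 * pi) M (pairing (fq o) ch cht).
Proof.
apply: (@pairing_spec _ _ (ed_sqint (ed o)) (ed_sqint (edt o)) (ed_supp (ed o)) (ed_supp (edt o))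
  (- 2 * pi) (growth b) (growth b)); rewrite ?half2pi.
- exact: (chi_jmeas o b0 ed).
- exact: (chi_jmeas o b0 edt).
- by move=> x xp; apply: spec_le (chi_spec o b0 ed xp) => //; exact: d0p.
- by move=> x xp; apply: spec_le (chi_spec o b0 edt xp) => //; exact: d0p.
Qed.

Let rS_pairing_spec j : exists M, spec (- 2 * pi) M (pairing (fq j) (rS j) (rSt j)).
Proof.
apply: (@pairing_spec _ _ (ed_sqint (ed j)) (ed_sqint (edt j)) (ed_supp (ed j)) (ed_supp (edt j))
  (- 2 * pi) (K) (K)); rewrite ?half2pi.
- exact: rS_jmeas b0 (ed j).
- exact: rS_jmeas b0 (edt j).
- by move=> x xp; apply: spec_le (rS_spec b0 (ed j) xp) => //; rewrite lerN2; case/andP: xp.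
- by move=> x xp; apply: spec_le (rS_spec b0 (edt j) xp) => //; rewrite lerN2; case/andP: xp.
Qed.

Let rest k r : R[i] := Ps S o k r * Ps St o k r * pairing (fq o) ch cht r
  + \sum_(j | (j != o) && (j != k)) Ps S j k r * Ps St j k r * pairing (fq j) (rS j) (rSt j) r.

(** Each term contains two products of N - 2 factors r S_l(pi) and a pairing with exponents at least
    - 2 pi. The sum is where the exponents of psi_k psi~_k end as x reaches pi, which is the
    separation that [stage] requires. *)
Let restspec k : k != o -> exists M, spec (2 * (N.-1%:R * - pi)) M (rest k).
Proof.
move=> ko; have ok : o != k by rewrite eq_sym.
have aE : N.-2%:R * - pi + N.-2%:R * - pi + - 2 * pi = 2 * (N.-1%:R * - pi) :> R.
  by rewrite N21 -natr1; ring.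
have [M1 h1] := chi_pairing_spec.
have s1 := specM (specM (Ps_spec b0 ed ok) (Ps_spec b0 edt ok)) h1.
have [|M2 h2] := @spec_sum _ [pred j | (j != o) && (j != k)] (2 * (N.-1%:R * - pi))
    (fun j r => Ps S j k r * Ps St j k r * pairing (fq j) (rS j) (rSt j) r).
  move=> j /andP[_ jk]; have [M h] := rS_pairing_spec j.
  have := specM (specM (Ps_spec b0 ed jk) (Ps_spec b0 edt jk)) h.
  by rewrite aE => ?; eexists; eassumption.
by rewrite aE in s1; eexists; exact: specD s1 h2.
Qed.

Definition lead1 : R[i] := psi_lead R N * psi_lead R N.
Definition const1 : R := 3 * (psi_const N b * psi_const N b).

Let mlin (u : R) : measurable_fun setT (fun x : R => u - (pi - x)).
Proof. by do 2?[apply: measurable_funB => //]; exact: measurable_cst. Qed.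

Let gap (x : R) : 0 < x < pi -> [/\ 0 <= 2 * pi - 2 * x, 2 * pi - 2 * x <= 2 * (pi - x)
  & 2 * pi - 2 * x <= 2 * (pi - x)].
Proof.
move=> /andP[_ /ltW xp]; have -> : 2 * pi - 2 * x = 2 * (pi - x) by ring.
by rewrite mulr_ge0 ?subr_ge0.
Qed.

Let pair_psi_front k : k != o ->
  front (fun x => 2 * (N.-1%:R * - pi) - 2 * pi + 2 * x) (fun x => 2 * pi - 2 * x) lead1 const1
    (fun x r => (mask x * ps k x r) * (mask x * pst k x r)).
Proof.
move=> ko; have := frontM (mlin _) (mlin _) gap (psi_front hN b0 ed ko) (psi_front hN b0 edt ko).
by apply: eq_front => // x; ring.
Qed.

(** The conclusion of [stage] is taken as a hypothesis, so that its constant can be fixed before the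
    potentials. *)
Lemma stage_leaf K2 c2 k : (forall (f : R -> R[i]) (B : R -> R -> R[i]) (J : R -> R[i]) (p MJ c2 : R),
    sqint f -> (forall x, ~~ (0 < x < pi) -> f x = 0) ->
    front (fun x => p + 2 * x) (fun x => 2 * pi - 2 * x) lead1 const1 B ->
    spec (p + 2 * pi) MJ J ->
    sqint (fun r => cint (fun x => f x * B x r) + J r) ->
    sqnorm (fun r => cint (fun x => f x * B x r) + J r) <= c2 ->
    sqnorm f <= K2 * c2) ->
  k != o -> sqint (gcross k) -> sqnorm (gcross k) <= c2 -> sqnorm (fq k) <= K2 * c2.
Proof.
move=> st ko sg lg; have [MJ sJ] := restspec ko.
have gE : gcross k = fun r => cint (fun x => fq k x * ((mask x * ps k x r) * (mask x * pst k x r))) + rest k r.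
  by apply/funext => r; exact: gcrossE.
have sJ' : spec (2 * (N.-1%:R * - pi) - 2 * pi + 2 * pi) MJ (rest k) by rewrite subrK.
apply: (st (fq k) _ (rest k) _ MJ c2 _ _ (pair_psi_front ko) sJ').
- exact: diff_sqint (ed_sqint (ed k)) (ed_sqint (edt k)).
- by move=> x xp; exact: (diff_supp (ed_supp (ed k)) (ed_supp (edt k)) xp).
- by rewrite -gE.
- by rewrite -gE.
Qed.

Definition lead2 : R[i] := (hi R ^+ N.-2 * hi R ^+ N.-2) * (hi R * hi R).
Definition const2 : R := 3 * ((3 * (T * T)) * (3 * ((1 + growth b + growth b) * (1 + growth b + growth b)))).

Let pair_chi_front k : k != o ->
  front (fun x => 2 * (N.-2%:R * - pi) - 2 * pi + 2 * x) (fun x => 2 * pi - 2 * x) lead2 const2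
    (fun x r => (Ps S o k r * Ps St o k r) * ((mask x * ch x r) * (mask x * cht x r))).
Proof.
move=> ko; have ok : o != k by rewrite eq_sym.
have mcst (u : R) : measurable_fun setT (fun _ : R => u) by exact: measurable_cst.
have g2 (x : R) : 0 < x < pi -> [/\ 0 <= 2 * pi :> R, 2 * pi <= 2 * pi :> R & 2 * pi <= 2 * pi :> R].
  by move=> _; rewrite mulr_ge0 ?pi_ge0.
have f1 := frontM (mcst _) (mcst _) g2 (front_Ps b0 ed ok) (front_Ps b0 edt ok).
have m2 : measurable_fun setT (fun x : R => - (pi - x)).
  by apply: measurableT_comp => //; apply: measurable_funB => //; exact: measurable_cst.
have f2 := frontM m2 m2 gap (chi_front o b0 ed) (chi_front o b0 edt).
have g3 (x : R) : 0 < x < pi -> [/\ 0 <= 2 * pi - 2 * x, 2 * pi - 2 * x <= 2 * pi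
    & 2 * pi - 2 * x <= 2 * pi - 2 * x].
  by move=> xp; have [? _ _] := gap xp; split => //; rewrite lerBlDr lerDl mulr_ge0// ltW//; case/andP: xp.
have m3 : measurable_fun setT (fun x : R => - (pi - x) + - (pi - x)) by exact: measurable_funD.
have := frontM (mcst _) m3 g3 f1 f2.
by apply: eq_front => // x; ring.
Qed.

Hypothesis mean0 : forall j, cint (fq j) = 0.

Definition uconst1 : R := upper_const (psi_const N b).
Definition uconst2 : R := upper_const (T * K).

Let psi_const0 k : k != o -> 0 <= psi_const N b.
Proof. by move=> ko; exact: front_ge0 (psi_front hN b0 ed ko). Qed.

Lemma psi_pairing_le k : k != o -> sqint (pairing (fq k) (ps k) (pst k)) /\
  sqnorm (pairing (fq k) (ps k) (pst k)) <= uconst1 * sqnorm (fq k).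
Proof.
move=> ko; have [A [B [mA mB bA bB h]]] := psi_upper hN b0 ed ko.
have [At [Bt [mAt mBt bAt bBt ht]]] := psi_upper hN b0 edt ko.
have sf := diff_sqint (ed_sqint (ed k)) (ed_sqint (edt k)).
have f0 := diff_supp (ed_supp (ed k)) (ed_supp (edt k)).
exact: (upper_estimate (psi_const0 ko) sf f0 (mean0 k) mA mB mAt mBt bA bB bAt bBt
  (psi_jmeas hN b0 ed ko) (psi_jmeas hN b0 edt ko) h ht).
Qed.

(** The product P of the values on other edges depends on r alone and is attached to the solution,
    which brings the terms of [gcross] to the form of [upper_estimate]. *)
Let rS_upper (q0 : R -> R[i]) s0 ds0 c0 dc0 (P : R -> R[i]) : edge_data b q0 s0 ds0 c0 dc0 -> cmeas P ->
  (forall r, cmod (P r) <= T) ->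
  [/\ cmeas (fun r => - hi R * P r), cmeas (fun r => hi R * P r),
   (forall r, cmod (- hi R * P r) <= T * K) /\ (forall r, cmod (hi R * P r) <= T * K),
   jmeas (fun x r => P r * (mask x * (rc r * s0 x r))) &
   forall x r, 0 < x < pi -> cmod (P r * (mask x * (rc r * s0 x r))
     - (- hi R * P r * cis (x * r) + hi R * P r * cis (- x * r))) <= T * K * jap r].
Proof.
move=> e mP bP.
have h2 r : cmod (hi R * P r) <= T * K.
  rewrite cmodM cmod_hi mulrC; apply: ler_pM; rewrite ?cmod_ge0 ?invr_ge0//.
  by apply: le_trans K1; rewrite invf_le1// ler1n.
split.
- by apply: cmeasM => //; exact: cmeas_cst.
- by apply: cmeasM => //; exact: cmeas_cst.
- by split => // r; rewrite mulNr cmodN.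
- by apply: jmeasM; [exact: (jmeas2 mP)|exact: (rS_jmeas b0 e)].
move=> x r xp; have xx : 0 <= x <= pi by case/andP: xp => /ltW -> /ltW ->.
have -> : P r * (mask x * (rc r * s0 x r))
     - (- hi R * P r * cis (x * r) + hi R * P r * cis (- x * r)) =
   P r * (rc r * s0 x r - rc (sin (r * x))).
  by rewrite maskE// sin_cis -[- (r * x)]mulrN [r * - x]mulrC [r * x]mulrC; ring.
rewrite cmodM -mulrA; apply: ler_pM; rewrite ?cmod_ge0//.
exact: (rS_jap b0 e r xx).
Qed.

Lemma rS_pairing_le j k : j != k ->
  sqint (fun r => Ps S j k r * Ps St j k r * pairing (fq j) (rS j) (rSt j) r) /\
  sqnorm (fun r => Ps S j k r * Ps St j k r * pairing (fq j) (rS j) (rSt j) r)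
    <= uconst2 * sqnorm (fq j).
Proof.
move=> jk; have sP := Ps_spec b0 ed jk; have sPt := Ps_spec b0 edt jk.
have [mA mB [bA bB] my h] := rS_upper (ed j) (spec_meas sP) (spec_bound sP).
have [mAt mBt [bAt bBt] myt ht] := rS_upper (edt j) (spec_meas sPt) (spec_bound sPt).
have sf := diff_sqint (ed_sqint (ed j)) (ed_sqint (edt j)).
have f0 := diff_supp (ed_supp (ed j)) (ed_supp (edt j)).
have TK0 : 0 <= T * K by rewrite mulr_ge0.
have := upper_estimate TK0 sf f0 (mean0 j) mA mB mAt mBt bA bB bAt bBt my myt h ht.
set F := (fun r => cint _); have -> // : F = fun r => Ps S j k r * Ps St j k r * pairing (fq j) (rS j) (rSt j) r.
apply/funext => r; rewrite /F /pairing -cintZ; last first.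
  have := cintegrable_lagrange (sqint_supp_cintegrable (ed_sqint (ed j)) (ed_supp (ed j)))
    (sqint_supp_cintegrable (ed_sqint (edt j)) (ed_supp (edt j)))
    (solZ (rc r) (ed_solS (ed j) r)) (solZ (rc r) (ed_solS (edt j) r)).
  exact.
by apply: eq_cint => x; rewrite /rS /rSt /fq; ring.
Qed.

(** Once the differences on the other edges are known, their terms are subtracted from [gcross], at
    the price of their L2 bounds. Only the term of edge o remains, and [stage] applies with J =
    0. *)
Lemma stage_root K2 c2 c3 k :
  (forall (f : R -> R[i]) (B : R -> R -> R[i]) (J : R -> R[i]) (p MJ c2 : R),
    sqint f -> (forall x, ~~ (0 < x < pi) -> f x = 0) ->
    front (fun x => p + 2 * x) (fun x => 2 * pi - 2 * x) lead2 const2 B ->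
    spec (p + 2 * pi) MJ J ->
    sqint (fun r => cint (fun x => f x * B x r) + J r) ->
    sqnorm (fun r => cint (fun x => f x * B x r) + J r) <= c2 ->
    sqnorm f <= K2 * c2) ->
  k != o -> sqint (gcross k) -> sqnorm (gcross k) <= c2 -> 0 <= c3 ->
  (forall j, j != o -> sqnorm (fq j) <= c3) ->
  sqnorm (fq o) <= K2 * (2 * c2 + 2 * (2 * (uconst1 * c3) + 2 * (4 ^+ N.-2 * (uconst2 * c3)))).
Proof.
move=> st ko sg lg c30 hj; have ok : o != k by rewrite eq_sym.
have u10 : 0 <= uconst1.
  by rewrite mulr_ge0 ?sqr_ge0// addr_ge0 ?mulr_ge0 ?sqr_ge0 ?pi_ge0.
have u20 : 0 <= uconst2.
  by rewrite mulr_ge0 ?sqr_ge0// addr_ge0 ?mulr_ge0 ?sqr_ge0 ?pi_ge0.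
have [s1 l1] := psi_pairing_le ko.
have [|j /andP[jo jk]|s2 l2] := @sqint_sum _ [pred j | (j != o) && (j != k)] (uconst2 * c3)
  (fun j r => Ps S j k r * Ps St j k r * pairing (fq j) (rS j) (rSt j) r).
- by rewrite mulr_ge0.
- have [s l] := rS_pairing_le jk; split => //; apply: le_trans l _.
  by apply: ler_wpM2l => //; exact: hj.
have [s3 l3] := sqintD s1 s2; have [s4 l4] := sqintB sg s3.
set F := (fun r => gcross k r - _) in s4 l4.
have FE : F = fun r => cint (fun x => fq o x * ((Ps S o k r * Ps St o k r) *
    ((mask x * ch x r) * (mask x * cht x r)))) + 0.
  apply/funext => r; rewrite /F gcrossE// addr0.
  transitivity (Ps S o k r * Ps St o k r * pairing (fq o) ch cht r); first by ring.
  rewrite /pairing -cintZ; last first.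
    have := cintegrable_lagrange (sqint_supp_cintegrable (ed_sqint (ed o)) (ed_supp (ed o)))
      (sqint_supp_cintegrable (ed_sqint (edt o)) (ed_supp (edt o)))
      (sol_chi o ed r) (sol_chi o edt r).
    exact.
  by apply: eq_cint => x; rewrite mulrCA.
apply: (st (fq o) _ (fun=> 0) _ 0 _ _ _ (pair_chi_front ko) (spec0 _)).
- exact: diff_sqint (ed_sqint (ed o)) (ed_sqint (edt o)).
- by move=> x xp; exact: (diff_supp (ed_supp (ed o)) (ed_supp (edt o)) xp).
- by rewrite -FE.
rewrite -FE; apply: le_trans l4 _; apply: lerD; first by apply: ler_wpM2l.
apply: ler_wpM2l => //; apply: le_trans l3 _; apply: lerD; apply: ler_wpM2l => //.
  by apply: le_trans l1 _; apply: ler_wpM2l => //; exact: hj.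
by rewrite card_neq2// in l2.
Qed.

End Graphs.
End Pair.

(** * From extended-real L2 norms to squared norms *)

Section SquareNorms.
Variable R : realType.
Local Notation mu := (@lebesgue_measure R).
Local Notation rc := (real_complex R).
Implicit Types (f g : R -> R[i]) (D : set R).

Lemma L2normE D f g : (forall x, g x = rc (\1_D x) * f x) ->
  L2norm D f = ((\int[mu]_x (cmod (g x) ^+ 2)%:E) `^ 2^-1)%E.
Proof.
move=> gE; rewrite /L2norm unlock; congr (_ `^ _)%E; apply: eq_integral => x _.
have h : cmod (g x) = \1_D x * cmod (f x).
  by rewrite gE cmodM cmod_real ger0_norm// indicE.
by rewrite -h /= ger0_norm ?cmod_ge0// powR_mulrn ?cmod_ge0.
Qed.

Lemma L2norm_sqint D f g : (forall x, g x = rc (\1_D x) * f x) -> sqint g ->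
  L2norm D f = (Num.sqrt (sqnorm g))%:E.
Proof.
move=> gE [mg ig]; rewrite (L2normE gE).
have -> : (\int[mu]_x (cmod (g x) ^+ 2)%:E = (sqnorm g)%:E)%E.
  by rewrite /sqnorm /Rintegral fineK//; exact: (integrable_fin_num measurableT ig).
by rewrite poweR_EFin powR12_sqrt// sqnorm_ge0.
Qed.

Lemma L2norm_lty D f g : (forall x, g x = rc (\1_D x) * f x) -> cmeas g ->
  (L2norm D f < +oo)%E -> sqint g.
Proof.
move=> gE mg; rewrite (L2normE gE) => h; split => //; apply/integrableP; split.
  by apply/measurable_EFinP; exact: measurable_sqr_cmod.
have -> : (\int[mu]_x `|(EFin \o (fun x => cmod (g x) ^+ 2)%R) x| =
    \int[mu]_x (cmod (g x) ^+ 2)%:E)%E.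
  by apply: eq_integral => x _ /=; rewrite ger0_norm// sqr_ge0.
rewrite ltey; apply/eqP => e; move: h; rewrite e poweRyr ?ltxx//.
Qed.

End SquareNorms.

(** * Stability with respect to the cross expressions *)

Section Core.
Variable R : realType.
Local Notation mu := (@lebesgue_measure R).
Local Notation rc := (real_complex R).
Variables (N : nat) (o : 'I_N) (b : R).
Hypotheses (hN : (2 <= N)%N) (b0 : 0 < b).

Let N21 : N.-1 = N.-2.+1. Proof. by case: N hN => // -[]. Qed.

Lemma other_edge : exists k, k != o.
Proof.
have : (0 < #|[pred k : 'I_N | k != o]|)%N by rewrite card_neq N21.
by case/card_gt0P => k; exists k.
Qed.

Lemma gcross_stability : exists2 A, 0 <= A &
  forall (Q : 'I_N -> R -> R[i]) (S dS C dC : 'I_N -> R -> R -> R[i])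
    (Qt : 'I_N -> R -> R[i]) (St dSt Ct dCt : 'I_N -> R -> R -> R[i]) c2,
    (forall j, edge_data b (Q j) (S j) (dS j) (C j) (dC j)) ->
    (forall j, edge_data b (Qt j) (St j) (dSt j) (Ct j) (dCt j)) ->
    (forall j, cint (fun x => Q j x - Qt j x) = 0) ->
    (forall k, k != o -> sqint (gcross o S dS C dC St dSt Ct dCt k) /\
      sqnorm (gcross o S dS C dC St dSt Ct dCt k) <= c2) ->
    forall j, sqnorm (fun x => Q j x - Qt j x) <= A * c2.
Proof.
have hi0 : hi R != 0 by rewrite eq_complex /= eqxx /= invr_eq0 pnatr_eq0.
have l1 : lead1 R N != 0 by rewrite mulf_neq0 ?psi_lead_neq0.
have l2 : lead2 R N != 0 by rewrite !mulf_neq0 ?expf_neq0.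
have [K1 K10 st1] := stage (const1 N b) l1.
have [K2 K20 st2] := stage (const2 N b) l2.
pose U1 := uconst1 N b; pose U2 := uconst2 N b.
have U10 : 0 <= U1 by rewrite mulr_ge0 ?sqr_ge0// addr_ge0 ?mulr_ge0 ?sqr_ge0 ?pi_ge0.
have U20 : 0 <= U2 by rewrite mulr_ge0 ?sqr_ge0// addr_ge0 ?mulr_ge0 ?sqr_ge0 ?pi_ge0.
(* The bound of [stage_root] for c3 = K1 * c2, with c2 factored out. *)
pose A2 := K2 * (2 + 2 * (2 * (U1 * K1) + 2 * (4 ^+ N.-2 * (U2 * K1)))).
have A20 : 0 <= A2.
  apply: mulr_ge0 => //; apply: addr_ge0 => //; apply: mulr_ge0 => //; apply: addr_ge0.
    by apply: mulr_ge0 => //; apply: mulr_ge0.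
  by apply: mulr_ge0 => //; apply: mulr_ge0; [exact: exprn_ge0|exact: mulr_ge0].
exists (K1 + A2); first exact: addr_ge0.
move=> Q S dS C dC Qt St dSt Ct dCt c2 ed edt mean0 hg.
have [k ko] := other_edge; have [sg lg] := hg k ko.
have c20 : 0 <= c2 by exact: le_trans (sqnorm_ge0 _) lg.
have leaf j : j != o -> sqnorm (fun x => Q j x - Qt j x) <= K1 * c2.
  by move=> jo; have [s l] := hg j jo; exact: (stage_leaf hN b0 ed edt st1 jo s l).
move=> j; have [->|jo] := eqVneq j o; last first.
  by apply: le_trans (leaf j jo) _; apply: ler_wpM2r => //; rewrite lerDl.
have := stage_root hN b0 ed edt mean0 st2 ko sg lg (mulr_ge0 K10 c20) leaf.
move=> /le_trans; apply; rewrite -/U1 -/U2.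
apply: le_trans (_ : A2 * c2 <= _); last by apply: ler_wpM2r => //; rewrite lerDr.
by rewrite le_eqVlt; apply/orP; left; apply/eqP; rewrite /A2; ring.
Qed.

End Core.

(** * From potentials on the open edge to functions on the line *)

Section Conversion.
Variables (R : realType) (N : nat).
Local Notation mu := (@lebesgue_measure R).
Local Notation rc := (real_complex R).

(** The hypotheses constrain q on the edge only, while the estimates integrate over the whole
    line. *)
Definition cutoff (q : R -> R[i]) (x : R) : R[i] := rc ((0 < x < pi)%R : bool)%:R * q x.

Lemma indic_edge (x : R) : (\1_(@edge R) x : R) = ((0 < x < pi)%R : bool)%:R.
Proof. by rewrite /edge indicE mem_setE in_itv. Qed.

Lemma cutoffE q x : cutoff q x = rc (\1_(@edge R) x) * q x.
Proof. by rewrite /cutoff indic_edge. Qed.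

Lemma cutoff_cmeas q : cmeasurable (@edge R) q -> cmeas (cutoff q).
Proof.
have mE : measurable (@edge R) by rewrite /edge; exact: measurable_itv.
move=> [/(measurable_restrictT _ mE) h1 /(measurable_restrictT _ mE) h2]; split.
- have -> // : (fun x => ReC (cutoff q x)) = (fun x => ReC (q x)) \_ (@edge R).
  apply/funext => x; rewrite /cutoff Re_mul /= mul0r subr0 patchE /edge mem_setE in_itv /=.
  by case: ifP; rewrite ?mul1r ?mul0r.
have -> // : (fun x => ImC (cutoff q x)) = (fun x => ImC (q x)) \_ (@edge R).
apply/funext => x; rewrite /cutoff Im_mul /= mul0r addr0 patchE /edge mem_setE in_itv /=.
by case: ifP; rewrite ?mul1r ?mul0r.
Qed.

Lemma cutoff_edge_data (r : R) q (Y : edge_solutions q) : 0 < r -> inL2 (@edge R) q ->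
  (L2norm (@edge R) q < r%:E)%E ->
  edge_data (r ^+ 2) (cutoff q) (fun x t => solS Y x (rc t ^+ 2)) (fun x t => dsolS Y x (rc t ^+ 2))
    (fun x t => solC Y x (rc t ^+ 2)) (fun x t => dsolC Y x (rc t ^+ 2)).
Proof.
move=> r0 [mq fq] lq; have mc := cutoff_cmeas mq.
have sq : sqint (cutoff q) := L2norm_lty (cutoffE q) mc fq.
have qE (x : R) : 0 < x < pi -> cutoff q x = q x by move=> xp; rewrite /cutoff xp mul1r.
split => //.
- by move=> t /negbTE tp; rewrite /cutoff tp mul0r.
- move: lq; rewrite (L2norm_sqint (cutoffE q) sq) lte_fin => /ltW h.
  by rewrite -(sqr_sqrtr (sqnorm_ge0 (cutoff q))) ler_sqr ?nnegrE ?sqrtr_ge0// ltW.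
- by move=> t; apply: SL_sol qE _; exact: solS_eq.
- by move=> t; apply: SL_sol qE _; exact: solC_eq.
- by move=> t; have [] := solS_init Y (rc t ^+ 2).
- by move=> t; have [] := solS_init Y (rc t ^+ 2).
- by move=> t; have [] := solC_init Y (rc t ^+ 2).
- by move=> t; have [] := solC_init Y (rc t ^+ 2).
Qed.

Lemma cutoff_mean q qt : cintegrable (cutoff q) -> cintegrable (cutoff qt) ->
  2^-1 * cintegral (@edge R) q = 2^-1 * cintegral (@edge R) qt ->
  cint (fun x => cutoff q x - cutoff qt x) = 0.
Proof.
move=> i1 i2 h; have n2 : (2^-1 : R[i]) != 0 by rewrite invr_neq0// pnatr_eq0.
rewrite cintB//; have := mulfI n2 h; rewrite /edge !cint_itv => e.
by apply/eqP; rewrite subr_eq0; apply/eqP.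
Qed.

End Conversion.

(** * Bounding the cross expressions by the spectral distance *)

Section GcrossBound.
Variable R : realType.
Local Notation rc := (real_complex R).
Variables (N : nat) (o : 'I_N) (b : R).
Hypotheses (hN : (2 <= N)%N) (b0 : 0 < b).
Variables (Q : 'I_N -> R -> R[i]) (S dS C dC : 'I_N -> R -> R -> R[i]).
Variables (Qt : 'I_N -> R -> R[i]) (St dSt Ct dCt : 'I_N -> R -> R -> R[i]).
Hypothesis ed : forall j, edge_data b (Q j) (S j) (dS j) (C j) (dC j).
Hypothesis edt : forall j, edge_data b (Qt j) (St j) (dSt j) (Ct j) (dCt j).

Let dl r : R[i] := rc r ^+ N * (Dl o S dS C r - Dl o St dSt Ct r).
Let dk k r : R[i] := rc r ^+ N.-1 * (Dk o S dS C dC k r - Dk o St dSt Ct dCt k r).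

Let N21 : N.-1 = N.-2.+1. Proof. by case: N hN => // -[]. Qed.
Let powN r : rc r ^+ N = rc r * rc r ^+ N.-1.
Proof. by rewrite -exprS prednK// ltnW. Qed.
Let powN1 r : rc r ^+ N.-1 = rc r * rc r ^+ N.-2.
Proof. by rewrite -exprS -N21. Qed.

Let cmeas_r : cmeas (fun r : R => rc r).
Proof. by apply: cmeas_real; exact: measurable_id. Qed.

Lemma dl_cmeas : cmeas dl.
Proof.
have [k ko] := other_edge o hN.
have h := cmeasM cmeas_r (cmeasB (Dl_cmeas hN b0 ed ko) (Dl_cmeas hN b0 edt ko)).
by apply: eq_cmeas h => r; rewrite /dl powN -mulrBr mulrA.
Qed.

Lemma dk_cmeas k : k != o -> cmeas (dk k).
Proof.
move=> ko; have h := cmeasM cmeas_r (cmeasB (Dk_cmeas hN b0 ed ko) (Dk_cmeas hN b0 edt ko)).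
by apply: eq_cmeas h => r; rewrite /dk powN1 -mulrBr mulrA.
Qed.

(** [gcross] equals r^(N-1) Delta~ times [dk] minus r^(N-2) Delta~_k times [dl]. Both prefactors are
    bounded by [delta_const], which is where the weights r^(N-1) and r^N of the spectral distance
    fit. *)
Lemma gcross_le k e2 : k != o -> sqint dl -> sqnorm dl <= e2 -> sqint (dk k) ->
  sqnorm (dk k) <= e2 -> sqint (gcross o S dS C dC St dSt Ct dCt k) /\
  sqnorm (gcross o S dS C dC St dSt Ct dCt k) <= 4 * delta_const N b ^+ 2 * e2.
Proof.
move=> ko s1 l1 s2 l2.
have [s3 l3] := sqint_bM (Dl_cmeas hN b0 edt ko) (fun r => Dl_le hN b0 edt r ko) s2.
have [s4 l4] := sqint_bM (Dk_cmeas hN b0 edt ko) (fun r => Dk_le hN b0 edt r ko) s1.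
have [s5 l5] := sqintB s3 s4.
set F := (fun x => _) in s5 l5.
have -> : gcross o S dS C dC St dSt Ct dCt k = F.
  apply/funext => r; rewrite /F /gcross /dk /dl powN powN1; ring.
split => //; apply: le_trans l5 _.
have d0 : 0 <= delta_const N b ^+ 2 by exact: sqr_ge0.
have h1 := le_trans l3 (ler_wpM2l d0 l2); have h2 := le_trans l4 (ler_wpM2l d0 l1).
apply: le_trans (lerD (ler_wpM2l _ h1) (ler_wpM2l _ h2)) _ => //.
by rewrite -mulrDl -natrD mulrA.
Qed.

End GcrossBound.

Theorem theorem4 (R : realType) (N : nat) (hN : (2 <= N)%N) (r : R) (hr : 0 < r) :
  exists2 A : R, 0 < A &
    forall (q qt : 'I_N -> R -> R[i])
           (Y : forall j, edge_solutions (q j)) (Yt : forall j, edge_solutions (qt j)),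
      is_potential q -> is_potential qt ->
      (forall j, omega q j = omega qt j) ->
      (potential_norm q < r%:E)%E -> (potential_norm qt < r%:E)%E ->
      (potential_norm (fun j x => (q j x - qt j x)%R)
         <= A%:E * spectral_distance (Ordinal (ltnW hN)) Y Yt)%E.
Proof.
set o := Ordinal (ltnW hN); have b0 : 0 < r ^+ 2 by rewrite exprn_gt0.
have [A A0 core] := gcross_stability o hN b0.
pose G := A * (4 * delta_const N (r ^+ 2) ^+ 2).
have G0 : 0 <= G by rewrite mulr_ge0// mulr_ge0// sqr_ge0.
have H0 : 0 < 1 + Num.sqrt G by rewrite ltr_wpDr// sqrtr_ge0.
(* The square root undoes the passage to squared norms; the summand 1 makes the constant
   positive. *)
exists (1 + Num.sqrt G) => // q qt Y Yt pq pqt om nq nqt.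
(* If the distance is infinite, so is the right-hand side. Otherwise each norm in it is finite, and
   the functions concerned are square integrable. *)
have [dfin|] := boolP (spectral_distance o Y Yt < +oo)%E; last first.
  by rewrite -leNgt leye_eq => /eqP ->; rewrite gt0_muley ?leey ?lte_fin.
have nq' j : (L2norm (@edge R) (q j) < r%:E)%E.
  by apply: le_lt_trans nq; exact: (le_bigmax _ (fun j => L2norm (@edge R) (q j))).
have nqt' j : (L2norm (@edge R) (qt j) < r%:E)%E.
  by apply: le_lt_trans nqt; exact: (le_bigmax _ (fun j => L2norm (@edge R) (qt j))).
have ed j := cutoff_edge_data (Y j) hr (pq j) (nq' j).
have edt j := cutoff_edge_data (Yt j) hr (pqt j) (nqt' j).
have icut j := sqint_supp_cintegrable (ed_sqint (ed j)) (ed_supp (ed j)).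
have icutt j := sqint_supp_cintegrable (ed_sqint (edt j)) (ed_supp (edt j)).
have mean0 j := cutoff_mean (icut j) (icutt j) (om j).
have mdl := dl_cmeas o hN b0 ed edt.
have mdk k (ko : k != o) := dk_cmeas hN b0 ed edt ko.
pose dl rho := real_complex R rho ^+ N *
  (Delta o Y (real_complex R rho ^+ 2) - Delta o Yt (real_complex R rho ^+ 2)).
pose dk k rho := real_complex R rho ^+ N.-1 *
  (DeltaK o Y (real_complex R rho ^+ 2) k - DeltaK o Yt (real_complex R rho ^+ 2) k).
have indT (g : R -> R[i]) x : g x = real_complex R (\1_setT x) * g x by rewrite indicT mul1r.
have d0 : (0 <= L2norm setT dl)%E by exact: Lnorm_ge0.
have dk0 k : (0 <= L2norm setT (dk k))%E by exact: Lnorm_ge0.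
have sum0 : (0 <= \sum_(k < N | k != o) L2norm setT (dk k))%E by apply: sume_ge0.
have dist : spectral_distance o Y Yt =
  (L2norm setT dl + \sum_(k < N | k != o) L2norm setT (dk k))%E by [].
rewrite dist in dfin *.
have sdl : sqint dl.
  apply: (L2norm_lty (indT dl) mdl); apply: le_lt_trans dfin.
  exact: leeDl.
have sdk k : k != o -> sqint (dk k).
  move=> ko; apply: (L2norm_lty (indT (dk k)) (mdk k ko)); apply: le_lt_trans dfin.
  rewrite (bigD1 k)//=; apply: le_trans (leeDr _ d0); apply: leeDl.
  exact: sume_ge0.
pose e := Num.sqrt (sqnorm dl) + \sum_(k < N | k != o) Num.sqrt (sqnorm (dk k)).
have eE : (L2norm setT dl + \sum_(k < N | k != o) L2norm setT (dk k))%E = e%:E.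
  rewrite (L2norm_sqint (indT dl) sdl) EFinD -sumEFin; congr (_ + _)%E.
  by apply: eq_bigr => k ko; rewrite (L2norm_sqint (indT (dk k)) (sdk k ko)).
have s0 : 0 <= \sum_(k < N | k != o) Num.sqrt (sqnorm (dk k)).
  by apply: sumr_ge0 => k _; exact: sqrtr_ge0.
have e0 : 0 <= e by rewrite addr_ge0 ?sqrtr_ge0.
have sq_le (g : R -> R[i]) : Num.sqrt (sqnorm g) <= e -> sqnorm g <= e ^+ 2.
  by move=> h; rewrite -(sqr_sqrtr (sqnorm_ge0 g)) ler_sqr ?nnegrE ?sqrtr_ge0.
have ldl : sqnorm dl <= e ^+ 2 by apply: sq_le; rewrite lerDl.
have ldk k : k != o -> sqnorm (dk k) <= e ^+ 2.
  move=> ko; apply: sq_le; rewrite /e (bigD1 k)//= addrCA lerDl addr_ge0 ?sqrtr_ge0//.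
  by apply: sumr_ge0 => j _; exact: sqrtr_ge0.
have hg k (ko : k != o) := @gcross_le R N o (r ^+ 2) hN b0
  (fun j x t => solS (Y j) x (real_complex R t ^+ 2))
  (fun j x t => dsolS (Y j) x (real_complex R t ^+ 2))
  (fun j x t => solC (Y j) x (real_complex R t ^+ 2))
  (fun j x t => dsolC (Y j) x (real_complex R t ^+ 2))
  _ _ _ _ _ edt k (e ^+ 2) ko sdl ldl (sdk k ko) (ldk k ko).
have fin := core _ _ _ _ _ _ _ _ _ _ _ ed edt mean0 hg.
rewrite eE -EFinM; apply/bigmax_leP; split.
  by rewrite lee_fin mulr_ge0// ltW.
move=> j _; have sf := diff_sqint (ed_sqint (ed j)) (ed_sqint (edt j)).
have gE x : cutoff (q j) x - cutoff (qt j) x = real_complex R (\1_(@edge R) x) * (q j x - qt j x).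
  by rewrite !cutoffE mulrBr.
rewrite (L2norm_sqint gE sf) lee_fin.
apply: le_trans (_ : Num.sqrt (G * e ^+ 2) <= _).
  by apply: ler_wsqrtr; apply: le_trans (fin j) _; rewrite /G -!mulrA.
rewrite sqrtrM// sqrtr_sqr ger0_norm//; apply: ler_wpM2r => //.
by rewrite lerDr.
Qed.
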